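(* Suppose that the problem is mildly ill-posed with regularity $\alpha\ge0$, i.e. there are constants $C_1,C_2>0$ such that $C_1(1+k^2)^{-\alpha/2}\le|\rho_k|\le C_2(1+k^2)^{-\alpha/2}$ as $k\to\infty$, that $f_0\in H^\gamma(\mathbb{H}_1)$ for some $\gamma>0$, and assign $f$ the mean-zero Gaussian prior distribution $\Pi=N(0,\Lambda)$ on $\mathbb{H}_1$, where the covariance operator $\Lambda$ has the same eigenvectors $\{e_k\}$ as $A^*A$, with eigenvalues $\tau_k^2=(1+k^2)^{-\delta-1/2}$, $\delta>0$. Then for a sufficiently large constant $C>0$, $$\Pi\left(f\in\mathbb{H}_1:\|f-f_0\|_1>C\,n^{-\frac{\delta\wedge\gamma}{2\alpha+2\delta+1}}\ \Big|\ Y\right)\to0$$ in $\mathbb{P}_{f_0}$-probability as $n\to\infty$.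
   Context: $\mathbb{H}_1,\mathbb{H}_2$ are separable Hilbert spaces with inner products $\langle\cdot,\cdot\rangle_i$ and norms $\|\cdot\|_i$, $i=1,2$. $A:\mathbb{H}_1\to\mathbb{H}_2$ is a known, injective, continuous linear operator with adjoint $A^*$. It is assumed throughout that there is an orthonormal basis $\{e_k\}_{k\ge 1}$ of $\mathbb{H}_1$ consisting of eigenvectors of $A^*A$, with $A^*Ae_k=\rho_k^2 e_k$ ($A$ need not be compact), and $\{g_k\}$ is the conjugate orthonormal system in $\mathbb{H}_2$ (an orthonormal basis of the range of $A$) defined by $Ae_k=\rho_k g_k$. Write $f_k=\langle f,e_k\rangle_1$, and $a\wedge b=\min(a,b)$. Model: for each $n\ge1$ one observes $Y=Y^{(n)}=Af+n^{-1/2}Z$, where $Z$ is Gaussian white noise on $\mathbb{H}_2$, interpreted as the Gaussian process $Y=(Y_h:h\in\mathbb{H}_2)$, $Y_h=\langle Af,h\rangle_2+n^{-1/2}Z_h$, where $(Z_h)$ is a mean-zero Gaussian process with $\mathbb{E}Z_hZ_{h'}=\langle h,h'\rangle_2$. Its law is denoted $\mathbb{P}_f$. Equivalently, one observes the independent variables $Y_k:=Y_{g_k}\sim N(\rho_kf_k,n^{-1})$, $k\ge1$. The data $Y$ are generated from $\mathbb{P}_{f_0}$. Posterior: for a prior $\Pi$ on a $\sigma$-algebra $\mathcal{B}$, with support $\mathcal{P}$, the posterior is $\Pi(B\mid Y)=\int_B e^{n\sum_k\rho_kf_kY_k-\frac n2\|Af\|_2^2}d\Pi(f)\big/\int_{\mathcal{P}}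 e^{n\sum_k\rho_kf_kY_k-\frac n2\|Af\|_2^2}d\Pi(f)$, $B\in\mathcal{B}$. Sobolev scale: for $s\ge0$, $H^s(\mathbb{H}_1)=\{f\in\mathbb{H}_1:\|f\|_{H^s}^2:=\sum_{k\ge1}f_k^2(1+k^2)^s<\infty\}$. Gaussian measures: $N(0,\Lambda)$ is the law of a random element $G$ of $\mathbb{H}_1$ such that $(\langle G,h\rangle_1:h\in\mathbb{H}_1)$ is a mean-zero Gaussian process with covariance $\mathrm{cov}(\langle G,h\rangle_1,\langle G,h'\rangle_1)=\langle h,\Lambda h'\rangle_1$; here $\Lambda$ is positive semi-definite, self-adjoint and trace class. *)

(* Defs.v *)
From HB Require Import structures.
From mathcomp Require Import all_boot all_order all_algebra.
From mathcomp Require Import all_classical all_reals all_analysis.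

Set Implicit Arguments.
Unset Strict Implicit.
Unset Printing Implicit Defensive.

Import Order.TTheory GRing.Theory Num.Theory.
Import numFieldNormedType.Exports.

Local Open Scope classical_set_scope.
Local Open Scope ring_scope.

HB.mixin Record hasInner (R : realType) H of NormedModule R H := {
  inner : {dot H for (@idfun R)} ;
  inner_norm : forall x : H, inner x x = `|x| ^+ 2
}.

#[short(type="hilbertType")]
HB.structure Definition Hilbert (R : realType) :=
  {H of CompleteNormedModule R H & hasInner R H}.

Section hilbert.
Context {R : realType}.
Implicit Types H : hilbertType R.

Definition separable (T : topologicalType) := exists2 D : set T, countable D & dense D.

Definition orthonormal_system H (e : nat -> H) :=
  forall i j, inner (e i) (e j) = (i == j)%:R.

Definition orthonormal_basis H (e : nat -> H) :=
  orthonormal_system e /\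
  forall f : H, series (fun k => inner f (e k) *: e k) @ \oo --> f.

Definition is_adjoint (H1 H2 : hilbertType R) (A : H1 -> H2) (A' : H2 -> H1) :=
  forall f h, inner (A f) h = inner f (A' h).

(* Sequences indexed by k >= 1 in the mathematics are indexed by nat here, the
   entry of index k : nat standing for the (k+1)-st one; accordingly this is
   the weight 1 + k^2 of that entry. *)
Definition weight (k : nat) : R := 1 + k.+1%:R ^+ 2.

Definition sobolev H (e : nat -> H) (s : R) : set H :=
  [set f | (\sum_(0 <= k <oo) (inner f (e k) ^+ 2 * weight k `^ s)%:E < +oo)%E].

Definition mildly_ill_posed (rho : nat -> R) (alpha : R) :=
  exists C1 C2 : R, [/\ 0 < C1, 0 < C2 &
    \forall k \near \oo, C1 * weight k `^ (- (alpha / 2)) <= `|rho k|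
                         <= C2 * weight k `^ (- (alpha / 2))].

End hilbert.

Section gaussian.
Context {R : realType}.

(* [normal_prob m 0] is not the Dirac mass at m but a junk value, hence the
   case distinction. *)
Definition gaussian_prob (m s : R) : set R -> \bar R :=
  if s == 0 then \d_m else normal_prob m s.

Definition gaussian_rv d (Om : measurableType d) (P : probability Om R)
    (X : Om -> R) :=
  measurable_fun [set: Om] X /\
  exists m s : R, 0 <= s /\
    forall B : set R, measurable B -> P (X @^-1` B) = gaussian_prob m s B.

Definition gaussian_process d (Om : measurableType d) (P : probability Om R)
    (I : Type) (X : I -> Om -> R) :=
  forall (m : nat) (t : 'I_m -> I) (c : 'I_m -> R),
    gaussian_rv P (fun w => \sum_(i < m) c i * X (t i) w).

Definition centered_gaussian_process d (Om : measurableType d)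
    (P : probability Om R) (I : Type) (X : I -> Om -> R) (K : I -> I -> R) :=
  [/\ gaussian_process P X,
      forall t, ('E_P[X t] = 0)%E
    & forall t u, covariance P (X t) (X u) = (K t u)%:E].

Definition white_noise (H : hilbertType R) d (Om : measurableType d)
    (P : probability Om R) (Z : H -> Om -> R) :=
  centered_gaussian_process P Z (fun h h' => inner h h').

Definition borel (T : ptopologicalType) := g_sigma_algebraType (@open T).

Definition self_adjoint (H : hilbertType R) (L : H -> H) := is_adjoint L L.

Definition positive_semidefinite (H : hilbertType R) (L : H -> H) :=
  forall h, 0 <= inner h (L h).

(* Meant for a positive semi-definite L, for which |L| = L. *)
Definition trace_class (H : hilbertType R) (L : H -> H) :=
  forall b : nat -> H, orthonormal_basis b ->
    (\sum_(0 <= k <oo) (inner (b k) (L (b k)))%:E < +oo)%E.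

Definition covariance_operator (H : hilbertType R) (L : {linear H -> H}) :=
  [/\ continuous L, self_adjoint L, positive_semidefinite L & trace_class L].

Definition gaussian_measure (H : hilbertType R)
    (Pi : probability (borel H) R) (L : {linear H -> H}) :=
  covariance_operator L /\
  exists (d : measure_display) (Om : measurableType d) (Q : probability Om R)
      (G : {RV Q >-> borel H}),
    (forall B : set (borel H), measurable B -> Pi B = distribution Q G B) /\
    centered_gaussian_process Q (fun (h : H) w => inner (G w : H) h)
      (fun h h' => inner h (L h')).

End gaussian.

Section inverse_problem.
Context {R : realType} {H1 H2 : hilbertType R}.

(* The process Y_h = <A f, h> + n^(-1/2) Z_h. *)
Definition observation (A : H1 -> H2) (f : H1) (n : nat) Om (Z : H2 -> Om -> R)
    (h : H2) (w : Om) : R :=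
  inner (A f) h + n%:R `^ (- 2^-1) * Z h w.

Definition measure_support (Pi : probability (borel H1) R) : set H1 :=
  [set f | forall U : set H1, open U -> U f -> (0 < Pi U)%E].

(* The log-likelihood of f given the values y k of Y at g_k.  The series
   converges for almost every pair (f, y); elsewhere [limn] has a default
   value. *)
Definition log_likelihood (A : H1 -> H2) (e : nat -> H1) (rho : nat -> R)
    (n : nat) (y : nat -> R) (f : H1) : R :=
  n%:R * limn (series (fun k => rho k * inner f (e k) * y k))
  - n%:R / 2 * `|A f| ^+ 2.

Definition posterior (A : H1 -> H2) (e : nat -> H1) (g : nat -> H2)
    (rho : nat -> R) (Pi : probability (borel H1) R) (n : nat) (Y : H2 -> R)
    (B : set H1) : R :=
  let lik f := expR (log_likelihood A e rho n (fun k => Y (g k)) f) in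
  (\int[Pi]_(f in B) lik f) / (\int[Pi]_(f in measure_support Pi) lik f).

End inverse_problem.

Definition cvg_in_probability (R : realType) (d : nat -> measure_display)
    (Om : forall n, measurableType (d n)) (P : forall n, probability (Om n) R)
    (X : forall n, Om n -> R) (x : R) :=
  forall eps : R, 0 < eps ->
    (fun n => P n [set w | eps < `|X n w - x|]) @ \oo --> (0%E : \bar R).

(* Main.v *)
Require Import Defs.
From HB Require Import structures.
From mathcomp Require Import all_boot all_order all_algebra.
From mathcomp Require Import ring lra.
From mathcomp Require Import all_classical all_reals all_analysis.
From mathcomp Require Import measurable_realfun.

(** Write x_k for the coordinate of f along e_k.  Under the prior the x_k are
    independent centred Gaussian variables of variances tau_k, and the
    log-likelihood is the sum over k of

      n rho_k y_k x_k - n rho_k^2 x_k^2 / 2,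

    so the posterior is conjugate coordinate by coordinate: x_k has variance
    s_k = tau_k / (1 + n rho_k^2 tau_k) and mean n rho_k y_k s_k.  Let mu_k be
    the error of that mean as an estimate of the coordinate of f0.  The posterior
    mean of |f - f0|^2 is the sum of the s_k and of the mu_k^2, which is of order
    eps_n^2, eps_n being the rate, off an event of small probability.  Since C
    does not grow with n, Markov's inequality is not enough: |f - f0|^2 has to
    concentrate.

    The posterior itself is never identified as a Gaussian measure.  With
    lambda = eps_n^-2, the variable V = exp (- lambda |f - f0|^2) has explicit
    first and second posterior moments ([lik_laplace]), since prior, likelihood
    and V are all exponentials of quadratic functions.  The product formula
    shows that the mean of V is at least exp (- lambda sum (s_k + mu_k^2)), which
    stays away from 0, while the second moment exceeds the squared mean by
    a factor at most exp Q with Q bounded by a multiple of sup_k (lambda s_k)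
    ([sqr_laplace_double]).  By Chebyshev's inequality
    ([laplace_chebyshev]) V seldom falls below half its mean; but V is below half
    its mean wherever |f - f0| > C eps_n, once C is large.  This is
    [posterior_mass_le].

    Put kappa = n^(1 / (2 alpha + 2 delta + 1)), the frequency where the precision
    of the data equals that of the prior.  Then s_k is at most a constant times
    (kappa + k)^(-2 delta - 1) ([post_var_le]), so that the sum of the s_k is of
    order kappa^(-2 delta) and sup_k (lambda s_k) is of order 1 / kappa, which
    tends to 0.  In mu_k the bias is the coordinate of f0 shrunk by
    1 / (1 + n rho_k^2 tau_k), and its square sum is of order kappa^(-2 beta),
    beta = min (delta, gamma), by the Sobolev bound on f0 ([shrinkage_le]).
    The noise part has square at most s_k Z_k^2, where the Z_k are independent
    standard Gaussian, and the sum of the s_k Z_k^2 is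
    controlled with probability tending to 1 by the same Laplace transform and
    Chebyshev argument ([gauss_seq_sqr_tail_sup]).

    Two points of analysis remain.  Independence enters only through the laws of
    linear combinations: a factor exp (- b (x_k - m)^2 / 2) is the Fourier
    transform of a normal law, so a product of such factors becomes an iterated
    integral of cosines of linear combinations ([gauss_seq_bumps_cos]).
    And the log-likelihood is an infinite series in x_k, which has to converge
    for almost every f for the moments to be limits of finite products: its
    variances decrease with a power to spare, and Gaussian tails along
    dyadic blocks give almost sure convergence ([gauss_seq_series_cvg]), while an
    L^2 bound gives convergence of the integrals ([cvg_integral_sqr_bounded]). *)

Set Implicit Arguments.
Unset Strict Implicit.
Unset Printing Implicit Defensive.

Import Order.TTheory GRing.Theory Num.Theory.
Import numFieldNormedType.Exports.

Local Open Scope classical_set_scope.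
Local Open Scope ring_scope.

(** * The normal law *)

Section normal_law.
Context {R : realType}.
Local Notation mu := (@lebesgue_measure R).
Implicit Types m s t x : R.

(** The density of [normal_prob] agrees almost everywhere with its
    Radon-Nikodym derivative, through which integrals are computed. *)
Lemma ge0_integral_normal_prob m s (f : R -> \bar R) :
  measurable_fun [set: R] f -> (forall x, 0 <= f x)%E ->
  (\int[normal_prob m s]_x f x = \int[mu]_x (f x * (normal_pdf m s x)%:E))%E.
Proof.
move=> mf f0.
pose nu : {finite_measure set (g_sigma_algebraType R.-ocitv.-measurable) -> \bar R} := normal_prob m s.
have numu : normal_prob m s `<< mu by exact: normal_prob_dominates.
rewrite -[LHS](@Radon_Nikodym_SigmaFinite.change_of_variables _ _ _ nu mu)//.
apply: ae_eq_integral => //.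
- apply: emeasurable_funM => //.
  exact: (measurable_int mu (Radon_Nikodym_SigmaFinite.f_integrable numu)).
- apply: emeasurable_funM => //.
  by apply/measurable_EFinP; exact: measurable_normal_pdf.
apply: ae_eqe_mul2l.
apply: integral_ae_eq => //=.
- exact: Radon_Nikodym_SigmaFinite.f_integrable.
- by apply/measurable_EFinP; exact: measurable_normal_pdf.
- by move=> A _ mA; rewrite -Radon_Nikodym_SigmaFinite.f_integral.
Qed.

Lemma integral_normal_prob m s (f : R -> R) :
  measurable_fun [set: R] f ->
  (normal_prob m s).-integrable [set: R] (EFin \o f) ->
  mu.-integrable [set: R] (fun x => (f x * normal_pdf m s x)%:E) /\
  (\int[normal_prob m s]_x (f x)%:E = \int[mu]_x (f x * normal_pdf m s x)%:E)%E.
Proof.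
move=> mf /integrableP[_ intf].
have mfe : measurable_fun [set: R] (EFin \o f) by exact/measurable_EFinP.
have pdf0 x : (0 <= (normal_pdf m s x)%:E)%E by rewrite lee_fin normal_pdf_ge0.
have mp : measurable_fun [set: R] (normal_pdf m s) by exact: measurable_normal_pdf.
split.
  apply/integrableP; split.
    by apply/measurable_EFinP; exact: measurable_funM.
  move: intf; rewrite ge0_integral_normal_prob//=; last first.
    by apply/measurable_EFinP; exact: measurableT_comp.
  by under eq_integral do rewrite -EFinM -[X in _ * X]ger0_norm ?normal_pdf_ge0// -normrM.
rewrite integralE [RHS]integralE; congr (_ - _)%E.
  rewrite [LHS](@ge0_integral_normal_prob m s ((EFin \o f)^\+)%E)//; last first.
    exact: measurable_funepos.
  by apply: eq_integral => x _; rewrite !funeposE /= EFinM maxe_pMl// mul0e.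
rewrite [LHS](@ge0_integral_normal_prob m s ((EFin \o f)^\-)%E)//; last first.
  exact: measurable_funeneg.
by apply: eq_integral => x _; rewrite !funenegE /= -mulNr EFinM maxe_pMl// mul0e.
Qed.

(** The Gaussian kernel absorbs a Gaussian factor; b may be negative, which
    gives the exponential square moment behind the tail bound. *)
Lemma normal_pdf_tilt (b m s s' : R) x : 0 < s -> 0 < s' ->
  s' ^- 2 = s ^- 2 + b ->
  expR (- (b * (x - m) ^+ 2 / 2)) * normal_pdf m s x =
  s' / s * normal_pdf m s' x.
Proof.
move=> s0 s'0 ss'.
have sn0 : s != 0 by rewrite gt_eqF.
have s'n0 : s' != 0 by rewrite gt_eqF.
rewrite !normal_pdfE// mulrCA /normal_fun -expRD.
have -> : - (b * (x - m) ^+ 2 / 2) + - (x - m) ^+ 2 / (s ^+ 2 *+ 2) =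
          - (x - m) ^+ 2 / (s' ^+ 2 *+ 2).
  have -> : b = s' ^- 2 - s ^- 2 by rewrite ss' addrC addKr.
  by rewrite -[s ^+ 2 *+ 2]mulr_natr -[s' ^+ 2 *+ 2]mulr_natr; field; rewrite s'n0 sn0.
rewrite mulrA; congr (_ * _).
have peakE u : 0 < u -> normal_peak u = (u * Num.sqrt (pi *+ 2))^-1 :> R.
  move=> u0; rewrite /normal_peak -mulrnAr sqrtrM ?sqr_ge0//.
  by rewrite sqrtr_sqr gtr0_norm.
by rewrite !peakE// !invfM (mulrC s') -(mulrA s^-1) mulVKf.
Qed.

(** Tilting by b = - 1 / (2 s^2) doubles the variance, whence the value. *)
Lemma normal_exp_sqr m s : 0 < s ->
  (\int[normal_prob m s]_x (expR ((x - m) ^+ 2 / (4 * s ^+ 2)))%:E =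
   (Num.sqrt 2)%:E)%E.
Proof.
move=> s0; rewrite ge0_integral_normal_prob//; last first.
  apply/measurable_EFinP; apply: measurableT_comp => //.
  apply: measurable_funM => //; apply: measurable_funX.
  exact: measurable_funB.
have s20 : 0 < Num.sqrt 2 * s by rewrite mulr_gt0.
transitivity (\int[mu]_x ((Num.sqrt 2)%:E * (normal_pdf m (Num.sqrt 2 * s) x)%:E))%E.
  apply: eq_integral => x _; rewrite -!EFinM; congr EFin.
  have e : (Num.sqrt 2 * s) ^- 2 = s ^- 2 + (- (2 * s ^+ 2)^-1) :> R.
    by rewrite exprMn sqr_sqrtr//; field; rewrite gt_eqF.
  transitivity (Num.sqrt 2 * s / s * normal_pdf m (Num.sqrt 2 * s) x); last first.
    by rewrite mulfK ?gt_eqF.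
  rewrite -(normal_pdf_tilt _ _ s0 s20 e); congr (expR _ * _).
  by field; rewrite gt_eqF.
rewrite integralZl//; last exact: integrable_normal_pdf.
by rewrite integral_normal_pdf mule1.
Qed.

End normal_law.

Section stein.
Context {R : realType}.
Local Notation mu := (@lebesgue_measure R).

(** The fundamental theorem of calculus on growing intervals. *)
Lemma integral_derive_eq0 (F f : R -> R) :
  (forall x : R, is_derive x (1 : R) F (f x)) -> continuous f ->
  mu.-integrable [set: R] (EFin \o f) ->
  F n%:R @[n --> \oo] --> 0 -> F (- n%:R) @[n --> \oo] --> 0 ->
  (\int[mu]_x (f x)%:E = 0)%E.
Proof.
move=> Ff cf intf Fy FNy.
pose I (n : nat) : set R := [set` `[- n.+1%:R : R, n.+1%:R]].
have mI n : measurable (I n) by exact: measurable_itv.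
have mf : measurable_fun [set: R] f by exact: continuous_measurable_fun.
have FTC n : (\int[mu]_(x in I n) (f x)%:E = (F n.+1%:R - F (- n.+1%:R))%:E)%E.
  rewrite (@continuous_FTC2 _ f F)//.
  - by rewrite -subr_gt0 opprK -natrD ltr0n addSn.
  - exact: continuous_subspaceT.
  - have cF : continuous F.
      by move=> x; apply/differentiable_continuous/derivable1_diffP; have [] := Ff x.
    split=> [x _||]; first by have [] := Ff x.
    + by apply: cvg_at_right_filter; exact: cF.
    + by apply: cvg_at_left_filter; exact: cF.
  - by move=> x _; rewrite derive1E; have [_ ->] := Ff x.
have [|||||_ _ cvgf] := @dominated_convergence _ _ R mu [set: R] measurableT
  (fun n => ((EFin \o f) \_ (I n))) (EFin \o f) (fun x => `|(f x)%:E|%E).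
- move=> n; apply/(measurable_restrictT _ (mI n)).
  by apply: measurable_funTS; exact/measurable_EFinP.
- exact/measurable_EFinP.
- apply: aeW => x _; apply: cvg_near_cst; near=> n.
  rewrite /patch mem_set// /I/= in_itv/= -ler_norml.
  near: n; exists (Num.trunc `|x|) => // n /= xn.
  by rewrite (le_trans (ltW (truncnS_gt _)))// ler_nat ltnS.
- exact: integrable_abse.
- by apply: aeW => x n _; rewrite /patch; case: ifPn => //; rewrite abse0 abse_ge0.
apply: cvg_unique cvgf _ => //=.
rewrite (_ : (fun _ => _) = (fun n => (F n.+1%:R - F (- n.+1%:R))%:E)); last first.
  by apply/funext => n; rewrite -FTC [RHS]integral_mkcond.
apply: cvg_EFin; first exact: nearW.
rewrite -[0](subr0 0); apply: cvgB.
- by rewrite (cvg_shiftS (fun n => F n%:R)).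
- by rewrite (cvg_shiftS (fun n => F (- n%:R))).
Unshelve. all: end_near. Qed.

Variables (m s : R) (s0 : 0 < s).
Local Notation N := (normal_prob m s).

(** Quadratic growth is dominated by the exponential square moment. *)
Lemma normal_integrable_le (C : R) (f : R -> R) : measurable_fun [set: R] f ->
  (forall x, `|f x| <= C * (1 + (x - m) ^+ 2)) ->
  N.-integrable [set: R] (EFin \o f).
Proof.
move=> mf fC.
have C0 : 0 <= C.
  by rewrite -(@pmulr_lge0 _ (1 + (m - m) ^+ 2)) ?(le_trans _ (fC m))// subrr expr0n addr0.
pose g x := expR ((x - m) ^+ 2 / (4 * s ^+ 2)).
have mg : measurable_fun [set: R] g.
  apply: measurableT_comp => //; apply: measurable_funM => //.
  by apply: measurable_funX; exact: measurable_funB.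
have intg : N.-integrable [set: R] (fun x => ((C * (1 + 4 * s ^+ 2))%:E * (g x)%:E)%E).
  apply: integrableZl => //; apply/integrableP; split; first exact/measurable_EFinP.
  under eq_integral do rewrite /= ger0_norm ?expR_ge0//.
  by rewrite normal_exp_sqr// ltry.
apply: le_integrable intg => //; first exact/measurable_EFinP.
move=> x _; rewrite /= lee_fin (le_trans (fC x))// -mulrA normrM (ger0_norm C0).
have g0 : 0 <= g x by exact: expR_ge0.
have s2 : 0 < 4 * s ^+ 2 by rewrite mulr_gt0 ?exprn_gt0.
rewrite ler_wpM2l// ger0_norm; last by rewrite mulr_ge0// addr_ge0 ?ltW.
have g1 : 1 + (x - m) ^+ 2 / (4 * s ^+ 2) <= g x by exact: expR_ge1Dx.
have d0 : 0 <= (x - m) ^+ 2 / (4 * s ^+ 2) by rewrite divr_ge0 ?sqr_ge0 ?ltW.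
have dE : (x - m) ^+ 2 = (x - m) ^+ 2 / (4 * s ^+ 2) * (4 * s ^+ 2).
  by rewrite divfK ?gt_eqF.
move: g1 s2 d0 dE; set K := 4 * s ^+ 2; set q := (x - m) ^+ 2 / K => g1 K0 q0 ->.
by have := mulr_ge0 (ltW K0) (_ : 0 <= g x - (1 + q)); rewrite subr_ge0 => /(_ g1); lra.
Qed.

(** Integration by parts against the Gaussian density, whose derivative is
    - (x - m) / s^2 times itself. *)
Lemma stein (C : R) (G G' : R -> R) :
  (forall x : R, is_derive x (1 : R) G (G' x)) -> continuous G' ->
  (forall x, `|G x| <= C * (1 + `|x - m|)) ->
  (forall x, `|G' x| <= C * (1 + (x - m) ^+ 2)) ->
  (\int[N]_x (G' x - (x - m) / s ^+ 2 * G x)%:E = 0)%E.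
Proof.
move=> dG cG' GC G'C.
have sn0 : s != 0 by rewrite gt_eqF.
pose D x := G' x - (x - m) / s ^+ 2 * G x.
have C0 : 0 <= C.
  by rewrite -(@pmulr_lge0 _ (1 + `|m - m|)) ?(le_trans _ (GC m))// subrr normr0 addr0.
have cG : continuous G.
  by move=> x; apply/differentiable_continuous/derivable1_diffP; have [] := dG x.
have cD : continuous D.
  move=> x; apply: cvgB; first exact: cG'.
  apply: cvgM; last exact: cG.
  by apply: cvgM; [apply: cvgB; [exact: cvg_id|exact: cvg_cst]|exact: cvg_cst].
have mD : measurable_fun [set: R] D by exact: continuous_measurable_fun.
have intD : N.-integrable [set: R] (EFin \o D).
  apply: (@normal_integrable_le (C + 2 * C / s ^+ 2)) => // x.
  rewrite /D (le_trans (ler_normB _ _))// [leRHS]mulrDl lerD//.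
  have -> : `|(x - m) / s ^+ 2 * G x| = `|x - m| * `|G x| / s ^+ 2.
    by rewrite mulrAC !normrM normfV (ger0_norm (sqr_ge0 s)).
  rewrite [leRHS]mulrAC ler_wpM2r ?invr_ge0 ?sqr_ge0//.
  apply: (le_trans (ler_wpM2l _ (GC x))) => //.
  rewrite -(real_normK (num_real (x - m))); move: (normr_ge0 (x - m)) C0.
  set u := `|x - m| => u0 C0'.
  have : 0 <= C * ((u - 1) ^+ 2 + u) by rewrite mulr_ge0// addr_ge0 ?sqr_ge0.
  have : 0 <= C * u ^+ 2 by rewrite mulr_ge0 ?sqr_ge0.
  have : 0 <= C * (1 - u)^+2 by rewrite mulr_ge0 ?sqr_ge0.
  nra.
have [intDp ->] := integral_normal_prob mD intD.
pose p := normal_pdf m s.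
have dp x : is_derive x (1 : R) p (- (x - m) / s ^+ 2 * p x).
  pose h (y : R) := - (2 * s ^+ 2)^-1 * (y - m) ^+ 2.
  have -> : p = (fun y => normal_peak s * expR (h y)).
    rewrite /p normal_pdfE//; apply/funext => y; congr (_ * expR _).
    by rewrite /h -[s ^+ 2 *+ 2]mulr_natr; field.
  have dh : is_derive x (1 : R) h (- (x - m) / s ^+ 2).
    rewrite /h; apply: is_derive_eq.
    by rewrite /GRing.scale/=; field.
  have := is_derive1_comp (is_derive_expR (h x)) dh => dexp.
  apply: is_derive_eq.
  by rewrite /GRing.scale/=; ring.
pose K := C * (normal_peak s * (1 + 4 * s ^+ 2)).
have FK x : `|G x * p x| * `|x - m| <= K.
  have p_le : p x <= normal_peak s / (1 + (x - m) ^+ 2 / (2 * s ^+ 2)).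
    rewrite /p normal_pdfE// ler_wpM2l ?normal_peak_ge0// /normal_fun mulNr expRN.
    have w0 : 0 < 1 + (x - m) ^+ 2 / (2 * s ^+ 2).
      by rewrite ltr_wpDr// divr_ge0 ?sqr_ge0// mulr_ge0 ?sqr_ge0.
    rewrite lef_pV2 ?posrE ?expR_gt0// -[s ^+ 2 *+ 2]mulr_natl.
    exact: expR_ge1Dx.
  have p0 : 0 <= p x by exact: normal_pdf_ge0.
  rewrite normrM (ger0_norm p0) mulrAC.
  have -> : K = C * (1 + 4 * s ^+ 2) * normal_peak s by rewrite /K; ring.
  have Gd : `|G x| * `|x - m| <= C * (1 + 2 * (x - m) ^+ 2).
    apply: (le_trans (ler_wpM2r _ (GC x))) => //.
    rewrite -mulrA ler_wpM2l// -(real_normK (num_real (x - m))).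
    by have := sqr_ge0 (`|x - m| - 1); nra.
  have Gd0 : 0 <= `|G x| * `|x - m| by rewrite mulr_ge0.
  apply: (le_trans (ler_pM Gd0 p0 Gd p_le)).
  rewrite [leLHS]mulrA [leLHS]mulrAC ler_wpM2r ?normal_peak_ge0//.
  have s2 : 0 < 2 * s ^+ 2 by rewrite mulr_gt0 ?exprn_gt0.
  have w0 : 0 <= (x - m) ^+ 2 / (2 * s ^+ 2) by rewrite divr_ge0 ?sqr_ge0// ltW.
  have dE : (x - m) ^+ 2 = (x - m) ^+ 2 / (2 * s ^+ 2) * (2 * s ^+ 2).
    by rewrite divfK ?gt_eqF.
  move: s2 w0 dE; set w := (x - m) ^+ 2 / _ => s2 w0 ->.
  have w1 : 0 < 1 + w by rewrite ltr_wpDr.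
  rewrite ler_pdivrMr//.
  by rewrite -[leRHS]mulrA ler_wpM2l//; nra.
have Fcvg (u : nat -> R) : (forall n, n%:R - `|m| <= `|u n - m|) ->
    G (u n) * p (u n) @[n --> \oo] --> 0.
  move=> un; apply/cvgr0Pnorm_le => /= eps eps0; near=> n.
  rewrite leNgt; apply/negP => Feps.
  have nK : K / eps < n%:R - `|m|.
    rewrite ltrBrDr; near: n; exists (Num.trunc (K / eps + `|m|)).+1 => // n /= xn.
    by rewrite (lt_le_trans (truncnS_gt _))// ler_nat.
  have := FK (u n); apply/negP; rewrite -ltNge.
  have K0 : 0 <= K by rewrite /K !mulr_ge0 ?normal_peak_ge0// addr_ge0// mulr_ge0 ?sqr_ge0.
  have nm0 : 0 < n%:R - `|m| by apply: le_lt_trans nK; rewrite divr_ge0// ltW.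
  rewrite (@lt_le_trans _ _ (eps * (n%:R - `|m|)))//.
    by rewrite mulrC -ltr_pdivrMr.
  by rewrite ler_pM// ltW.
apply: (@integral_derive_eq0 (fun x => G x * p x)) => //.
- move=> x; apply: is_derive_eq.
  by rewrite /D/= /GRing.scale/= -/p; ring.
- move=> x; apply: cvgM; first exact: cD.
  exact: continuous_normal_pdf.
- apply: Fcvg => n.
  by rewrite (le_trans _ (lerB_dist _ _))// normr_nat.
- apply: Fcvg => n.
  by rewrite (le_trans _ (lerB_dist _ _))// normrN normr_nat.
Unshelve. all: end_near. Qed.

End stein.

Section normal_moments.
Context {R : realType}.
Variables (m s : R) (s0 : 0 < s).
Local Notation N := (normal_prob m s).

Let sn0 : s != 0. Proof. by rewrite gt_eqF. Qed.

Lemma normal_centered_mean : (\int[N]_x (x - m)%:E = 0)%E.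
Proof.
have /= := @stein R m s s0 1 (cst 1) (cst 0).
move=> /(_ _ _ _ _)H.
have {}H : (\int[N]_x (0 - (x - m) / s ^+ 2 * 1)%:E = 0)%E.
  apply: H => //= x.
  - exact: cvg_cst.
  - by rewrite normr1 mul1r lerDl.
  - by rewrite normr0 mul1r addr_ge0 ?sqr_ge0.
have := congr1 (fun z => (- s ^+ 2)%:E * z)%E H; rewrite mule0 => <-.
rewrite -integralZl//.
  apply: eq_integral => x _; rewrite -EFinM; congr EFin.
  by field.
apply: (@normal_integrable_le _ _ _ s0 (s ^- 2)) => //.
  apply: measurable_funB => //; apply: measurable_funM => //.
  by apply: measurable_funM => //; exact: measurable_funB.
move=> x; rewrite sub0r mulr1 normrN normrM normfV (ger0_norm (sqr_ge0 s)) mulrC.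
rewrite ler_wpM2l ?invr_ge0 ?sqr_ge0// -(real_normK (num_real (x - m))).
have := sqr_ge0 (`|x - m| - 1); have := normr_ge0 (x - m); nra.
Qed.

Lemma normal_centered_var : (\int[N]_x ((x - m) ^+ 2)%:E = (s ^+ 2)%:E)%E.
Proof.
have H : (\int[N]_x (1 - (x - m) / s ^+ 2 * (x - m))%:E = 0)%E.
  apply: (@stein R m s s0 1 (fun x => x - m) (cst 1)) => //= x.
  - by apply: is_derive_eq; rewrite subr0.
  - exact: cvg_cst.
  - by rewrite mul1r lerDr.
  - by rewrite normr1 mul1r lerDl sqr_ge0.
have i1 : N.-integrable [set: R] (EFin \o (fun x : R => s ^+ 2)).
  by apply: (@normal_integrable_le _ _ _ s0 (s ^+ 2)) => // x;
    rewrite ger0_norm ?sqr_ge0// ler_peMr ?sqr_ge0// lerDl sqr_ge0.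
have i2 : N.-integrable [set: R] (EFin \o (fun x => (x - m) ^+ 2)).
  apply: (@normal_integrable_le _ _ _ s0 1) => //.
    by apply: measurable_funX; exact: measurable_funB.
  by move=> x; rewrite ger0_norm ?sqr_ge0// mul1r lerDr.
have H2 : (\int[N]_x ((s ^+ 2)%:E - ((x - m) ^+ 2)%:E) = 0)%E.
  have := congr1 (fun z => (s ^+ 2)%:E * z)%E H; rewrite mule0 => <-.
  rewrite -integralZl//.
    apply: eq_integral => x _; rewrite -EFinM -EFinB; congr EFin.
    by field.
  apply: (@normal_integrable_le _ _ _ s0 (1 + s ^- 2)) => //.
    apply: measurable_funB => //; apply: measurable_funM => //; last exact: measurable_funB.
    by apply: measurable_funM => //; exact: measurable_funB.
  move=> x; rewrite (le_trans (ler_normB _ _))// normr1 mulrAC -expr2.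
  rewrite ger0_norm; last by rewrite mulr_ge0 ?invr_ge0 ?sqr_ge0.
  have : 0 <= s ^- 2 by rewrite invr_ge0 sqr_ge0.
  by have := sqr_ge0 (x - m); nra.
have fI : (\int[N]_x ((x - m) ^+ 2)%:E)%E \is a fin_num by exact: integrable_fin_num i2.
move: H2; rewrite integralB//= integral_cst//= [X in (_ * X)%E]probability_setT mule1.
by rewrite -(fineK fI) -EFinB => /eqP; rewrite eqe subr_eq0 => /eqP <-.
Qed.

Variable c : R.

Local Notation phi := (fun t : R => \int[N]_x cos (t * (x - m) + c)).

Let int_cos t : N.-integrable [set: R] (EFin \o (fun x => cos (t * (x - m) + c))).
Proof.
apply: (@normal_integrable_le _ _ _ s0 1) => //.
  apply: continuous_measurable_fun => x; apply: continuous_comp; last exact: continuous_cos.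
  apply: cvgD; last exact: cvg_cst.
      by apply: cvgM; [exact: cvg_cst|apply: cvgB; [exact: cvg_id|exact: cvg_cst]].
move=> x; rewrite mul1r (@le_trans _ _ 1)// ?lerDl ?sqr_ge0//.
by rewrite ler_norml cos_geN1 cos_le1.
Qed.

(** The characteristic function solves phi' = - s^2 t phi, by differentiation
    under the integral and Stein's identity for x |-> sin (t (x - m) + c). *)
Lemma normal_cos t : (\int[N]_x (cos (t * (x - m) + c))%:E =
  (cos c * expR (- (s ^+ 2 * t ^+ 2 / 2)))%:E)%E.
Proof.
suff H : phi t = cos c * expR (- (s ^+ 2 * t ^+ 2 / 2)).
  have fi : (\int[N]_x (cos (t * (x - m) + c))%:E)%E \is a fin_num.
    by apply: integrable_fin_num => //; exact: int_cos.
  by rewrite -H /Rintegral fineK.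
have dcos y (x : R) : is_derive x (1 : R) (fun t => cos (t * (y - m) + c)) (- (y - m) * sin (x * (y - m) + c)).
  have h : is_derive x (1 : R) (fun t => t * (y - m) + c) (y - m).
    by apply: is_derive_eq; rewrite scaler0 add0r scaler1 addr0.
  have dc := @is_derive1_comp R cos (fun t => t * (y - m) + c) x _ _ (is_derive_cos _) h.
  by apply: (is_derive_eq dc); ring.
have dsin t' (x : R) : is_derive x (1 : R) (fun x => sin (t' * (x - m) + c)) (t' * cos (t' * (x - m) + c)).
  have h : is_derive x (1 : R) (fun x => t' * (x - m) + c) t'.
    apply: is_derive_eq.
    by rewrite subr0 addr0 /GRing.scale/= mulr1.
  have dc := @is_derive1_comp R sin (fun x => t' * (x - m) + c) x _ _ (is_derive_sin _) h.
  by apply: (is_derive_eq dc); ring.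
have dphi (t' : R) : is_derive t' (1 : R) phi (- (s ^+ 2 * t') * phi t').
  pose f (u x : R) := cos (u * (x - m) + c).
  have It : `]t' - 1, t' + 1[%classic t' by rewrite /= in_itv/= ltrBlDr ltrDl ltr01.
  have df u x : derivable (f ^~ x) u 1 by have [] := dcos x u.
  have dfE u x : partial1of2 f u x = - (x - m) * sin (u * (x - m) + c).
    by rewrite partial1of2E; have [_ ->] := dcos x u.
  have intG : N.-integrable [set: R] (EFin \o (fun x => `|x - m|)).
    apply: (@normal_integrable_le _ _ _ s0 1).
      by apply: measurableT_comp => //; exact: measurable_funB.
    move=> x; rewrite normr_id mul1r -(real_normK (num_real (x - m))).
    by have := sqr_ge0 (`|x - m| - 1); have := normr_ge0 (x - m); nra.
  have G_ub u x : `|partial1of2 f u x| <= `|x - m|.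
    rewrite dfE normrM normrN ler_piMr//.
    by rewrite ler_norml sin_geN1 sin_le1.
  have D1 := @derivable_under_integral R _ _ N f _ measurableT t' _ _ It
    (fun u _ => int_cos u) (fun u x _ _ => df u x) _ (fun x => normr_ge0 (x - m))
    intG (fun u x _ _ => G_ub u x).
  have D2 := @differentiation_under_integral R _ _ N f _ measurableT t' _ _ It
    (fun u _ => int_cos u) (fun u x _ _ => df u x) _ (fun x => normr_ge0 (x - m))
    intG (fun u x _ _ => G_ub u x).
  apply: DeriveDef; first exact: D1.
  rewrite -derive1E D2; under eq_Rintegral do rewrite dfE.
  have st : (\int[N]_x (t' * cos (t' * (x - m) + c) - (x - m) / s ^+ 2 * sin (t' * (x - m) + c))%:E = 0)%E.
    apply: (@stein R m s s0 (1 + `|t'|) (fun x => sin (t' * (x - m) + c))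
      (fun x => t' * cos (t' * (x - m) + c))) => /=.
    - move=> x; apply: cvgM; first exact: cvg_cst.
      apply: continuous_comp; last exact: continuous_cos.
      apply: cvgD; last exact: cvg_cst.
      by apply: cvgM; [exact: cvg_cst|apply: cvgB; [exact: cvg_id|exact: cvg_cst]].
    - move=> x; rewrite (@le_trans _ _ 1)//; first by rewrite ler_norml sin_geN1 sin_le1.
      by have := normr_ge0 t'; have := normr_ge0 (x - m); nra.
    - move=> x; rewrite normrM.
      have : `|cos (t' * (x - m) + c)| <= 1 by rewrite ler_norml cos_geN1 cos_le1.
      have := normr_ge0 (cos (t' * (x - m) + c)); have := normr_ge0 t'; have := sqr_ge0 (x - m).
      by nra.
  have int_xsin : N.-integrable [set: R] (EFin \o (fun x => - (x - m) * sin (t' * (x - m) + c))).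
    apply: le_integrable intG => //.
      apply/measurable_EFinP; apply: continuous_measurable_fun => x.
      apply: cvgM; first by apply: cvgN; apply: cvgB; [exact: cvg_id|exact: cvg_cst].
      apply: continuous_comp; last exact: continuous_sin.
      apply: cvgD; last exact: cvg_cst.
      by apply: cvgM; [exact: cvg_cst|apply: cvgB; [exact: cvg_id|exact: cvg_cst]].
    by move=> x _; rewrite /= lee_fin normr_id -dfE.
  have st' : \int[N]_x (t' * cos (t' * (x - m) + c) + s ^- 2 * (- (x - m) * sin (t' * (x - m) + c))) = 0.
    rewrite /Rintegral -[RHS]/(fine 0%E) -st; congr fine; apply: eq_integral => x _.
    by congr EFin; field.
  have it : N.-integrable [set: R] (EFin \o (fun x => t' * cos (t' * (x - m) + c))).
    by apply: (integrableZl measurableT t' (int_cos t')).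
  have ix : N.-integrable [set: R] (EFin \o (fun x => s ^- 2 * (- (x - m) * sin (t' * (x - m) + c)))).
    by apply: (integrableZl measurableT (s ^- 2) int_xsin).
  move: st'; rewrite RintegralD// RintegralZl// ?RintegralZl//.
  move=> /eqP; rewrite addrC addr_eq0 => /eqP e.
  rewrite -[LHS](@mulVKf _ (s ^+ 2)) ?sqrf_eq0//.
  by move: e; set J := s ^- 2 * _; move=> ->; ring.
pose psi t' := phi t' * expR (s ^+ 2 * t' ^+ 2 / 2).
have : psi t = psi 0.
  apply: is_derive_0_is_cst => x.
  pose h (y : R) := s ^+ 2 * y ^+ 2 / 2.
  have dh : is_derive x (1 : R) h (s ^+ 2 * x).
    by rewrite /h; apply: is_derive_eq; rewrite /GRing.scale/=; field.
  have dexp := @is_derive1_comp R expR h x _ _ (is_derive_expR _) dh.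
  by apply: is_derive_eq; rewrite /GRing.scale/= -/(h x); ring.
rewrite /psi expr0n mulr0 mul0r expR0 mulr1 => psiE.
rewrite expRN; apply: (@mulIf _ (expR (s ^+ 2 * t ^+ 2 / 2))).
  by rewrite gt_eqF ?expR_gt0.
rewrite -[RHS]mulrA mulVf ?gt_eqF ?expR_gt0// psiE mulr1.
rewrite /Rintegral; under eq_integral do rewrite mul0r add0r.
by rewrite integral_cst//= [normal_prob _ _ _]probability_setT mule1.
Qed.

End normal_moments.

(** * Gaussian variables and sequences *)

Section gauss_law.
Context {R : realType} d (Om : measurableType d) (P : probability Om R).

(** [gaussian_rv] with its parameters exposed, s being the standard deviation. *)
Definition gauss_law (X : Om -> R) (m s : R) :=
  [/\ measurable_fun [set: Om] X, 0 <= s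
    & forall B : set R, measurable B -> P (X @^-1` B) = gaussian_prob m s B].

Lemma gauss_law_integral X m s C (f : R -> R) : gauss_law X m s ->
  measurable_fun [set: R] f -> (forall x, `|f x| <= C * (1 + (x - m) ^+ 2)) ->
  P.-integrable [set: Om] (EFin \o (f \o X)) /\
  (\int[P]_w (f (X w))%:E =
    if (s == 0)%R then (f m)%:E else \int[normal_prob m s]_x (f x)%:E)%E.
Proof.
move=> [mX s0 lawX] mf fC.
pose Xm : {mfun Om >-> R} := HB.pack X (isMeasurableFun.Build _ _ _ _ X mX).
have mef : measurable_fun [set: R] (EFin \o f) by exact/measurable_EFinP.
have maf : measurable_fun [set: R] (abse \o (EFin \o f)) by exact: measurableT_comp.
case: ifPn => [/eqP|] sE.
  have intD (g : R -> \bar R) : measurable_fun [set: R] g ->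
      (\int[distribution P Xm]_x g x = g m)%E.
    move=> mg; rewrite (@eq_measure_integral _ _ _ _ \d_m) => [|A mA _]; last first.
      by rewrite -[LHS]/(P (X @^-1` A)) lawX// /gaussian_prob sE eqxx.
    by rewrite integral_dirac// diracT mul1e.
  have intf : P.-integrable [set: Om] (EFin \o (f \o X)).
    apply/integrableP; split; first by apply/measurable_EFinP; exact: measurableT_comp.
    rewrite -[X in (X < _)%E](@ge0_integral_distribution _ _ _ _ _ P Xm _ maf (fun y => abse_ge0 _))//.
    by rewrite intD// ltry.
  by split => //; rewrite -[RHS](intD (EFin \o f))// integral_distribution.
have sgt0 : 0 < s by rewrite lt_def sE.
(* The identity carries the normal law to the sigma-algebra on which the law
   of X lives, so that the two can be compared as measures. *)
have mid : measurable_fun [set: measurableTypeR R] (idfun : measurableTypeR R -> R).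
  exact: (@measurable_id _ R setT).
pose J : {mfun (measurableTypeR R) >-> R} :=
  HB.pack (idfun : measurableTypeR R -> R) (isMeasurableFun.Build _ _ _ _ _ mid).
have intD (g : R -> \bar R) :
    (\int[distribution P Xm]_x g x = \int[distribution (normal_prob m s) J]_x g x)%E.
  apply: eq_measure_integral => A mA _.
  rewrite -[LHS]/(P (X @^-1` A)) -[RHS]/(normal_prob m s (idfun @^-1` A)) lawX//.
  by rewrite /gaussian_prob (negbTE sE).
have iN := normal_integrable_le sgt0 mf fC.
have intf : P.-integrable [set: Om] (EFin \o (f \o X)).
  apply/integrableP; split; first by apply/measurable_EFinP; exact: measurableT_comp.
  rewrite -[X in (X < _)%E](@ge0_integral_distribution _ _ _ _ _ P Xm _ maf (fun y => abse_ge0 _))//.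
  rewrite intD (@ge0_integral_distribution _ _ _ _ _ (normal_prob m s) J _ maf (fun y => abse_ge0 _))//.
  by have /integrableP[] := iN.
split => //.
rewrite -[LHS](@integral_distribution _ _ _ _ _ P Xm (EFin \o f))// intD.
by rewrite integral_distribution.
Qed.

Lemma gauss_law_mean X m s : gauss_law X m s ->
  (P.-integrable [set: Om] (EFin \o X)) /\ (\int[P]_w (X w)%:E = m%:E)%E.
Proof.
move=> lX; have [//|x|i ->] := @gauss_law_integral X m s (1 + `|m|) id lX.
  rewrite (le_trans (_ : _ <= `|x - m| + `|m|))//.
    by rewrite -{1}(subrK m x) ler_normD.
  rewrite -(real_normK (num_real (x - m))).
  by have := sqr_ge0 (`|x - m| - 1); have := normr_ge0 (x - m);
    have := normr_ge0 m; nra.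
split=> //; case: ifPn => // sE.
have s0 : 0 < s by case: lX => _ ? _; rewrite lt_def sE.
have := normal_centered_mean m s0 => e.
have i1 : (normal_prob m s).-integrable [set: R] (EFin \o (fun x => x - m)).
  apply: (@normal_integrable_le _ _ _ s0 1); first exact: measurable_funB.
  move=> x; rewrite mul1r -(real_normK (num_real (x - m))).
  by have := sqr_ge0 (`|x - m| - 1); have := normr_ge0 (x - m); nra.
transitivity (\int[normal_prob m s]_x ((x - m)%:E + m%:E))%E.
  by apply: eq_integral => x _; rewrite -EFinD subrK.
have im : (normal_prob m s).-integrable [set: R] (EFin \o cst m).
  by apply: (finite_measure_integrable_cst (normal_prob m s)).
rewrite integralD//= e add0e integral_cst//.
by rewrite [X in (_ * X)%E]probability_setT mule1.
Qed.

Lemma gauss_law_var X m s : gauss_law X m s ->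
  P.-integrable [set: Om] (EFin \o (fun w => (X w - m) ^+ 2)) /\
  (\int[P]_w ((X w - m) ^+ 2)%:E = (s ^+ 2)%:E)%E.
Proof.
move=> lX; have [|x|i ->] := @gauss_law_integral X m s 1 (fun x => (x - m) ^+ 2) lX.
- by apply: measurable_funX; exact: measurable_funB.
- by rewrite mul1r ger0_norm ?sqr_ge0// lerDr.
split => //; case: ifPn => [/eqP ->|sE]; first by rewrite subrr.
by rewrite normal_centered_var//; case: lX => _ ? _; rewrite lt_def sE.
Qed.

Lemma gauss_law_cos X m s t c : gauss_law X m s ->
  (\int[P]_w (cos (t * (X w - m) + c))%:E =
   (cos c * expR (- (s ^+ 2 * t ^+ 2 / 2)))%:E)%E.
Proof.
move=> lX; have [|x|i ->] := @gauss_law_integral X m s 1 (fun x => cos (t * (x - m) + c)) lX.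
- apply: continuous_measurable_fun => x; apply: continuous_comp; last exact: continuous_cos.
  apply: cvgD; last exact: cvg_cst.
  by apply: cvgM; [exact: cvg_cst|apply: cvgB; [exact: cvg_id|exact: cvg_cst]].
- rewrite mul1r (@le_trans _ _ 1)// ?lerDl ?sqr_ge0//.
  by rewrite ler_norml cos_geN1 cos_le1.
case: ifPn => [/eqP ->|sE].
  by rewrite subrr mulr0 add0r expr0n mul0r mul0r oppr0 expR0 mulr1.
by rewrite normal_cos//; case: lX => _ ? _; rewrite lt_def sE.
Qed.

(** Markov's inequality for exp (X^2 / (4 s^2)). *)
Lemma gauss_law_tail X (s v eps : R) : gauss_law X 0 s -> 0 < v -> s ^+ 2 <= v ->
  0 <= eps ->
  (P [set w | (eps < `|X w|)%R] <= (Num.sqrt 2 * expR (- (eps ^+ 2 / (4 * v))))%:E)%E.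
Proof.
move=> lX v0 sv eps0; have [mX s0 lawX] := lX.
pose A : set R := [set x | eps < `|x|].
have mA : measurable A.
  rewrite /A (_ : [set x | _] = (fun x : R => `|x|) @^-1` `]eps, +oo[%classic); last first.
    by apply/seteqP; split => x /=; rewrite in_itv/= andbT.
  by rewrite -[X in measurable X]setTI; apply: normr_measurable.
rewrite [X in P X](_ : _ = X @^-1` A)// lawX// /gaussian_prob.
case: ifPn => [/eqP sE|sE].
  rewrite diracE memNset ?lee_fin ?mulr_ge0 ?expR_ge0//.
  by rewrite /A/= normr0; apply/negP; rewrite -leNgt.
have sgt0 : 0 < s by rewrite lt_def sE.
have s2 : 0 < 4 * s ^+ 2 by rewrite mulr_gt0 ?exprn_gt0.
rewrite EFinM -(normal_exp_sqr 0 sgt0) muleC -ge0_integralZl_EFin ?expR_ge0//; last first.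
  apply/measurable_EFinP; apply: measurableT_comp => //.
  apply: measurable_funM => //; apply: measurable_funX.
  exact: measurable_funB.
have <- : (\int[normal_prob 0 s]_x (\1_A x)%:E = normal_prob 0 s A)%E.
  by rewrite integral_indic// setIT.
apply: ge0_le_integral => //=.
- by apply/measurable_EFinP; exact: measurable_indic.
- apply/measurable_EFinP; apply: measurable_funM => //; apply: measurableT_comp => //.
  apply: measurable_funM => //; apply: measurable_funX.
  exact: measurable_funB.
move=> x _; rewrite indicE; have [|_] := boolP (x \in A); last first.
  by rewrite mule_ge0 ?lee_fin ?expR_ge0.
rewrite inE/= => Ax; rewrite -EFinM lee_fin -expRD -[leLHS]expR0 ler_expR subr0.
rewrite addrC subr_ge0 ler_pM ?divr_ge0 ?sqr_ge0 ?invr_ge0 ?mulr_ge0 ?(ltW v0)//.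
  by rewrite -[leRHS](real_normK (num_real x)) lerXn2r ?nnegrE// ltW.
by rewrite lef_pV2 ?posrE ?mulr_gt0// ler_pM2l.
Qed.

End gauss_law.

Section gauss_seq.
Context {R : realType} d (Om : measurableType d) (P : probability Om R).

(** A sequence of independent centered Gaussian variables of variances v,
    described by the laws of its finite linear combinations. *)
Definition gauss_seq (X : nat -> Om -> R) (v : nat -> R) :=
  forall (N : nat) (c : nat -> R),
    gauss_law P (fun w => \sum_(i < N) c i * X i w) 0
      (Num.sqrt (\sum_(i < N) c i ^+ 2 * v i)).

Lemma centered_gaussian_gauss_law (I : Type) (X : I -> Om -> R) (K : I -> I -> R) t :
  centered_gaussian_process P X K -> exists s, gauss_law P (X t) 0 s.
Proof.
move=> [gX EX _].
have [mX [m [s [s0 law]]]] := gX 1%N (fun=> t) (fun=> 1).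
have XE : (fun w => \sum_(i < 1) 1 * X t w) = X t.
  by apply/funext => w; rewrite big_ord1 mul1r.
rewrite XE in mX law.
have lX : gauss_law P (X t) m s by split.
have [_] := gauss_law_mean lX.
have := EX t; rewrite unlock => -> [m0].
by exists s; rewrite m0.
Qed.

(** A linear combination is Gaussian by assumption; its parameters are read off
    its first two moments. *)
Lemma centered_gaussian_gauss_seq (I : Type) (X : I -> Om -> R) (K : I -> I -> R)
    (t : nat -> I) (v : nat -> R) :
  centered_gaussian_process P X K ->
  (forall i j, K (t i) (t j) = (i == j)%:R * v i) ->
  gauss_seq (fun i => X (t i)) v.
Proof.
move=> cX Kt N c; have [gX EX CX] := cX.
have [mS [m [s [s0 law]]]] := gX N (fun i : 'I_N => t i) (fun i : 'I_N => c i).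
pose S w := \sum_(i < N) c i * X (t i) w.
have lS : gauss_law P S m s by split.
have lX i : exists s, gauss_law P (X (t i)) 0 s.
  exact: centered_gaussian_gauss_law.
have mX i : measurable_fun [set: Om] (X (t i)) by have [? []] := lX i.
have iX i : P.-integrable [set: Om] (EFin \o X (t i)).
  by have [? /gauss_law_mean[]] := lX i.
have iX0 i : (\int[P]_w (X (t i) w)%:E = 0)%E by have := EX (t i); rewrite unlock.
have iXX i j : P.-integrable [set: Om] (EFin \o (fun w => X (t i) w * X (t j) w)).
  have [? /gauss_law_var[i1 _]] := lX i; have [? /gauss_law_var[i2 _]] := lX j.
  apply: le_integrable (integrableD _ i1 i2) => //.
    by apply/measurable_EFinP; exact: measurable_funM.
  move=> w _; rewrite /= !subr0 lee_fin normrM.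
  rewrite [leRHS]ger0_norm ?addr_ge0 ?sqr_ge0//.
  rewrite -(real_normK (num_real (X (t i) w))) -(real_normK (num_real (X (t j) w))).
  have := sqr_ge0 (`|X (t i) w| - `|X (t j) w|).
  have := normr_ge0 (X (t i) w); have := normr_ge0 (X (t j) w); nra.
have EXX i j : (\int[P]_w (X (t i) w * X (t j) w)%:E = ((i == j)%:R * v i)%:E)%E.
  rewrite -Kt -CX unlock !EX/= unlock; apply: eq_integral => w _.
  congr EFin; rewrite -[RHS]/((X (t i) w - 0) * (X (t j) w - 0)).
  by rewrite !subr0.
have m0 : m = 0.
  have [_ []] := gauss_law_mean lS.
  rewrite /S; under eq_integral do rewrite -sumEFin.
  rewrite integral_sum//; last first.
    by move=> i; exact: (integrableZl measurableT (c i) (iX i)).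
  rewrite big1 => [[<-]//|i _].
  under eq_integral do rewrite EFinM.
  by rewrite integralZl//; [rewrite iX0 mule0|exact: iX].
subst m.
have sE : s ^+ 2 = \sum_(i < N) c i ^+ 2 * v i.
  apply: (@EFin_inj R); have [_ <-] := gauss_law_var lS.
  have iij i j : P.-integrable [set: Om] (fun w => (c i * c j * (X (t i) w * X (t j) w))%:E).
    exact: (integrableZl measurableT (c i * c j) (iXX i j)).
  transitivity (\int[P]_w (\sum_(i < N) \sum_(j < N) (c i * c j * (X (t i) w * X (t j) w))%:E))%E.
    apply: eq_integral => w _; rewrite subr0 expr2 /S mulr_suml -sumEFin.
    apply: eq_bigr => i _; rewrite mulr_sumr -sumEFin; apply: eq_bigr => j _.
    by congr EFin; ring.
  rewrite integral_sum//; last by move=> i; exact: integrable_sum.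
  rewrite -sumEFin; apply: eq_bigr => i _; rewrite integral_sum//.
  rewrite (bigD1 i)//= big1 ?adde0 => [|j ij].
    under eq_integral do rewrite EFinM.
    rewrite integralZl//; last exact: iXX.
    by rewrite EXX eqxx mul1r -EFinM expr2.
  under eq_integral do rewrite EFinM.
  rewrite integralZl//; last exact: iXX.
  rewrite EXX.
  have -> : (i == j :> nat) = false by rewrite eq_sym; exact: negbTE.
  by rewrite mul0r mule0.
suff -> : Num.sqrt (\sum_(i < N) c i ^+ 2 * v i) = s by [].
by rewrite -sE sqrtr_sqr ger0_norm.
Qed.

Variables (X : nat -> Om -> R) (v : nat -> R).
Hypotheses (v_ge0 : forall i, 0 <= v i) (gX : gauss_seq X v).

Lemma gauss_seq_coord i : gauss_law P (X i) 0 (Num.sqrt (v i)).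
Proof.
have := gX i.+1 (fun j => (j == i)%:R).
have E (F : nat -> R) : \sum_(j < i.+1) (j == i :> nat)%:R * F j = F i.
  rewrite big_ord_recr/= eqxx mul1r big1 ?add0r// => j _.
  by rewrite ltn_eqF ?mul0r.
rewrite (_ : (fun w => _) = X i); last first.
  by apply/funext => w; apply: (E (fun j => X j w)).
rewrite (_ : \sum_(j < i.+1) _ = v i)// -[RHS](E v); apply: eq_bigr => j _.
by case: eqP; rewrite ?expr1n ?expr0n.
Qed.

Lemma gauss_seq_measurable i : measurable_fun [set: Om] (X i).
Proof. by have [] := gauss_seq_coord i. Qed.

Lemma gauss_seq_cos N (t : nat -> R) c :
  (\int[P]_w (cos (\sum_(0 <= j < N) t j * X j w + c))%:E =
   (cos c * expR (- (\sum_(0 <= j < N) t j ^+ 2 * v j) / 2))%:E)%E.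
Proof.
have := gauss_law_cos 1 c (gX N t).
rewrite !big_mkord sqr_sqrtr; last first.
  by apply: sumr_ge0 => i _; rewrite mulr_ge0// sqr_ge0.
rewrite expr1n mulr1 mulNr => <-; apply: eq_integral => w _.
by rewrite big_mkord mul1r subr0.
Qed.

End gauss_seq.

Section bounded_fubini.
Context {R : realType} d d' (T : measurableType d) (T' : measurableType d').

Lemma bounded_fubini (P : probability T R) (Q : probability T' R)
    (f : T * T' -> R) M : measurable_fun [set: T * T'] f ->
  (forall x, `|f x| <= M) ->
  (\int[P]_x \int[Q]_y (f (x, y))%:E = \int[Q]_y \int[P]_x (f (x, y))%:E)%E.
Proof.
move=> mf fM; apply: (@Fubini _ _ _ _ _ P Q (EFin \o f)).
apply/integrable12ltyP; first exact/measurable_EFinP.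
have M0 : 0 <= M by have := fM point; apply: le_trans.
apply: (@le_lt_trans _ _ (\int[P]_x M%:E)%E); last first.
  by rewrite integral_cst//= [P _]probability_setT mule1 ltry.
have maf : measurable_fun [set: T * T'] (fun z => `|f z|%:E).
  by apply/measurable_EFinP; exact: measurableT_comp.
apply: ge0_le_integral => //=.
- by move=> x _; apply: integral_ge0.
- by apply: (@measurable_fun_fubini_tonelli_F _ _ _ _ _ Q (fun z => `|f z|%:E)).
move=> x _; apply: (@le_trans _ _ (\int[Q]_y M%:E)%E); last first.
  by rewrite integral_cst//= [Q _]probability_setT mule1.
apply: ge0_le_integral => //=.
- by apply/(measurable_fun_pair2 (f := fun z => `|f z|%:E)).
- by move=> y _; rewrite lee_fin.
Qed.

End bounded_fubini.

(** * Expectations of exponentials of quadratic functions *)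

Section gauss_laplace.
Context {R : realType}.

(** The expectation of exp (- b (X - m)^2 / 2) for X ~ N(0, v). *)
Definition bump_mean (b m v : R) : R :=
  (Num.sqrt (1 + b * v))^-1 * expR (- (b * m ^+ 2 / (2 * (1 + b * v)))).

(** A Gaussian bump is a characteristic function. *)
Lemma bump_fourier (b m x : R) : 0 < b ->
  ((expR (- (b * (x - m) ^+ 2 / 2)))%:E =
   \int[normal_prob 0 (Num.sqrt b)]_y (cos (y * (x - m)))%:E)%E.
Proof.
move=> b0; have sb : 0 < Num.sqrt b by rewrite sqrtr_gt0.
have := normal_cos 0 sb 0 (x - m).
rewrite cos0 mul1r sqr_sqrtr ?(ltW b0)// => <-.
by apply: eq_integral => y _; rewrite subr0 addr0 mulrC.
Qed.

Lemma bump_meanE (b m v : R) : 0 < b -> 0 <= v ->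
  (\int[normal_prob 0 (Num.sqrt b)]_y (cos (y * m) * expR (- (v * y ^+ 2 / 2)))%:E
   = (bump_mean b m v)%:E)%E.
Proof.
move=> b0 v0; have sb : 0 < Num.sqrt b by rewrite sqrtr_gt0.
have bv : 0 < 1 + b * v by rewrite ltr_pwDl// mulr_ge0// ltW.
pose s' := Num.sqrt (b / (1 + b * v)).
have s'0 : 0 < s' by rewrite sqrtr_gt0 divr_gt0.
have s'2 : s' ^+ 2 = b / (1 + b * v) by rewrite sqr_sqrtr// ltW// divr_gt0.
have e : s' ^- 2 = Num.sqrt b ^- 2 + v.
  by rewrite s'2 sqr_sqrtr ?ltW//; field; rewrite !gt_eqF.
have mcos : measurable_fun [set: R] (fun y : R => cos (y * m)).
  apply: continuous_measurable_fun => y; apply: continuous_comp; last exact: continuous_cos.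
  by apply: cvgM; [exact: cvg_id|exact: cvg_cst].
have mexp : measurable_fun [set: R] (fun y : R => expR (- (v * y ^+ 2 / 2))).
  apply: measurableT_comp => //; apply: measurableT_comp => //.
  apply: measurable_funM => //; apply: measurable_funM => //.
have cos1 (u : R) : `|cos u| <= 1 by rewrite ler_norml cos_geN1 cos_le1.
have icos : (normal_prob 0 s').-integrable [set: R] (EFin \o (fun y => cos (y * m))).
  by apply: (@normal_integrable_le R 0 _ s'0 1) => // y;
    rewrite mul1r (le_trans (cos1 _))// lerDl sqr_ge0.
have iexp : (normal_prob 0 (Num.sqrt b)).-integrable [set: R]
    (EFin \o (fun y => cos (y * m) * expR (- (v * y ^+ 2 / 2)))).
  apply: (@normal_integrable_le R 0 _ sb 1); first exact: measurable_funM.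
  move=> y; rewrite mul1r subr0 normrM (ger0_norm (expR_ge0 _)).
  rewrite (@le_trans _ _ (1 * 1))//; last by rewrite mul1r lerDl sqr_ge0.
  rewrite ler_pM ?expR_ge0// -[leRHS]expR0 ler_expR oppr_le0.
  by rewrite divr_ge0// mulr_ge0// sqr_ge0.
have [_ ->] := integral_normal_prob (measurable_funM mcos mexp) iexp.
have [i1 e1] := integral_normal_prob mcos icos.
transitivity ((s' / Num.sqrt b)%:E * \int[normal_prob 0 s']_y (cos (y * m))%:E)%E.
  rewrite e1.
  rewrite -(integralZl measurableT i1).
  apply: eq_integral => y _.
  rewrite -EFinM; congr EFin.
  have := normal_pdf_tilt 0 y sb s'0 e; rewrite subr0 => h.
  by rewrite -[LHS]mulrA [RHS]mulrCA -h.
have := normal_cos 0 s'0 0 m; rewrite cos0 mul1r => cE.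
have -> : (\int[normal_prob 0 s']_y (cos (y * m))%:E = (expR (- (s' ^+ 2 * m ^+ 2 / 2)))%:E)%E.
  by rewrite -cE; apply: eq_integral => y _; rewrite subr0 addr0 mulrC.
rewrite -EFinM /bump_mean; congr (_ * expR (- _))%:E.
  rewrite /s' sqrtrM ?ltW// sqrtrV ?ltW// mulrAC divff ?mul1r//.
  by rewrite gt_eqF.
by rewrite s'2; field; rewrite gt_eqF.
Qed.

End gauss_laplace.

Section gauss_seq_laplace.
Context {R : realType} d (Om : measurableType d) (P : probability Om R).
Variables (X : nat -> Om -> R) (v : nat -> R).
Hypotheses (v_ge0 : forall i, 0 <= v i) (gX : gauss_seq P X v).

Let bump b m (x : R) := expR (- (b * (x - m) ^+ 2 / 2)).

(** Replacing the bump in X_K by its Fourier integral turns it into one more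
    phase in the cosine, so that only laws of linear combinations are used. *)
Lemma gauss_seq_bumps_cos (b m : nat -> R) K N (t : nat -> R) c :
  (forall i, 0 < b i) -> (K <= N)%N ->
  (\int[P]_w (cos (\sum_(K <= j < N) t j * X j w + c) *
              \prod_(k < K) bump (b k) (m k) (X k w))%:E =
   (cos c * expR (- (\sum_(K <= j < N) t j ^+ 2 * v j) / 2) *
    \prod_(k < K) bump_mean (b k) (m k) (v k))%:E)%E.
Proof.
move=> b0; elim: K N t c => [|K IH] N t c KN.
  under eq_integral do rewrite big_ord0 mulr1.
  by rewrite (gauss_seq_cos v_ge0 gX) big_ord0 mulr1.
pose S w := \sum_(K.+1 <= j < N) t j * X j w.
pose V := \sum_(K.+1 <= j < N) t j ^+ 2 * v j.
pose Q w := \prod_(k < K) bump (b k) (m k) (X k w).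
pose G := \prod_(k < K) bump_mean (b k) (m k) (v k).
pose f (z : Om * measurableTypeR R) :=
  cos (S z.1 + c) * cos (z.2 * (X K z.1 - m K)) * Q z.1.
have mX := gauss_seq_measurable gX.
have mbump b' m' : measurable_fun [set: R] (bump b' m').
  apply: measurableT_comp => //; apply: measurableT_comp => //.
  apply: measurable_funM => //; apply: measurable_funM => //.
  by apply: measurable_funX; exact: measurable_funB.
have mQ : measurable_fun [set: Om] Q.
  by apply: measurable_prod => k _; exact: measurableT_comp.
have mS : measurable_fun [set: Om] S.
  by apply: measurable_sum => k; apply: measurable_funM.
have Q01 w : 0 <= Q w <= 1.
  have b01 k : 0 <= bump (b k) (m k) (X k w) <= 1.
    rewrite expR_ge0/= -[leRHS]expR0 ler_expR oppr_le0.
    by rewrite divr_ge0// mulr_ge0 ?sqr_ge0 ?(ltW (b0 _)).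
  by rewrite prodr_ge0 ?numdomain.Num.Theory.prodr_ile1// => k _; have /andP[] := b01 k.
have cos1 (u : R) : `|cos u| <= 1 by rewrite ler_norml cos_geN1 cos_le1.
have mcos : measurable_fun [set: R] (@cos R).
  by apply: continuous_measurable_fun; exact: continuous_cos.
have mf : measurable_fun [set: Om * measurableTypeR R] f.
  have mS1 : measurable_fun [set: Om * measurableTypeR R] (fun z => S z.1).
    exact: measurableT_comp.
  have mQ1 : measurable_fun [set: Om * measurableTypeR R] (fun z => Q z.1).
    exact: measurableT_comp.
  have mX1 : measurable_fun [set: Om * measurableTypeR R] (fun z => X K z.1).
    by apply: measurableT_comp.
  have my : measurable_fun [set: Om * measurableTypeR R] (fun z => z.2 : R).
    exact: measurable_snd.
  apply: measurable_funM => //; apply: measurable_funM.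
    by apply: (measurableT_comp mcos); exact: measurable_funD.
  by apply: (measurableT_comp mcos); apply: measurable_funM => //; exact: measurable_funB.
have f1 z : `|f z| <= 1.
  have /andP[Q0 Q1] := Q01 z.1; rewrite /f !normrM (ger0_norm Q0).
  by rewrite mulr_ile1 ?mulr_ge0// mulr_ile1.
transitivity (\int[P]_w \int[normal_prob 0 (Num.sqrt (b K))]_y (f (w, y))%:E)%E.
  apply: eq_integral => w _; rewrite /f/=.
  rewrite big_ord_recr/= -/(Q w).
  under eq_integral do rewrite mulrAC EFinM.
  rewrite integralZl//; last first.
    apply: (@normal_integrable_le R 0 _ _ 1) => [||y].
    - by rewrite sqrtr_gt0.
    - apply: (measurableT_comp mcos); exact: measurable_funM.
    - by rewrite mul1r (le_trans (cos1 _))// lerDl sqr_ge0.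
  rewrite -bump_fourier// -EFinM mulrA; congr EFin.
rewrite (bounded_fubini P (normal_prob 0 (Num.sqrt (b K))) mf f1).
transitivity (\int[normal_prob 0 (Num.sqrt (b K))]_y
   ((cos c * expR (- V / 2) * G)%:E * (cos (y * m K) * expR (- (v K * y ^+ 2 / 2)))%:E))%E.
  apply: eq_integral => y _; rewrite -EFinM.
  pose t' (e : R) j := if (j == K)%N then e else t j.
  have t'E e w : \sum_(K <= j < N) t' e j * X j w = e * X K w + S w.
    rewrite big_ltn// /t' eqxx; congr (_ + _); apply: eq_big_nat => j /andP[Kj _].
    by rewrite gtn_eqF.
  have t'V e : \sum_(K <= j < N) t' e j ^+ 2 * v j = e ^+ 2 * v K + V.
    rewrite big_ltn// /t' eqxx; congr (_ + _); apply: eq_big_nat => j /andP[Kj _].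
    by rewrite gtn_eqF.
  have IHe e : (\int[P]_w (cos (e * X K w + S w + (c - e * m K)) * Q w)%:E =
      (cos (c - e * m K) * expR (- (e ^+ 2 * v K + V) / 2) * G)%:E)%E.
    rewrite -t'V -IH ?(ltnW KN)//; apply: eq_integral => w _.
    by rewrite t'E.
  have int e : P.-integrable [set: Om]
      (EFin \o (fun w => cos (e * X K w + S w + (c - e * m K)) * Q w)).
    apply: measurable_bounded_integrable => //.
    - by rewrite [X in (X < _)%E]probability_setT ltry.
    - apply: measurable_funM => //; apply: (measurableT_comp mcos).
      apply: measurable_funD => //; apply: measurable_funD => //.
      exact: measurable_funM.
    exists 1; split => // M M1 w _; rewrite /= normrM.
    have /andP[Q0 Q1] := Q01 w.
    by rewrite (ger0_norm Q0) (le_trans _ (ltW M1))// mulr_ile1.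
  transitivity (\int[P]_w ((2^-1)%:E * ((cos (y * X K w + S w + (c - y * m K)) * Q w)%:E +
      (cos (- y * X K w + S w + (c - - y * m K)) * Q w)%:E)))%E.
    apply: eq_integral => w _; rewrite -EFinD -EFinM; congr EFin; rewrite /f/=.
    have -> : y * X K w + S w + (c - y * m K) = (S w + c) + y * (X K w - m K) by ring.
    have -> : - y * X K w + S w + (c - - y * m K) = (S w + c) - y * (X K w - m K) by ring.
    rewrite (cosD (S w + c)) (cosB (S w + c)).
    by rewrite -[LHS]/(cos (S w + c) * cos (y * (X K w - m K)) * Q w); field.
  rewrite integralZl//; last by apply: integrableD => //; exact: int.
  rewrite integralD//; [|exact: int..].
  rewrite !IHe -EFinD -EFinM; congr EFin.
  rewrite sqrrN (mulNr y (m K)) opprK (cosB c) (cosD c).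
  have -> : expR (- (y ^+ 2 * v K + V) / 2) = expR (- V / 2) * expR (- (v K * y ^+ 2 / 2)).
    by rewrite -expRD; congr expR; field.
  by field.
rewrite integralZl//; last first.
  apply: (@normal_integrable_le R 0 _ _ 1) => [||y].
  - by rewrite sqrtr_gt0.
  - apply: measurable_funM.
      by apply: (measurableT_comp mcos); exact: measurable_funM.
    apply: measurableT_comp => //; apply: measurableT_comp => //.
    by apply: measurable_funM => //; apply: measurable_funM.
  rewrite mul1r subr0 normrM (ger0_norm (expR_ge0 _)) (@le_trans _ _ 1)//.
    rewrite mulr_ile1 ?expR_ge0// -[leRHS]expR0 ler_expR oppr_le0.
    by rewrite divr_ge0// mulr_ge0// sqr_ge0.
  by rewrite lerDl sqr_ge0.
rewrite bump_meanE// -EFinM big_ord_recr/= -/G.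
by congr EFin; ring.
Qed.

End gauss_seq_laplace.

Section gauss_seq_exp.
Context {R : realType} d (Om : measurableType d) (P : probability Om R).

(** The expectation of exp (a X - b X^2 / 2) for X ~ N(0, v). *)
Definition quad_mean (a b v : R) : R :=
  (Num.sqrt (1 + b * v))^-1 * expR (a ^+ 2 * v / (2 * (1 + b * v))).

Lemma quad_mean_gt0 (a b v : R) : 0 < b -> 0 <= v -> 0 < quad_mean a b v.
Proof.
move=> b0 v0; rewrite mulr_gt0 ?expR_gt0// invr_gt0 sqrtr_gt0.
by rewrite ltr_pwDl// mulr_ge0// ltW.
Qed.

Lemma quad_meanE (a b v : R) : 0 < b -> 0 <= v ->
  quad_mean a b v = expR (a ^+ 2 / (2 * b)) * bump_mean b (a / b) v.
Proof.
move=> b0 v0; rewrite /quad_mean /bump_mean [RHS]mulrCA -expRD; congr (_ * expR _).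
have bv : 0 < 1 + b * v by rewrite ltr_pwDl// mulr_ge0// ltW.
by field; rewrite !gt_eqF.
Qed.

Variables (X : nat -> Om -> R) (v : nat -> R).
Hypotheses (v_ge0 : forall i, 0 <= v i) (gX : gauss_seq P X v).

(** Completing the square, with centre a / b, turns each factor into a bump. *)
Lemma gauss_seq_exp (a b : nat -> R) K : (forall i, 0 < b i) ->
  (\int[P]_w (expR (\sum_(k < K) (a k * X k w - b k * X k w ^+ 2 / 2)))%:E =
   (\prod_(k < K) quad_mean (a k) (b k) (v k))%:E)%E.
Proof.
move=> b0.
pose h (k : nat) (x : R) := expR (- (b k * (x - a k / b k) ^+ 2 / 2)).
pose e (k : nat) := expR (a k ^+ 2 / (2 * b k)).
transitivity (\int[P]_w ((\prod_(k < K) e k)%:E * (\prod_(k < K) h k (X k w))%:E))%E.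
  apply: eq_integral => w _; rewrite -EFinM -big_split/= expR_sum; congr EFin.
  apply: eq_bigr => k _; rewrite /e /h -expRD; congr expR.
  by field; rewrite gt_eqF.
have := @gauss_seq_bumps_cos R d Om P X v v_ge0 gX b (fun k => a k / b k) K K (fun=> 0) 0 b0 (leqnn K).
rewrite !big_geq// oppr0 mul0r expR0 cos0 !mul1r => E.
have E' : (\int[P]_w (\prod_(k < K) h k (X k w))%:E = (\prod_(k < K) bump_mean (b k) (a k / b k) (v k))%:E)%E.
  rewrite -E; apply: eq_integral => w _.
  by rewrite big_geq// add0r cos0 mul1r.
rewrite integralZl//; last first.
  apply/integrableP; split.
    apply/measurable_EFinP; apply: measurable_prod => k _.
    have mX := gauss_seq_measurable gX k.
    apply: (measurableT_comp _ mX).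
    apply: measurableT_comp => //; apply: measurableT_comp => //.
    apply: measurable_funM => //; apply: measurable_funM => //.
    by apply: measurable_funX; exact: measurable_funB.
  have h0 w : 0 <= \prod_(k < K) h k (X k w) by apply: prodr_ge0 => k _; exact: expR_ge0.
  under eq_integral do rewrite /= ger0_norm//.
  by rewrite E' ltry.
rewrite E' -EFinM -big_split/=; congr EFin.
by apply: eq_bigr => k _; rewrite quad_meanE.
Qed.

End gauss_seq_exp.

(** * Almost sure convergence of Gaussian series *)

Section calculus.
Context {R : realType}.

(** Comparison of x^(-p-1) with its integral, from 1 + z <= exp z and
    ln (1 + z) <= z. *)
Lemma powR_telescope (p x : R) : 0 < p -> 0 < x ->
  p * (x + 1) `^ (- (p + 1)) <= x `^ (- p) - (x + 1) `^ (- p).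
Proof.
move=> p0 x0; have x1 : 0 < x + 1 by rewrite addr_gt0.
have -> : x `^ (- p) = (x + 1) `^ (- p) * (x / (x + 1)) `^ (- p).
  by rewrite -powRM ?divr_ge0 ?ltW// mulrCA divff ?mulr1// gt_eqF.
have -> : (x + 1) `^ (- (p + 1)) = (x + 1) `^ (- p) * (x + 1)^-1.
  rewrite opprD powRD; last by apply/implyP => _; rewrite gt_eqF.
  by rewrite powR_inv1// ltW.
rewrite -[X in _ - X]mulr1 -mulrBr mulrCA ler_wpM2l ?powR_ge0//.
have t0 : 0 < x / (x + 1) by rewrite divr_gt0.
rewrite /powR gt_eqF// lerBrDl mulNr.
apply: le_trans (expR_ge1Dx _); rewrite lerD2l -mulrN ler_pM2l//.
rewrite lerNr.
have -> : x / (x + 1) = 1 + - (x + 1)^-1 by field; rewrite gt_eqF.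
by apply: le_ln1Dx; rewrite ltrN2 invf_lt1// ltrDr.
Qed.

Lemma sum_powR_le (p kappa : R) N : 0 < p -> 0 < kappa ->
  \sum_(k < N) (kappa + k.+1%:R) `^ (- (p + 1)) <= kappa `^ (- p) / p.
Proof.
move=> p0 k0; rewrite ler_pdivlMr// mulrC mulr_sumr.
apply: (@le_trans _ _ (\sum_(k < N) ((kappa + k%:R) `^ (- p) - (kappa + k.+1%:R) `^ (- p)))).
  apply: ler_sum => k _; rewrite -natr1 addrA.
  by apply: powR_telescope; rewrite ?ltr_wpDr.
rewrite -(big_mkord xpredT (fun k => (kappa + k%:R) `^ (- p) - (kappa + k.+1%:R) `^ (- p))).
rewrite (eq_bigr (fun k => - ((kappa + k.+1%:R) `^ (- p)) - - ((kappa + k%:R) `^ (- p)))); last first.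
  by move=> k _; rewrite opprK addrC.
rewrite telescope_sumr// opprK addr0 addrC lerBlDr lerDl.
exact: powR_ge0.
Qed.

(** Powers of two are hit by the subsequence r.+1 = 2 ^ j.+1, so the
    hypothesis controls both the jumps of S along the powers of two and the
    oscillation of S between two of them. *)
Lemma dyadic_is_cvg (S : nat -> R) (z : R) n0 : 0 < z < 1 ->
  (forall r, (n0 <= r)%N ->
     `|S r.+1 - S (2 ^ trunc_log 2 r)%N| <= z ^+ trunc_log 2 r) ->
  cvgn S.
Proof.
move=> /andP[z0 z1] Sr; pose T j := S (2 ^ j)%N.
have TS j : (n0 <= j)%N -> `|T j.+1 - T j| <= z ^+ j.
  move=> n0j; pose r := (2 ^ j.+1).-1.
  have r1 : r.+1 = (2 ^ j.+1)%N by rewrite prednK// expn_gt0.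
  have rj : trunc_log 2 r = j.
    apply: trunc_log_eq => //; rewrite -ltnS r1 leqnn andbT.
    by rewrite ltn_exp2l.
  have := Sr r; rewrite rj r1; apply.
  rewrite (leq_trans n0j)// -ltnS r1 (leq_trans (ltn_expl j (isT : 1 < 2)%N))//.
  by rewrite leq_exp2l.
have cT : cvgn T.
  have : cvgn (fun j => T (j + n0)%N).
    pose u j := T (j.+1 + n0)%N - T (j + n0)%N.
    have cu : cvgn (series u).
      have gE j : geometric 1 z j = z ^+ j by rewrite /geometric/= mul1r.
      apply: normed_cvg; apply: (@series_le_cvg _ _ (geometric 1 z)).
      - by move=> j; exact: normr_ge0.
      - by move=> j; rewrite gE exprn_ge0// ltW.
      - move=> j; rewrite gE (le_trans (TS _ _))// ?leq_addl//.
        by rewrite ler_wiXn2l ?ltW// leq_addr.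
      - by apply: is_cvg_geometric_series; rewrite ger0_norm ?ltW.
    have -> : (fun j => T (j + n0)%N) = (fun j => series u j + T n0).
      apply/funext => j; rewrite seriesEnat/= /u telescope_sumr//.
      by rewrite add0n subrK.
    by apply: is_cvgD => //; exact: is_cvg_cst.
  by move=> /cvg_ex[l]; rewrite (cvg_shiftn n0 T) => cl; apply/cvg_ex; exists l.
have logy : trunc_log 2 r @[r --> \oo] --> \oo.
  apply/cvgnyPge => A; exists (2 ^ A)%N => // r /= Ar.
  exact: trunc_log_max.
pose L := limn T.
have cTr : T (trunc_log 2 r) @[r --> \oo] --> L by apply: cvg_comp logy _.
have czr : z ^+ trunc_log 2 r @[r --> \oo] --> (0 : R).
  have cz : (fun j => z ^+ j) @ \oo --> (0 : R).
    by apply: cvg_expr; rewrite ger0_norm ?ltW.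
  by apply: cvg_comp logy cz.
have : S r.+1 @[r --> \oo] --> L.
  apply/cvgrPdist_le => e e0.
  move/cvgrPdist_le: cTr => /(_ (e / 2)); rewrite divr_gt0// => /(_ isT) cTr.
  move/cvgrPdist_le: czr => /(_ (e / 2)); rewrite divr_gt0// => /(_ isT) czr.
  near=> r.
  have h1 : `|S r.+1 - T (trunc_log 2 r)| <= e / 2.
    apply: (le_trans (Sr r _)); first by near: r; exact: nbhs_infty_ge.
    have : `|0 - z ^+ trunc_log 2 r| <= e / 2 by near: r.
    by rewrite sub0r normrN; apply: le_trans; exact: ler_norm.
  have h2 : `|L - T (trunc_log 2 r)| <= e / 2 by near: r.
  have -> : L - S r.+1 = (L - T (trunc_log 2 r)) - (S r.+1 - T (trunc_log 2 r)) by ring.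
  by rewrite (le_trans (ler_normB _ _))// [e]splitr lerD.
move=> cS; apply/cvg_ex; exists L; move: cS.
by rewrite (cvg_shiftS S).
Unshelve. all: end_near. Qed.

End calculus.

Section gauss_seq_as.
Context {R : realType}.

Lemma nneseries_le_bound (u : nat -> R) M : (forall n, 0 <= u n) ->
  (forall N, \sum_(k < N) u k <= M) ->
  (\sum_(0 <= k <oo) (u k)%:E <= M%:E)%E.
Proof.
move=> u0 uM; apply: lime_le; first by apply: is_cvg_nneseries => n _ _; rewrite lee_fin.
by apply: nearW => N; rewrite big_mkord sumEFin lee_fin.
Qed.

Lemma nneseries_lt_bound (u : nat -> R) : (forall n, 0 <= u n) ->
  (\sum_(0 <= k <oo) (u k)%:E < +oo)%E ->
  exists2 M, 0 < M & forall N, \sum_(k < N) u k <= M.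
Proof.
move=> u0 ufin.
have sfin : (\sum_(0 <= k <oo) (u k)%:E)%E \is a fin_num.
  by rewrite ge0_fin_numE//; apply: nneseries_ge0 => n _ _; rewrite lee_fin.
exists (`|fine (\sum_(0 <= k <oo) (u k)%:E)%E| + 1); first by rewrite ltr_wpDl.
move=> N; rewrite (@le_trans _ _ (fine (\sum_(0 <= k <oo) (u k)%:E)%E))//; last first.
  by rewrite (le_trans (ler_norm _))// lerDl.
rewrite -lee_fin fineK// -sumEFin -(big_mkord xpredT (fun k => (u k)%:E)).
by apply: nneseries_lim_ge => n _; rewrite lee_fin.
Qed.

Context d (Om : measurableType d) (P : probability Om R).
Variables (X : nat -> Om -> R) (v : nat -> R).
Hypotheses (v_ge0 : forall i, 0 <= v i) (gX : gauss_seq P X v).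

Lemma gauss_seq_increment_tail (c : nat -> R) (p n : nat) (V eps : R) :
  (p <= n)%N -> 0 < V -> \sum_(p <= k < n) c k ^+ 2 * v k <= V -> 0 <= eps ->
  (P [set w | (eps < `|series (fun k => c k * X k w) n -
                      series (fun k => c k * X k w) p|)%R] <=
   (Num.sqrt 2 * expR (- (eps ^+ 2 / (4 * V))))%:E)%E.
Proof.
move=> pn V0 cV eps0.
pose c' k := if (p <= k)%N then c k else 0.
have E (F : nat -> R -> R) : (forall k, F k 0 = 0) ->
    \sum_(k < n) F k (c' k) = \sum_(p <= k < n) F k (c k).
  move=> F0; rewrite -(big_mkord xpredT (fun k => F k (c' k))).
  rewrite (big_cat_nat (leq0n p) pn)/= big_nat big1 ?add0r => [|k /andP[_ kp]]; last first.
    by rewrite /c' leqNgt kp/= F0.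
  by apply: eq_big_nat => k /andP[pk _]; rewrite /c' pk.
have := gX n c'.
rewrite (E (fun k x => x ^+ 2 * v k)); last by move=> k; rewrite expr0n mul0r.
rewrite (_ : (fun w => _) = (fun w => series (fun k => c k * X k w) n -
                      series (fun k => c k * X k w) p)); last first.
  apply/funext => w; rewrite sub_series_geq// -(E (fun k x => x * X k w))// => k.
  by rewrite mul0r.
move=> gl; apply: (gauss_law_tail gl) => //.
by rewrite sqr_sqrtr// sumr_ge0// => k _; rewrite mulr_ge0 ?sqr_ge0.
Qed.

(** Almost sure convergence of a series of independent Gaussian variables with
    a power to spare in the variances: the dyadic increments have Gaussian
    tails, which are summable over all partial sums, so that Borel-Cantelli
    applies without any maximal inequality. *)
Lemma gauss_seq_series_cvg (c : nat -> R) (eta M : R) : 0 < eta -> 0 < M ->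
  (forall N, \sum_(k < N) k.+1%:R `^ eta * (c k ^+ 2 * v k) <= M) ->
  {ae P, forall w, cvgn (series (fun k => c k * X k w))}.
Proof.
move=> eta0 M0 cM.
(* In the block of index j the variance is at most M y^(-4 j), which leaves room
   for increments of size y^(-j), a summable sequence. *)
pose y : R := 2 `^ (eta / 4).
have y1 : 1 < y.
  have := @gt0_ltr_powR R (eta / 4); rewrite divr_gt0// => /(_ isT 1 2).
  by rewrite powR1 !nnegrE ler01 ler0n ltr1n => /(_ isT isT isT).
have y0 : 0 < y by rewrite (lt_trans _ y1).
pose z := y^-1.
have z01 : 0 < z < 1 by rewrite invr_gt0 y0 invf_lt1.
pose j r := trunc_log 2 r.
pose S w n := series (fun k => c k * X k w) n.
pose F r := [set w | (z ^+ j r.+1 < `|S w r.+2 - S w (2 ^ j r.+1)%N|)%R].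
have mS n : measurable_fun [set: Om] (S ^~ n).
  rewrite (_ : S ^~ n = (fun w => \sum_(0 <= k < n) c k * X k w)); last first.
    by apply/funext => w; rewrite /S seriesEnat.
  apply: measurable_sum => k; apply: measurable_funM => //.
  exact: gauss_seq_measurable gX k.
have mF r : measurable (F r).
  rewrite (_ : F r = (fun w => `|S w r.+2 - S w (2 ^ j r.+1)%N|) @^-1`
      `]z ^+ j r.+1, +oo[%classic).
    rewrite -[X in measurable X]setTI.
    by apply: measurableT_comp => //; exact: measurable_funB.
  by apply/seteqP; split => w; rewrite /F /= in_itv/= andbT.
have PF r : (P (F r) <= (Num.sqrt 2 * expR (- (y ^+ (2 * j r.+1) / (4 * M))))%:E)%E.
  have jr : (2 ^ j r.+1 <= r.+1)%N by exact: trunc_logP.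
  pose V := M / y ^+ (4 * j r.+1).
  have := @gauss_seq_increment_tail c (2 ^ j r.+1) r.+2 V (z ^+ j r.+1).
  have -> : (z ^+ j r.+1) ^+ 2 / (4 * V) = y ^+ (2 * j r.+1) / (4 * M).
    rewrite /V /z ![(_ * j r.+1)%N]mulnC !exprM exprVn.
    by field; rewrite !gt_eqF ?exprn_gt0.
  apply.
  - by rewrite (leq_trans jr).
  - by rewrite divr_gt0// exprn_gt0.
  - rewrite ler_pdivlMr ?exprn_gt0// mulrC mulr_sumr.
    apply: le_trans (cM r.+2); rewrite -(big_mkord xpredT (fun k => k.+1%:R `^ eta * (c k ^+ 2 * v k))).
    rewrite [leRHS](big_cat_nat (leq0n (2 ^ j r.+1)))/=; last by rewrite (leq_trans jr).
    rewrite ler_wpDl//.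
      by apply: sumr_ge0 => k _; rewrite mulr_ge0 ?powR_ge0// mulr_ge0 ?sqr_ge0.
    rewrite ler_sum_nat// => k /andP[jk _].
    have cv0 : 0 <= c k ^+ 2 * v k by rewrite mulr_ge0// sqr_ge0.
    rewrite ler_wpM2r//.
    have -> : y ^+ (4 * j r.+1) = (2 ^ j r.+1)%:R `^ eta.
      rewrite exprM -[y ^+ 4]powR_mulrn ?(ltW y0)// /y -powRrM divfK//.
      rewrite -powR_mulrn ?powR_ge0// -powRrM mulrC powRrM powR_mulrn ?ler0n//.
      by rewrite natrX.
    apply: ge0_ler_powR; rewrite ?nnegrE ?ler0n ?(ltW eta0)//.
    by rewrite ler_nat ltnW.
  - by rewrite exprn_ge0// ltW// invr_gt0.
(* With this k the lower bound x^(k + 1) / (k + 1)! of exp x is at least a multiple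
   of 4^j, hence of (r + 2)^2, for x of order y^(2 j). *)
have [k yk] : exists k, 4 <= y ^+ (2 * k.+1).
  exists (Num.trunc (4 / eta)); rewrite -powR_mulrn ?(ltW y0)// /y -powRrM.
  have e4 : 2 `^ 2 = 4 :> R by rewrite powR_mulrn//; ring.
  rewrite -[leLHS]e4.
  apply: ler_powR; first by rewrite ler1n.
  have := truncnS_gt (4 / eta); rewrite ltr_pdivrMr// => /ltW h.
  by rewrite natrM; lra.
pose Cst := Num.sqrt 2 * (k.+1`!%:R * (4 * M) ^+ k.+1) * 4.
have Cst0 : 0 <= Cst by rewrite !mulr_ge0// exprn_ge0// mulr_ge0// (ltW M0).
have bnd r : Num.sqrt 2 * expR (- (y ^+ (2 * j r.+1) / (4 * M))) <=
    Cst * (1 + r.+1%:R) `^ (- (1 + 1)).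
  set x := _ / _; have x0 : 0 < x by rewrite divr_gt0 ?exprn_gt0// mulr_gt0.
  have ex : x ^+ k.+1 / k.+1`!%:R <= expR x.
    by rewrite (le_trans _ (expR_ge1Dxn k (ltW x0)))// lerDr.
  have f0 : 0 < k.+1`!%:R :> R by rewrite ltr0n fact_gt0.
  have e1 : expR (- x) <= k.+1`!%:R * (4 * M) ^+ k.+1 / (y ^+ (2 * k.+1)) ^+ j r.+1.
    rewrite expRN -[leRHS]invrK lef_pV2 ?posrE ?expR_gt0//; last first.
      by rewrite invr_gt0 divr_gt0 ?exprn_gt0// mulr_gt0// exprn_gt0// mulr_gt0.
    apply: le_trans ex; rewrite /x expr_div_n -!exprM.
    have -> : (2 * k.+1 * j r.+1 = 2 * j r.+1 * k.+1)%N by rewrite mulnAC.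
    by rewrite invf_div -mulrA [X in _ <= _ * X]mulrC -invfM.
  rewrite -mulrA -mulrA ler_wpM2l// -mulrA; apply: (le_trans e1).
  rewrite -mulrA ler_wpM2l// ler_wpM2l ?exprn_ge0 ?mulr_ge0 ?(ltW M0)//.
  have -> : (1 + r.+1%:R) `^ (- (1 + 1)) = (r.+2%:R ^+ 2)^-1 :> R.
    by rewrite nat1r (_ : - (1 + 1) = - 2%:R :> R)// powR_invn.
  have r2 : 0 < r.+2%:R ^+ 2 :> R by rewrite exprn_gt0.
  rewrite ler_pdivlMr// mulrC ler_pdivrMr; last by rewrite exprn_gt0// exprn_gt0.
  apply: (@le_trans _ _ (4 * 4 ^+ j r.+1)); last first.
    by rewrite ler_wpM2l// lerXn2r ?nnegrE ?exprn_ge0// ltW.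
  have : (r.+2 <= 2 * 2 ^ j r.+1)%N by rewrite -expnS trunc_log_ltn.
  rewrite -(ler_nat R) natrM natrX => h.
  have -> : 4 * 4 ^+ j r.+1 = (2 * 2 ^+ j r.+1) ^+ 2 :> R.
    by rewrite exprMn -exprM mulnC exprM; congr (_ * _ ^+ _); ring.
  by rewrite lerXn2r ?nnegrE// mulr_ge0// exprn_ge0.
have sumF : (\sum_(n <oo) P (F n) < +oo)%E.
  apply: (@le_lt_trans _ _ (\sum_(0 <= n <oo) (Cst * (1 + n.+1%:R) `^ (- (1 + 1)))%:E)%E).
    apply: lee_nneseries => // n _.
    by apply: (le_trans (PF n)); rewrite lee_fin; exact: bnd.
  apply: (@le_lt_trans _ _ (Cst * (1 `^ (- 1) / 1))%:E); last exact: ltry.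
  apply: nneseries_le_bound => [n|N]; first by rewrite mulr_ge0 ?powR_ge0.
  by rewrite -mulr_sumr ler_wpM2l//; exact: sum_powR_le.
have N0 := lim_sup_set_cvg0 mF sumF.
exists (lim_sup_set F); split => //.
  apply: bigcap_measurable => // n _; apply: bigcup_measurable => i _; exact: mF.
move=> w /= nc; apply: contrapT => wF; apply: nc.
have [n0 Hn0] : exists n0, forall r, (n0 <= r)%N -> ~ F r w.
  apply: contrapT => h; apply: wF => n _.
  apply: contrapT => h2; apply: h; exists n => r nr Fr; apply: h2.
  by exists r.
apply: (@dyadic_is_cvg R _ z n0.+1 z01) => -[//|r] nr.
by have /negP := Hn0 r nr; rewrite -leNgt.
Qed.

End gauss_seq_as.

(** * Convergence of integrals and Chebyshev's inequality *)

Section integral_limits.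
Context {R : realType} d (T : measurableType d) (P : probability T R).

Lemma ler_dist_minr (a b M : R) : `|Num.min a M - Num.min b M| <= `|a - b|.
Proof.
have n1 := ler_norm (a - b); have := ler_norm (- (a - b)); rewrite normrN => n2.
by case: (ltP a M) => h1; case: (ltP b M) => h2; rewrite ?subrr ?normr0// ler_norml; lra.
Qed.

Lemma prob_integral_cst (C : R) : (\int[P]_x C%:E = C%:E)%E.
Proof. by rewrite integral_cst//= [X in (_ * X)%E]probability_setT mule1. Qed.

Lemma sqr_bounded_integral_min (u : T -> R) (C M : R) :
  measurable_fun [set: T] u -> (forall x, 0 <= u x) -> 0 < M ->
  (\int[P]_x (u x ^+ 2)%:E <= C%:E)%E ->
  (\int[P]_x (Num.min (u x) M)%:E <= \int[P]_x (u x)%:E)%E /\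
  (\int[P]_x (u x)%:E <= \int[P]_x (Num.min (u x) M)%:E + (C / M)%:E)%E.
Proof.
move=> mu u0 M0 uC.
have mmin : measurable_fun [set: T] (fun x => Num.min (u x) M).
  exact: measurable_minr.
have min0 x : 0 <= Num.min (u x) M by rewrite le_min u0 ltW.
split.
  apply: ge0_le_integral => //=.
  - by move=> x _; rewrite lee_fin.
  - exact/measurable_EFinP.
  - exact/measurable_EFinP.
  - by move=> x _; rewrite lee_fin ge_min lexx.
apply: (@le_trans _ _ (\int[P]_x ((Num.min (u x) M)%:E + (M^-1)%:E * (u x ^+ 2)%:E))%E).
  apply: ge0_le_integral => //=.
  - by move=> x _; rewrite lee_fin.
  - exact/measurable_EFinP.
  - apply: emeasurable_funD; first exact/measurable_EFinP.
    apply/measurable_EFinP; apply: measurable_funM => //.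
    exact: measurable_funX.
  - move=> x _; rewrite -EFinM -EFinD lee_fin mulrC.
    rewrite -lerBlDl ler_pdivlMr//; case: (leP (u x) M) => uM.
      by rewrite subrr mul0r sqr_ge0.
    by have := u0 x; nra.
rewrite ge0_integralD//=; last 4 first.
- by move=> x _; rewrite lee_fin.
- exact/measurable_EFinP.
- by move=> x _; rewrite -EFinM lee_fin mulr_ge0 ?sqr_ge0// invr_ge0 ltW.
- apply/measurable_EFinP; apply: measurable_funM => //.
  exact: measurable_funX.
rewrite leeD2l// ge0_integralZl_EFin ?invr_ge0 ?(ltW M0)//; last 2 first.
- by move=> x _; rewrite lee_fin sqr_ge0.
- by apply/measurable_EFinP; exact: measurable_funX.
by rewrite EFinM muleC lee_wpmul2r// lee_fin invr_ge0 ltW.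
Qed.

(** Almost everywhere convergence and a bound in L^2 give convergence of the
    integrals: truncation at M changes them by at most C / M. *)
Lemma cvg_integral_sqr_bounded (u_ : nat -> T -> R) (u : T -> R) (C : R) :
  (forall n, measurable_fun [set: T] (u_ n)) -> measurable_fun [set: T] u ->
  (forall n x, 0 <= u_ n x) -> (forall x, 0 <= u x) ->
  (forall n, \int[P]_x (u_ n x ^+ 2)%:E <= C%:E)%E ->
  {ae P, forall x, u_ n x @[n --> \oo] --> u x} ->
  (\int[P]_x (u x)%:E)%E \is a fin_num /\
  fine (\int[P]_x (u_ n x)%:E)%E @[n --> \oo] --> fine (\int[P]_x (u x)%:E)%E.
Proof.
move=> mu_ mu u_0 u0 uC cu.
have C0 : 0 <= C.
  rewrite -lee_fin; apply: le_trans (uC 0%N); apply: integral_ge0 => x _.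
  by rewrite lee_fin sqr_ge0.
have uC' : (\int[P]_x (u x ^+ 2)%:E <= C%:E)%E.
  have mu2 n : measurable_fun [set: T] (fun x => (u_ n x ^+ 2)%:E).
    by apply/measurable_EFinP; exact: measurable_funX.
  apply: (@le_trans _ _ (\int[P]_x limn_einf (fun n => (u_ n x ^+ 2)%:E))%E); last first.
    apply: (@le_trans _ _ (limn_einf (fun n => \int[P]_x (u_ n x ^+ 2)%:E))%E).
      by apply: (fatou P measurableT mu2) => n x _; rewrite lee_fin sqr_ge0.
    rewrite limn_einf_lim; apply: lime_le; first exact: is_cvg_einfs.
    apply: nearW => n; apply: le_trans (uC n).
    by apply: ereal_inf_lbound; exists n => /=.
  rewrite le_eqVlt; apply/orP; left; apply/eqP; apply: ae_eq_integral => //.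
  - by apply/measurable_EFinP; exact: measurable_funX.
  - under eq_fun do rewrite -[limn_einf _]oppeK -limn_esupN.
    apply: measurableT_comp => //; apply: measurable_fun_limn_esup => n.
    exact: measurableT_comp.
  move: cu; apply: filterS => x cux _.
  have /cvg_limn_einf_sup[-> _]// : (u_ n x ^+ 2)%:E @[n --> \oo] --> (u x ^+ 2)%:E.
  by apply: cvg_EFin; [exact: nearW|exact: cvgM].
have bnd (g : T -> R) (M : R) : measurable_fun [set: T] g -> (forall x, 0 <= g x) ->
    (\int[P]_x (g x ^+ 2)%:E <= C%:E)%E -> 0 < M ->
    [/\ (\int[P]_x (g x)%:E)%E \is a fin_num,
       (\int[P]_x (Num.min (g x) M)%:E)%E \is a fin_num &
     `|fine (\int[P]_x (g x)%:E)%E - fine (\int[P]_x (Num.min (g x) M)%:E)%E| <= C / M].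
  move=> mg g0 gC M0.
  have [h1 h2] := sqr_bounded_integral_min mg g0 M0 gC.
  have min0 x : 0 <= Num.min (g x) M by rewrite le_min g0 ltW.
  have f2 : (\int[P]_x (Num.min (g x) M)%:E)%E \is a fin_num.
    rewrite ge0_fin_numE; last by apply: integral_ge0 => x _; rewrite lee_fin.
    apply: (@le_lt_trans _ _ (\int[P]_x M%:E)%E); last by rewrite prob_integral_cst ltry.
    apply: ge0_le_integral => //=.
    - by move=> x _; rewrite lee_fin.
    - by apply/measurable_EFinP; exact: measurable_minr.
    - by move=> x _; rewrite lee_fin ge_min lexx orbT.
  have f1 : (\int[P]_x (g x)%:E)%E \is a fin_num.
    rewrite ge0_fin_numE; last by apply: integral_ge0 => x _; rewrite lee_fin.
    by apply: (le_lt_trans h2); rewrite -(fineK f2) -EFinD ltry.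
  split => //; move: h1 h2; rewrite -(fineK f1) -(fineK f2) -EFinD !lee_fin => h1 h2.
  by rewrite ger0_norm ?subr_ge0//= lerBlDl.
split; first by have [] := bnd u 1 mu u0 uC' ltr01.
apply/cvgrPdist_le => e e0.
pose M := 3 * (C + 1) / e.
have M0 : 0 < M by rewrite divr_gt0// mulr_gt0// ltr_wpDl.
have CM : C / M <= e / 3.
  rewrite /M invf_div mulrA ler_pdivrMr ?mulr_gt0 ?ltr_wpDl//.
  by nra.
have [|||||_ _ dM] := @dominated_convergence _ _ R P [set: T] measurableT
  (fun n x => (Num.min (u_ n x) M)%:E) (fun x => (Num.min (u x) M)%:E) (cst M%:E).
- by move=> n; apply/measurable_EFinP; exact: measurable_minr.
- by apply/measurable_EFinP; exact: measurable_minr.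
- move: cu; apply: filterS => x cux _; apply: cvg_EFin; first exact: nearW.
  apply/cvgrPdist_le => r r0; move/cvgrPdist_le: cux => /(_ r r0).
  apply: filterS => n; apply: le_trans.
  exact: ler_dist_minr.
- exact: (finite_measure_integrable_cst P).
- apply: aeW => x n _; rewrite lee_fin ger0_norm ?le_min ?u_0 ?(ltW M0)//.
  by rewrite ge_min lexx orbT.
have [_ f2 _] := bnd u M mu u0 uC' M0.
move: dM; rewrite -(fineK f2) => /fine_cvgP[_] /cvgrPdist_le/(_ (e / 3)); rewrite divr_gt0// => /(_ isT) dM.
near=> n.
have [_ _ b1] := bnd u M mu u0 uC' M0.
have [_ _ b2] := bnd (u_ n) M (mu_ n) (u_0 n) (uC n) M0.
have b3 : `|fine (\int[P]_x (Num.min (u x) M)%:E)%E - fine (\int[P]_x (Num.min (u_ n x) M)%:E)%E| <= e / 3.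
  by near: n.
move: b1 b2 b3; set A := fine _; set B := fine _; set A' := fine _; set B' := fine _ => b1 b2 b3.
have -> : A - A' = (A - B) + (B - B') - (A' - B') by ring.
rewrite (le_trans (ler_normB _ _))// (le_trans (lerD (ler_normD _ _) (lexx _)))//.
have := le_trans b1 CM; have := le_trans b2 CM; lra.
Unshelve. all: end_near. Qed.

End integral_limits.

Section laplace_chebyshev.
Context {R : realType} d (T : measurableType d) (P : probability T R).

(** Chebyshev's inequality for V under the finite measure of density L: when
    the second moment N2 / D of V is close to the square of its mean N1 / D,
    V seldom falls below half its mean. *)
Lemma laplace_chebyshev (L V : T -> R) (D N1 N2 : R) (A : set T) :
  measurable_fun [set: T] L -> measurable_fun [set: T] V -> measurable A ->
  (forall x, 0 <= L x) -> (forall x, 0 <= V x <= 1) ->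
  (\int[P]_x (L x)%:E = D%:E)%E ->
  (\int[P]_x (L x * V x)%:E = N1%:E)%E ->
  (\int[P]_x (L x * V x ^+ 2)%:E = N2%:E)%E ->
  0 < D -> 0 < N1 ->
  (forall x, A x -> V x <= N1 / D / 2) ->
  (\int[P]_(x in A) (L x)%:E <= (4 * (N2 * D / N1 ^+ 2 - 1) * D)%:E)%E.
Proof.
move=> mL mV mA L0 V01 LD LN1 LN2 D0 N10 AV.
pose a := N1 / D; have a0 : 0 < a by rewrite divr_gt0.
(* g = L (2 (V - a) / a)^2 dominates L where V is below a / 2. *)
pose g x := (4 / a ^+ 2) * (L x * V x ^+ 2) + (4 * L x - (8 / a) * (L x * V x)).
have mLV : measurable_fun [set: T] (fun x => L x * V x) by exact: measurable_funM.
have mLV2 : measurable_fun [set: T] (fun x => L x * V x ^+ 2).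
  by apply: measurable_funM => //; exact: measurable_funX.
have iL : P.-integrable [set: T] (EFin \o L).
  apply/integrableP; split; first exact/measurable_EFinP.
  by under eq_integral do rewrite /= ger0_norm//; rewrite LD ltry.
have iLV : P.-integrable [set: T] (EFin \o (fun x => L x * V x)).
  apply: le_integrable iL => //; first exact/measurable_EFinP.
  move=> x _; have /andP[V0 V1] := V01 x.
  by rewrite /= lee_fin ger0_norm ?mulr_ge0// [leRHS]ger0_norm// ler_piMr.
have iLV2 : P.-integrable [set: T] (EFin \o (fun x => L x * V x ^+ 2)).
  apply: le_integrable iL => //; first exact/measurable_EFinP.
  move=> x _; have /andP[V0 V1] := V01 x.
  by rewrite /= lee_fin ger0_norm ?mulr_ge0// ?exprn_ge0// [leRHS]ger0_norm// ler_piMr// exprn_ile1.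
have gE x : g x = 4 / a ^+ 2 * L x * (V x - a) ^+ 2.
  by rewrite /g; field; rewrite gt_eqF.
have g0 x : 0 <= g x.
  by rewrite gE mulr_ge0 ?sqr_ge0// mulr_ge0// divr_ge0// sqr_ge0.
have Ag x : A x -> L x <= g x.
  move=> Ax; rewrite gE mulrAC ler_peMl//.
  rewrite mulrAC ler_pdivlMr ?exprn_gt0// mul1r.
  have := AV x Ax; rewrite -/a => h.
  by have /andP[V0 _] := V01 x; nra.
have mg : measurable_fun [set: T] g.
  apply: measurable_funD; first exact: measurable_funM.
  by apply: measurable_funB; exact: measurable_funM.
apply: (@le_trans _ _ (\int[P]_x (g x)%:E)%E).
  apply: (@le_trans _ _ (\int[P]_(x in A) (g x)%:E)%E).
    apply: ge0_le_integral => //=.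
    - by move=> x _; rewrite lee_fin.
    - by apply/measurable_EFinP; apply: measurable_funTS.
    - by apply/measurable_EFinP; apply: measurable_funTS.
  by apply: ge0_subset_integral => //; [exact/measurable_EFinP|move=> x _; rewrite lee_fin].
have iB : P.-integrable [set: T] (fun x => (4 * L x)%:E - (8 / a * (L x * V x))%:E)%E.
  apply: integrableB => //; first exact: (integrableZl measurableT 4 iL).
  exact: (integrableZl measurableT (8 / a) iLV).
have -> : (\int[P]_x (g x)%:E = \int[P]_x ((4 / a ^+ 2)%:E * (L x * V x ^+ 2)%:E +
    ((4 * L x)%:E - (8 / a * (L x * V x))%:E)))%E.
  by apply: eq_integral.
rewrite integralD//; last exact: (integrableZl measurableT (4 / a ^+ 2) iLV2).
rewrite integralZl// integralB//; [|exact: (integrableZl measurableT 4 iL)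
  |exact: (integrableZl measurableT (8 / a) iLV)].
under [X in (_ + (X - _))%E]eq_integral do rewrite EFinM.
under [X in (_ + (_ - X))%E]eq_integral do rewrite EFinM.
rewrite !integralZl// LD LN1 LN2 -!EFinM -EFinB -EFinD lee_fin le_eqVlt; apply/orP; left.
by apply/eqP; rewrite /a; field; rewrite !gt_eqF.
Qed.

End laplace_chebyshev.

Section scalar.
Context {R : realType}.

Lemma sqrt_inv_expR (x : R) : 0 <= x -> expR (- x) <= (Num.sqrt (1 + 2 * x))^-1.
Proof.
move=> x0; rewrite expRN lef_pV2 ?posrE ?expR_gt0 ?sqrtr_gt0//; last lra.
rewrite -[leRHS]ger0_norm ?expR_ge0// -sqrtr_sqr ler_wsqrtr//.
by rewrite -expRM_natl; apply: expR_ge1Dx.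
Qed.

(** The first order terms in x cancel, so that the Laplace transform of a
    squared Gaussian variable at twice the argument exceeds its own square by a
    factor of second order only. *)
Lemma sqrt_inv_ratio (x : R) : 0 <= x ->
  (Num.sqrt (1 + 4 * x))^-1 <= (Num.sqrt (1 + 2 * x))^-1 ^+ 2 * expR (2 * x ^+ 2).
Proof.
move=> x0.
have h2 : 0 < 1 + 2 * x by lra.
have h4 : 0 < 1 + 4 * x by lra.
rewrite exprVn sqr_sqrtr ?(ltW h2)// [leRHS]mulrC ler_pdivlMr//.
rewrite [leLHS]mulrC ler_pdivrMr ?sqrtr_gt0//.
have -> : 1 + 2 * x = Num.sqrt ((1 + 2 * x) ^+ 2) by rewrite sqrtr_sqr gtr0_norm.
have -> : expR (2 * x ^+ 2) = Num.sqrt (expR (2 * x ^+ 2) ^+ 2).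
  by rewrite sqrtr_sqr ger0_norm ?expR_ge0.
rewrite -sqrtrM ?sqr_ge0// ler_wsqrtr// -expRM_natl.
have h := expR_ge1Dx (2 * (2 * x ^+ 2)).
apply: (@le_trans _ _ ((1 + 2 * (2 * x ^+ 2)) * (1 + 4 * x))); first nra.
by rewrite ler_wpM2r// ltW.
Qed.

End scalar.

(** * Weighted sums of squares of Gaussian variables *)

Section gauss_seq_sqr.
Context {R : realType} d (Om : measurableType d) (P : probability Om R).
Variables (X : nat -> Om -> R) (v : nat -> R).
Hypotheses (v_ge0 : forall i, 0 <= v i) (gX : gauss_seq P X v).

(** The expectation of the sum is finite. *)
Lemma gauss_seq_sqr_sum_ae (u : nat -> R) (M : R) : (forall k, 0 <= u k) ->
  (forall N, \sum_(k < N) u k * v k <= M) ->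
  {ae P, forall w, (\sum_(0 <= k <oo) (u k * X k w ^+ 2)%:E < +oo)%E}.
Proof.
move=> u0 uM.
have mX2 k : measurable_fun [set: Om] (fun w => (u k * X k w ^+ 2)%:E).
  apply/measurable_EFinP; apply: measurable_funM => //; apply: measurable_funX.
  exact: gauss_seq_measurable gX k.
have X20 k w : (0 <= (u k * X k w ^+ 2)%:E)%E by rewrite lee_fin mulr_ge0 ?sqr_ge0.
have msum : measurable_fun [set: Om] (fun w => \sum_(0 <= k <oo) (u k * X k w ^+ 2)%:E)%E.
  by apply: ge0_emeasurable_sum => //.
have isum : P.-integrable [set: Om] (fun w => \sum_(0 <= k <oo) (u k * X k w ^+ 2)%:E)%E.
  apply/integrableP; split => //.
  under eq_integral do rewrite gee0_abs ?nneseries_ge0//.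
  rewrite integral_nneseries//.
  apply: (@le_lt_trans _ _ M%:E); last by rewrite ltry.
  rewrite (eq_eseriesr (g := fun k => (u k * v k)%:E)).
    by apply: nneseries_le_bound => // k; rewrite mulr_ge0.
  move=> k _; under eq_integral do rewrite EFinM.
  have [iX2 EX2] := gauss_law_var (gauss_seq_coord gX k).
  have EX2' : (\int[P]_w (X k w ^+ 2)%:E = (v k)%:E)%E.
    rewrite sqr_sqrtr// in EX2; rewrite -EX2; apply: eq_integral => w _.
    by rewrite subr0.
  rewrite ge0_integralZl_EFin//.
  - by rewrite EX2'.
  - by move=> w _; rewrite lee_fin sqr_ge0.
  - apply/measurable_EFinP; apply: measurable_funX.
    exact: gauss_seq_measurable gX k.
have := integrable_ae measurableT isum.
apply: filterS => w /(_ I) fw; by rewrite ltey_eq fw.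
Qed.

(** [laplace_chebyshev] for exp (- lambda U), U the weighted square sum, whose
    Laplace transform is a product: U concentrates as soon as its weights are
    small compared with 1 / lambda. *)
Lemma gauss_seq_sqr_tail (u : nat -> R) (lambda t Sx Q : R) K :
  (forall k, 0 < u k) -> (forall k, v k = 1) -> 0 < lambda ->
  \sum_(k < K) u k <= Sx -> \sum_(k < K) (lambda * u k) ^+ 2 <= Q ->
  expR (- (lambda * t)) <= expR (- (lambda * Sx)) / 2 ->
  (P [set w | (t < \sum_(k < K) u k * X k w ^+ 2)%R] <=
    (4 * (expR (2 * Q) - 1))%:E)%E.
Proof.
move=> u0 v1 l0 uS uQ ht.
pose U w := \sum_(k < K) u k * X k w ^+ 2.
pose V w := expR (- (lambda * U w)).
have mX := gauss_seq_measurable gX.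
have mU : measurable_fun [set: Om] U.
  apply: measurable_sum => k; apply: measurable_funM => //.
  exact: measurable_funX.
have U0 w : 0 <= U w by apply: sumr_ge0 => k _; rewrite mulr_ge0 ?sqr_ge0// ltW.
have mV : measurable_fun [set: Om] V.
  by apply: measurableT_comp => //; apply: measurableT_comp => //; exact: measurable_funM.
have E (c : R) : 0 < c -> (\int[P]_w (expR (- (c * U w)))%:E =
    (\prod_(k < K) (Num.sqrt (1 + 2 * (c * u k)))^-1)%:E)%E.
  move=> c0; have := @gauss_seq_exp R _ _ P X v v_ge0 gX (fun=> 0) (fun k => 2 * (c * u k)) K.
  move=> /(_ (fun k => mulr_gt0 _ (mulr_gt0 c0 (u0 k)))) => H.
  rewrite (_ : \prod_(k < K) _ = \prod_(k < K) quad_mean 0 (2 * (c * u k)) (v k)).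
    rewrite -H//; apply: eq_integral => w _; congr (expR _)%:E.
    rewrite /U mulr_sumr -sumrN; apply: eq_bigr => k _; by field.
  apply: eq_bigr => k _; rewrite /quad_mean expr0n !mul0r expR0 mulr1.
  by rewrite v1 mulr1.
pose N1 := \prod_(k < K) (Num.sqrt (1 + 2 * (lambda * u k)))^-1.
pose N2 := \prod_(k < K) (Num.sqrt (1 + 4 * (lambda * u k)))^-1.
have x0 k : 0 <= lambda * u k by rewrite mulr_ge0// ltW.
have N10 : 0 < N1.
  by apply: prodr_gt0 => k _; rewrite invr_gt0 sqrtr_gt0; have := x0 k; lra.
have N1S : expR (- (lambda * Sx)) <= N1.
  apply: (@le_trans _ _ (\prod_(k < K) expR (- (lambda * u k)))).
    rewrite -expR_sum ler_expR sumrN lerN2 -mulr_sumr ler_wpM2l// ltW//.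
  apply: ler_prod => k _; rewrite expR_ge0/=; exact: sqrt_inv_expR.
have N2N1 : N2 <= N1 ^+ 2 * expR (2 * Q).
  apply: (@le_trans _ _ (N1 ^+ 2 * expR (2 * \sum_(k < K) (lambda * u k) ^+ 2))); last first.
    by rewrite ler_wpM2l ?sqr_ge0// ler_expR ler_wpM2l.
  rewrite mulr_sumr expR_sum -prodrXl -big_split/=.
  apply: ler_prod => k _; rewrite invr_ge0 sqrtr_ge0/=; exact: sqrt_inv_ratio.
have Amea : measurable [set w | (t < U w)%R].
  rewrite (_ : [set w | _] = U @^-1` `]t, +oo[%classic).
    by rewrite -[X in measurable X]setTI; apply: mU.
  by apply/seteqP; split => w; rewrite /= in_itv/= andbT.
have H : (\int[P]_(x in [set w | (t < U w)%R]) (cst 1 x)%:E <=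
    (4 * (N2 * 1 / N1 ^+ 2 - 1) * 1)%:E)%E.
  apply: (@laplace_chebyshev R _ _ P (cst 1) V 1 N1 N2) => //.
  - move=> w; rewrite expR_ge0/= -[leRHS]expR0 ler_expR oppr_le0.
    by rewrite mulr_ge0// ltW.
  - exact: prob_integral_cst.
  - by rewrite -E//; apply: eq_integral => w _; rewrite /cst mul1r.
  - have -> : N2 = \prod_(k < K) (Num.sqrt (1 + 2 * (2 * lambda * u k)))^-1.
      by apply: eq_bigr => k _; congr (Num.sqrt (1 + _))^-1; ring.
    rewrite -E ?mulr_gt0//; apply: eq_integral => w _; congr EFin.
    by rewrite /cst mul1r /V -expRM_natl; congr expR; ring.
  - move=> w /= tU; rewrite divr1.
    apply: (@le_trans _ _ (expR (- (lambda * Sx)) / 2)); last by rewrite ler_wpM2r.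
    by apply: le_trans ht; rewrite ler_expR lerN2 ler_wpM2l// ltW.
move: H; rewrite (_ : (\int[P]_(x in _) _ = P [set w | (t < U w)%R])%E); last first.
  by rewrite -[RHS]mul1e -integral_cst.
move/le_trans; apply; rewrite lee_fin !mulr1 ler_wpM2l// lerD2r.
by rewrite ler_pdivrMr ?exprn_gt0// mulrC.
Qed.

End gauss_seq_sqr.

(** * Hilbert spaces and the conjugate basis *)

Section hilbert_theory.
Context {R : realType} (H : hilbertType R).
Implicit Types x y z : H.

Lemma innerC x y : inner x y = inner y x.
Proof. by rewrite hermC mul1r. Qed.

Lemma innerDl x y z : inner (x + y) z = inner x z + inner y z.
Proof. exact: linearDl. Qed.

Lemma innerBl x y z : inner (x - y) z = inner x z - inner y z.
Proof. exact: linearBl. Qed.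

Lemma innerZl a x y : inner (a *: x) y = a * inner x y.
Proof. exact: linearZl_LR. Qed.

Lemma innerZr a x y : inner x (a *: y) = a * inner x y.
Proof. by rewrite innerC innerZl innerC. Qed.

Lemma inner_suml n (c : nat -> R) (u : nat -> H) y :
  inner (\sum_(k < n) c k *: u k) y = \sum_(k < n) c k * inner (u k) y.
Proof.
elim: n => [|n IH]; first by rewrite !big_ord0 linear0l.
by rewrite !big_ord_recr/= innerDl innerZl IH.
Qed.

Lemma cauchy_schwarz x y : `|inner x y| <= `|x| * `|y|.
Proof.
have [->|y0] := eqVneq y 0; first by rewrite linear0r !normr0 mulr0.
have n0 : 0 < `|y| by rewrite normr_gt0.
rewrite -(@ler_pXn2r _ 2)// ?nnegrE ?mulr_ge0// exprMn real_normK ?num_real//.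
pose t := inner x y / `|y| ^+ 2.
have : 0 <= inner (x - t *: y) (x - t *: y) by rewrite inner_norm sqr_ge0.
rewrite innerBl innerZl (innerC x) (innerC y) !innerBl !innerZl !inner_norm (innerC y x).
have n2 : 0 < `|y| ^+ 2 by rewrite exprn_gt0.
have -> : inner x y = t * `|y| ^+ 2 by rewrite /t divfK ?gt_eqF.
move=> h. have : 0 <= `|x| ^+ 2 - t ^+ 2 * `|y| ^+ 2 by move: h; rewrite -!mulrA; lra.
by nra.
Qed.

Lemma continuous_innerl y : continuous (fun x : H => inner x y).
Proof.
move=> x; apply/cvgrPdist_le => e e0.
have y1 : 0 < `|y| + 1 by rewrite ltr_wpDl.
near=> z; rewrite -innerBl (le_trans (cauchy_schwarz _ _))//.
apply: (@le_trans _ _ (`|x - z| * (`|y| + 1))).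
  by rewrite ler_wpM2l// lerDl.
rewrite -ler_pdivlMr//.
near: z; apply: cvgr_dist_le; first exact: cvg_id.
by rewrite divr_gt0.
Unshelve. all: end_near. Qed.

Lemma orthonormal_sum_norm (g : nat -> H) (c : nat -> R) n :
  orthonormal_system g ->
  `|\sum_(k < n) c k *: g k| ^+ 2 = \sum_(k < n) c k ^+ 2.
Proof.
move=> og; rewrite -inner_norm inner_suml; apply: eq_bigr => k _.
rewrite innerC inner_suml (bigD1 k)//= big1 ?addr0 => [|j jk].
  by rewrite og eqxx mulr1.
by rewrite og (_ : (j == k :> nat) = false) ?mulr0//; exact: negbTE.
Qed.

Lemma parseval_series (g : nat -> H) (c : nat -> R) x :
  orthonormal_system g -> series (fun k => c k *: g k) @ \oo --> x ->
  \sum_(k < n) c k ^+ 2 @[n --> \oo] --> `|x| ^+ 2.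
Proof.
move=> og cx.
have -> : (fun n => \sum_(k < n) c k ^+ 2) =
    (fun n => `|series (fun k => c k *: g k) n| ^+ 2).
  by apply/funext => n; rewrite seriesEord/= orthonormal_sum_norm.
by apply: cvgM; apply: cvg_norm.
Qed.

End hilbert_theory.

Section spectral_operator.
Context {R : realType} (H1 H2 : hilbertType R).
Variables (A : {linear H1 -> H2}) (Aadj : {linear H2 -> H1}).
Hypotheses (A_cont : continuous A) (A_inj : injective A).
Hypothesis AadjP : is_adjoint A Aadj.
Variables (e : nat -> H1) (rho : nat -> R) (g : nat -> H2).
Hypothesis e_basis : orthonormal_basis e.
Hypothesis e_eigen : forall k, Aadj (A (e k)) = rho k ^+ 2 *: e k.
Hypothesis g_conj : forall k, A (e k) = rho k *: g k.

Lemma eigenvalue_neq0 k : rho k != 0.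
Proof.
apply/eqP => r0; have [oe _] := e_basis.
have : e k = 0 by apply: A_inj; rewrite g_conj r0 scale0r linear0.
by move=> ek; have := oe k k; rewrite ek linear0l eqxx => /esym/eqP; rewrite oner_eq0.
Qed.

Lemma conjugate_orthonormal : orthonormal_system g.
Proof.
move=> i j; have [oe _] := e_basis.
have : inner (A (e i)) (A (e j)) = rho j ^+ 2 * (i == j)%:R.
  by rewrite AadjP e_eigen innerZr oe.
rewrite !g_conj innerZl innerZr => h.
have h2 : rho i * rho j != 0 by rewrite mulf_neq0 ?eigenvalue_neq0.
apply: (mulfI h2); rewrite -mulrA h.
by have [->|] := eqVneq i j; rewrite ?mulr0// expr2.
Qed.

Lemma inner_conjugate f k : inner (A f) (g k) = rho k * inner f (e k).
Proof.
have r0 := eigenvalue_neq0 k; apply: (mulfI r0).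
have : inner (A f) (A (e k)) = rho k * inner (A f) (g k) by rewrite g_conj innerZr.
by move=> <-; rewrite AadjP e_eigen innerZr mulrA expr2.
Qed.

Lemma basis_norm f : \sum_(k < n) inner f (e k) ^+ 2 @[n --> \oo] --> `|f| ^+ 2.
Proof. by have [oe be] := e_basis; apply: parseval_series (be f). Qed.

Lemma operator_norm f :
  \sum_(k < n) (rho k * inner f (e k)) ^+ 2 @[n --> \oo] --> `|A f| ^+ 2.
Proof.
have [oe be] := e_basis.
apply: (@parseval_series _ _ g (fun k => rho k * inner f (e k)) _ conjugate_orthonormal).
have -> : series (fun k => (rho k * inner f (e k)) *: g k) =
    A \o series (fun k => inner f (e k) *: e k).
  apply/funext => n; rewrite /= !seriesEord/= linear_sum; apply: eq_bigr => k _.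
  by rewrite linearZ /= g_conj scalerA mulrC.
exact: cvg_comp (be f) (@A_cont f).
Qed.

End spectral_operator.

(** * Borel sets and the support of the prior *)

Section borel_measurability.
Context {R : realType}.

Lemma open_borel (T : ptopologicalType) (U : set T) : open U ->
  measurable (U : set (borel T)).
Proof. exact: sub_sigma_algebra. Qed.

Lemma continuous_borel_measurable (T : ptopologicalType) (f : T -> R) :
  continuous f -> measurable_fun [set: borel T] (f : borel T -> R).
Proof.
move=> /continuousP cf; apply: (measurability _ (RGenOpens.measurableE R)).
move=> _ [_ [a [b ->] <-]]; rewrite setTI; apply: open_borel.
exact/cf/interval_open.
Qed.

(** Off the set where the sequence converges limn takes a fixed default value,
    so that measurability only depends on that set. *)
Lemma measurable_fun_limn d (T : measurableType d) (h : nat -> T -> R) :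
  (forall n, measurable_fun [set: T] (h n)) ->
  measurable_fun [set: T] (fun x => limn (h ^~ x)).
Proof.
move=> mh.
pose C := [set x | cvgn (h ^~ x)].
have mC : measurable C.
  have -> : C = \bigcap_k \bigcup_N \bigcap_(n >= N)
      [set x | `|h N x - h n x| <= k.+1%:R^-1].
    apply/seteqP; split => x /=.
      move=> /cvg_ex[l cl] k _.
      have k0 : 0 < k.+1%:R^-1 / 2 :> R by rewrite divr_gt0// invr_gt0.
      move/cvgrPdist_le: cl => /(_ _ k0)[N _ hN].
      exists N => // n /= Nn.
      have -> : h N x - h n x = (l - h n x) - (l - h N x) by ring.
      rewrite (le_trans (ler_normB _ _))// [k.+1%:R^-1]splitr lerD//.
        exact: hN.
      by apply: hN => /=.
    move=> hx; apply/cauchy_cvgP; apply: cauchy_exP => r r0.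
    pose k := Num.trunc r^-1.
    have [N _ hN] := hx k I.
    exists (h N x); exists N => // n Nn /=.
    rewrite /ball/= (le_lt_trans (hN n Nn))//.
    by rewrite -[ltRHS]invrK ltf_pV2 ?posrE ?invr_gt0// truncnS_gt.
  apply: bigcap_measurable => // k _; apply: bigcup_measurable => N _.
  apply: bigcap_measurable => [|n _]; first by exists N => /=.
  rewrite (_ : [set x | _] = (fun x => `|h N x - h n x|) @^-1` `]-oo, k.+1%:R^-1]%classic).
    rewrite -[X in measurable X]setTI.
    by apply: measurableT_comp => //; exact: measurable_funB.
  by apply/seteqP; split => x; rewrite /= in_itv.
pose c : R := point.
have -> : (fun x => limn (h ^~ x)) =
    (fun x => limn (fun n => h n x * \1_C x) + c * \1_(~` C) x).
  apply/funext => x; rewrite !indicE in_setC; case: (boolP (x \in C)) => xC.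
    rewrite mulr0 addr0 (_ : (fun n => h n x * _) = h ^~ x)//.
    by apply/funext => n; rewrite mulr1.
  rewrite (_ : (fun n => h n x * _) = cst 0); last by apply/funext => n; rewrite /= mulr0.
  rewrite lim_cst// add0r mulr1; apply: getPN => l hl.
  by move/negP: xC; apply; rewrite inE; apply/cvg_ex; exists l.
apply: measurable_funD; last by apply: measurable_funM => //; apply: measurable_indic; exact: measurableC.
apply: (@measurable_fun_cvg _ _ _ _ (fun n x => h n x * \1_C x)).
  by move=> n; apply: measurable_funM.
move=> x _; rewrite indicE; case: (boolP (x \in C)) => xC.
  rewrite (_ : (fun n => h n x * _) = h ^~ x); last by apply/funext => n; rewrite mulr1.
  by move: xC; rewrite inE.
rewrite (_ : (fun n => h n x * _) = cst 0); last by apply/funext => n; rewrite /= mulr0.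
by rewrite lim_cst//; exact: cvg_cst.
Qed.

End borel_measurability.

Section support.
Context {R : realType} (H : hilbertType R) (Pi : probability (borel H) R).

Lemma measurable_support : measurable (measure_support Pi : set (borel H)).
Proof.
rewrite -[X in measurable X]setCK; apply: measurableC; apply: open_borel.
rewrite (_ : ~` _ = \bigcup_(U in [set U : set H | open U /\ ~ (0 < Pi U)%E]) U).
  by apply: bigcup_open => U [].
apply/seteqP; split => x /=.
  by move=> /existsNP[U /not_implyP[oU /not_implyP[Ux U0]]]; exists U.
by move=> [U [oU U0] Ux] /(_ U oU Ux).
Qed.

(** A point off the support lies in a null ball of radius 1 / (q + 1) centred in a
    countable dense set, and there are countably many such balls. *)
Lemma support_negligible : separable H ->
  Pi.-negligible (~` (measure_support Pi : set (borel H))).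
Proof.
move=> [D cD dD]; have /countable_injP[f injf] := cD.
pose B (n q : nat) : set (borel H) := \bigcup_(d in [set d : H | [/\ D d, f d = n &
  Pi (ball d q.+1%:R^-1) = 0%E]]) ball d q.+1%:R^-1.
apply: (@negligibleS _ _ _ _ (\bigcup_n \bigcup_q B n q)); last first.
  apply: negligible_bigcup => n; apply: negligible_bigcup => q.
  have [[d [Dd fd Pd]]|noD] := pselect (exists d : H, [/\ D d, f d = n &
      Pi (ball d q.+1%:R^-1) = 0%E]).
    apply: (@negligibleS _ _ _ _ (ball d q.+1%:R^-1 : set (borel H))).
      move=> x [d' [Dd' fd' _]].
      by rewrite (_ : d' = d)//; apply: injf; rewrite ?inE// fd fd'.
    exists (ball d q.+1%:R^-1); split => //.
    by apply: open_borel; apply: ball_open; rewrite invr_gt0.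
  apply: (@negligibleS _ _ _ _ set0); last exact: negligible_set0.
  by move=> x [d hd _]; apply: noD; exists d.
move=> x /existsNP[U /not_implyP[oU /not_implyP[Ux U0]]].
have PU0 : Pi U = 0%E.
  by apply/eqP; rewrite eq_le measure_ge0 andbT leNgt; exact/negP.
have /nbhs_ballP[r /= r0 rU] : nbhs x U by exact: open_nbhs_nbhs.
pose q := Num.trunc (2 / r).
have qr : 0 < q.+1%:R^-1 :> R by rewrite invr_gt0.
have q2 : q.+1%:R^-1 < r / 2.
  by rewrite -[ltRHS]invf_div ltf_pV2 ?posrE ?divr_gt0// truncnS_gt.
have [d [xd Dd]] : (ball x q.+1%:R^-1 `&` D) !=set0.
  apply: dD; last by apply: ball_open.
  by exists x; exact: ballxx.
exists (f d) => //; exists q => //; exists d; last by apply: ball_sym.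
split => //; apply/eqP; rewrite eq_le measure_ge0 andbT -PU0.
apply: le_measure; rewrite ?inE.
- by apply: open_borel; apply: ball_open.
- exact: open_borel.
move=> z dz; apply: rU; apply: (@le_ball _ _ _ (q.+1%:R^-1 + q.+1%:R^-1)).
  by rewrite [r]splitr lerD// ltW.
exact: ball_triangle xd dz.
Qed.

Lemma ge0_integral_support (L : borel H -> R) : separable H ->
  measurable_fun [set: borel H] L -> (forall f, 0 <= L f) ->
  (\int[Pi]_(f in measure_support Pi) (L f)%:E = \int[Pi]_f (L f)%:E)%E.
Proof.
move=> sH mL L0; have mS := measurable_support.
have N0 : Pi (~` (measure_support Pi : set (borel H))) = 0%E.
  by apply/negligibleP; [exact: measurableC|exact: support_negligible].
rewrite [RHS](ge0_negligible_integral (measurableC mS))//.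
- by rewrite setTD setCK.
- exact/measurable_EFinP.
- by move=> f _; rewrite lee_fin.
Qed.

End support.

(** * The Gaussian prior and the rates of its posterior *)

Section prior.
Context {R : realType} (H : hilbertType R).

Lemma gaussian_measure_gauss_seq (Pi : probability (borel H) R)
    (L : {linear H -> H}) (e : nat -> H) (v : nat -> R) :
  gaussian_measure Pi L -> orthonormal_basis e ->
  (forall k, L (e k) = v k *: e k) ->
  gauss_seq Pi (fun k (f : borel H) => inner (f : H) (e k)) v.
Proof.
move=> [_ [d [Om [Q [G [PiG cG]]]]]] [oe _] Le N c.
have gQ : gauss_seq Q (fun k w => inner (G w : H) (e k)) v.
  apply: (centered_gaussian_gauss_seq cG) => i j.
  rewrite Le innerZr oe; have [->|_] := eqVneq i j; last by rewrite mulr0 mul0r.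
  by rewrite mulr1 mul1r.
have [_ s0 law] := gQ N c.
have mS : measurable_fun [set: borel H] (fun f : borel H => \sum_(i < N) c i * inner (f : H) (e i)).
  apply: measurable_sum => i; apply: measurable_funM => //.
  by apply: continuous_borel_measurable; exact: continuous_innerl.
split => // B mB.
rewrite -law// PiG//.
by rewrite -[X in measurable X]setTI; exact: mS.
Qed.

End prior.

Section shrinkage.
Context {R : realType}.
Implicit Types A B c t s mu : R.

(** The Laplace transform at c of (X - x0)^2 when X - x0 ~ N(mu, s). *)
Definition sqr_laplace c s mu : R :=
  (Num.sqrt (1 + 2 * c * s))^-1 * expR (- (c * mu ^+ 2 / (1 + 2 * c * s))).

(** Completing the square: against the prior N(0, t), the likelihood
    exp (A x - B x^2 / 2) turns into the law of variance s = t / (1 + B t) and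
    mean A s. *)
Lemma quad_mean_tilt A B c (x0 : R) t : 0 < B -> 0 <= c -> 0 <= t ->
  quad_mean (A + 2 * c * x0) (B + 2 * c) t * expR (- (c * x0 ^+ 2)) =
  quad_mean A B t *
    sqr_laplace c (t / (1 + B * t)) (A * (t / (1 + B * t)) - x0).
Proof.
move=> B0 c0 t0.
have T0 : 0 < 1 + B * t by rewrite ltr_pwDl// mulr_ge0// ltW.
have Tc : 0 < 1 + (B + 2 * c) * t.
  by rewrite ltr_pwDl// mulr_ge0// addr_ge0 ?mulr_ge0// ltW.
have E : 1 + 2 * c * (t / (1 + B * t)) = (1 + (B + 2 * c) * t) / (1 + B * t).
  by field; rewrite gt_eqF.
rewrite /quad_mean /sqr_laplace E.
have -> : (Num.sqrt ((1 + (B + 2 * c) * t) / (1 + B * t)))^-1 =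
    Num.sqrt (1 + B * t) * (Num.sqrt (1 + (B + 2 * c) * t))^-1.
  by rewrite sqrtrM ?(ltW Tc)// sqrtrV ?(ltW T0)// invfM invrK mulrC.
have sT : Num.sqrt (1 + B * t) != 0 by rewrite gt_eqF// sqrtr_gt0.
rewrite -[LHS]mulrA -expRD [RHS]mulrACA -expRD (mulrA _ (Num.sqrt _)) mulVf// mul1r.
by congr (_ * expR _); field; rewrite !gt_eqF.
Qed.

Lemma sqr_laplace_gt0 c s mu : 0 <= c -> 0 <= s -> 0 < sqr_laplace c s mu.
Proof.
move=> c0 s0; rewrite mulr_gt0 ?expR_gt0// invr_gt0 sqrtr_gt0.
by rewrite ltr_pwDl// !mulr_ge0.
Qed.

Lemma sqr_laplace_ge c s mu : 0 <= c -> 0 <= s ->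
  expR (- (c * s + c * mu ^+ 2)) <= sqr_laplace c s mu.
Proof.
move=> c0 s0; rewrite opprD expRD ler_pM ?expR_ge0//.
  by rewrite -mulrA sqrt_inv_expR// mulr_ge0.
have h : 1 <= 1 + 2 * c * s by rewrite lerDl !mulr_ge0.
rewrite ler_expR lerN2 ler_pdivrMr ?(lt_le_trans ltr01)//.
by rewrite ler_peMr// mulr_ge0// sqr_ge0.
Qed.

Lemma sqr_laplace_double c s mu : 0 <= c -> 0 <= s ->
  sqr_laplace (2 * c) s mu <=
  sqr_laplace c s mu ^+ 2 *
    expR (2 * (c * s) ^+ 2 + 4 * (c * s) * (c * mu ^+ 2)).
Proof.
move=> c0 s0; rewrite /sqr_laplace exprMn expRD [leRHS]mulrACA.
have x0 : 0 <= c * s by rewrite mulr_ge0.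
apply: ler_pM; rewrite ?invr_ge0 ?sqrtr_ge0 ?expR_ge0//.
  rewrite (_ : 2 * (2 * c) * s = 4 * (c * s)); last by ring.
  rewrite (_ : 2 * c * s = 2 * (c * s)); last by rewrite mulrA.
  exact: sqrt_inv_ratio.
rewrite -expRM_natl -expRD ler_expR.
set x := c * s in x0 *; set q := c * mu ^+ 2.
have q0 : 0 <= q by rewrite mulr_ge0 ?sqr_ge0.
have -> : 2 * (2 * c) * s = 4 * x by rewrite /x; ring.
have -> : 2 * c * s = 2 * x by rewrite /x; ring.
have -> : 2 * c * mu ^+ 2 = 2 * q by rewrite /q; ring.
clearbody x q.
have h2 : 0 < 1 + 2 * x by lra.
have h4 : 0 < 1 + 4 * x by lra.
have -> : - (2 * q / (1 + 4 * x)) =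
    2 * - (q / (1 + 2 * x)) + 4 * x * q / ((1 + 2 * x) * (1 + 4 * x)).
  by field; rewrite !gt_eqF.
rewrite lerD2l ler_pdivrMr ?mulr_gt0// ler_peMr ?mulr_ge0//.
by nra.
Qed.

End shrinkage.

Section rates.
Context {R : realType}.

Lemma weight_ge1 k : 1 <= weight k :> R.
Proof. by rewrite /weight lerDl sqr_ge0. Qed.

Lemma weight_gt0 k : 0 < weight k :> R.
Proof. exact: lt_le_trans ltr01 (weight_ge1 k). Qed.

Lemma weight_sqrt_ge k : k.+1%:R <= weight k `^ (2^-1) :> R.
Proof.
rewrite powR12_sqrt ?(ltW (weight_gt0 k))//.
rewrite -[leLHS](@ger0_norm R) ?ler0n// -sqrtr_sqr ler_wsqrtr//.
by rewrite /weight lerDr.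
Qed.

Variables (alpha delta c1 : R).
Hypotheses (alpha_ge0 : 0 <= alpha) (delta_gt0 : 0 < delta) (c1_gt0 : 0 < c1).
Variables (rho : nat -> R).
Hypothesis rho_ge : forall k, c1 * weight k `^ (- alpha) <= rho k ^+ 2.

Definition prior_var k : R := weight k `^ (- delta - 2^-1).
Definition post_var (n : R) k : R :=
  prior_var k / (1 + n * rho k ^+ 2 * prior_var k).

Let u k : R := weight k `^ (2^-1).
Let u_gt0 k : 0 < u k. Proof. by rewrite powR_gt0// weight_gt0. Qed.
Let wE k p : weight k `^ p = u k `^ (2 * p) :> R.
Proof. by rewrite /u -powRrM mulrA mulVf ?mul1r. Qed.

Lemma prior_var_gt0 k : 0 < prior_var k.
Proof. by rewrite powR_gt0// weight_gt0. Qed.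

Lemma prior_var_le k : prior_var k <= k.+1%:R `^ (- (2 * delta + 1)).
Proof.
rewrite /prior_var wE (_ : 2 * (- delta - 2^-1) = - (2 * delta + 1)); last by field.
have q0 : 0 <= 2 * delta + 1 by rewrite addr_ge0// mulr_ge0// ltW.
rewrite !powRN lef_pV2 ?posrE ?powR_gt0 ?weight_gt0//.
apply: ge0_ler_powR => //; rewrite ?nnegrE ?ler0n ?(ltW (u_gt0 _))//.
exact: weight_sqrt_ge.
Qed.

Variable kappa : R.
Hypothesis kappa_ge1 : 1 <= kappa.
Let kappa_gt0 : 0 < kappa. Proof. exact: lt_le_trans kappa_ge1. Qed.
Let n : R := kappa `^ (2 * alpha + 2 * delta + 1).
Let n_gt0 : 0 < n. Proof. by rewrite powR_gt0. Qed.

Lemma post_var_gt0 k : 0 < post_var n k.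
Proof.
rewrite divr_gt0 ?prior_var_gt0// ltr_pwDl// mulr_ge0 ?(ltW (prior_var_gt0 _))//.
by rewrite mulr_ge0 ?sqr_ge0// ltW.
Qed.

(** Data and prior precisions balance at frequency kappa. *)
Lemma signal_noise_ge k :
  c1 * (kappa / u k) `^ (2 * alpha + 2 * delta + 1) <= n * rho k ^+ 2 * prior_var k.
Proof.
have -> : (kappa / u k) `^ (2 * alpha + 2 * delta + 1) =
    n * u k `^ (- (2 * alpha)) * u k `^ (- (2 * delta + 1)).
  rewrite powRM ?invr_ge0 ?(ltW (u_gt0 _)) ?(ltW kappa_gt0)// -mulrA; congr (_ * _).
  rewrite -powR_inv1 ?(ltW (u_gt0 _))// -powRrM -powRD; last first.
    by rewrite (gt_eqF (u_gt0 _)) implybT.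
  by congr (_ `^ _); ring.
have -> : prior_var k = u k `^ (- (2 * delta + 1)).
  by rewrite /prior_var wE; congr (_ `^ _); field.
rewrite mulrA ler_wpM2r ?powR_ge0// mulrCA ler_wpM2l ?(ltW n_gt0)//.
by have := rho_ge k; rewrite wE mulrN.
Qed.

Definition rate_const : R := 2 `^ (2 * delta + 1) * (1 + c1^-1).

Lemma rate_const_gt0 : 0 < rate_const.
Proof. by rewrite mulr_gt0 ?powR_gt0// addr_gt0 ?invr_gt0. Qed.

(** Coordinates beyond frequency kappa keep at most their prior variance; for those
    below, the precision of the data dominates. *)
Lemma post_var_le k :
  post_var n k <= rate_const * (kappa + k.+1%:R) `^ (- (2 * delta + 1)).
Proof.
set q := 2 * delta + 1; have q0 : 0 < q by rewrite addr_gt0// mulr_gt0.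
have uk := weight_sqrt_ge k; rewrite -/(u k) in uk.
have ku0 : 0 < kappa + u k by rewrite addr_gt0.
have hk : 0 < kappa + k.+1%:R by rewrite addr_gt0.
apply: (@le_trans _ _ (rate_const * (kappa + u k) `^ (- q))); last first.
  rewrite ler_wpM2l ?(ltW rate_const_gt0)// !powRN lef_pV2 ?posrE ?(powR_gt0 _ ku0) ?(powR_gt0 _ hk)//.
  apply: ge0_ler_powR; rewrite ?nnegrE ?(ltW q0)//.
  - by rewrite addr_ge0// ltW.
  - by rewrite ltW.
  - by rewrite lerD2l.
have pE : prior_var k = u k `^ (- q).
  by rewrite /prior_var wE; congr (_ `^ _); rewrite /q; field.
have -> : rate_const * (kappa + u k) `^ (- q) = (1 + c1^-1) * ((kappa + u k) / 2) `^ (- q).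
  rewrite /rate_const powRM ?(ltW ku0)// mulrAC mulrC; congr (_ * _).
  by rewrite mulrC; congr (_ * _); rewrite -(powR_inv1 (ler0n R 2)) -powRrM mulN1r opprK.
have h0 : 0 < (kappa + u k) / 2 by rewrite divr_gt0.
have sn := signal_noise_ge k.
have pv := prior_var_gt0 k.
have nr0 : 0 <= n * rho k ^+ 2 * prior_var k by rewrite mulr_ge0 ?(ltW pv)// mulr_ge0 ?sqr_ge0// ltW.
have [ku|uk'] := leP kappa (u k).
  apply: (@le_trans _ _ (prior_var k)).
    rewrite /post_var ler_pdivrMr; last by rewrite ltr_pwDl.
    by rewrite ler_peMr ?(ltW pv)// lerDl.
  apply: (@le_trans _ _ (1 * ((kappa + u k) / 2) `^ (- q))); last first.
    by rewrite ler_wpM2r ?powR_ge0// lerDl invr_ge0 ltW.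
  rewrite mul1r pE !powRN lef_pV2 ?posrE ?(powR_gt0 _ h0) ?(powR_gt0 _ (u_gt0 k))//.
  apply: ge0_ler_powR; rewrite ?nnegrE ?(ltW q0) ?(ltW h0) ?(ltW (u_gt0 _))//.
  lra.
apply: (@le_trans _ _ (c1^-1 * kappa `^ (- q))).
  rewrite /post_var ler_pdivrMr; last by rewrite ltr_pwDl.
  have ku1 : 1 <= kappa / u k by rewrite ler_pdivlMr// mul1r ltW.
  have e : prior_var k = c1^-1 * kappa `^ (- q) * (c1 * (kappa / u k) `^ q).
    rewrite mulrACA mulVf ?gt_eqF// mul1r powRM ?invr_ge0 ?(ltW (u_gt0 _)) ?(ltW kappa_gt0)//.
    rewrite mulrA -powRD; last by rewrite (gt_eqF kappa_gt0) implybT.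
    by rewrite addNr powRr0 mul1r -(powR_inv1 (ltW (u_gt0 k))) -powRrM mulN1r.
  rewrite {1}e ler_wpM2l ?mulr_ge0 ?powR_ge0 ?invr_ge0 ?(ltW c1_gt0)//.
  apply: (@le_trans _ _ (n * rho k ^+ 2 * prior_var k)); last by rewrite lerDr.
  apply: le_trans sn; rewrite ler_wpM2l ?(ltW c1_gt0)//.
  by apply: ler_powR => //; rewrite /q; have := alpha_ge0; lra.
apply: ler_pM; rewrite ?invr_ge0 ?powR_ge0 ?(ltW c1_gt0)//; first by rewrite lerDr.
rewrite !powRN lef_pV2 ?posrE ?powR_gt0 ?weight_gt0//.
apply: ge0_ler_powR; rewrite ?nnegrE ?(ltW q0) ?(ltW h0) ?(ltW kappa_gt0)//.
lra.
Qed.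

Lemma post_var_le_max k :
  post_var n k <= rate_const * kappa `^ (- (2 * delta + 1)).
Proof.
apply: (le_trans (post_var_le k)).
rewrite ler_wpM2l ?(ltW rate_const_gt0)// !powRN lef_pV2 ?posrE ?powR_gt0//; last exact: addr_gt0.
apply: ge0_ler_powR; rewrite ?nnegrE ?addr_ge0 ?mulr_ge0 ?(ltW delta_gt0) ?(ltW kappa_gt0)//.
by rewrite lerDl.
Qed.

Lemma sum_post_var_le K :
  \sum_(k < K) post_var n k <= rate_const / (2 * delta) * kappa `^ (- (2 * delta)).
Proof.
apply: (@le_trans _ _ (\sum_(k < K) rate_const * (kappa + k.+1%:R) `^ (- (2 * delta + 1)))).
  by apply: ler_sum => k _; exact: post_var_le.
rewrite -mulr_sumr -mulrA ler_wpM2l ?(ltW rate_const_gt0)// [leRHS]mulrC.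
by apply: sum_powR_le => //; rewrite mulr_gt0.
Qed.

(** The shrinkage factor of the k-th coefficient, compared with the Sobolev
    weight: this is the squared bias. *)
Lemma shrinkage_le (beta gamma : R) k : 0 <= beta -> beta <= delta -> beta <= gamma ->
  (1 / (1 + n * rho k ^+ 2 * prior_var k)) ^+ 2 <=
  (1 + c1^-1) ^+ 2 * kappa `^ (- (2 * beta)) * weight k `^ gamma.
Proof.
move=> b0 bd bg; set b := 1 / _.
have sn := signal_noise_ge k.
have pv := prior_var_gt0 k.
have nr0 : 0 <= n * rho k ^+ 2 * prior_var k by rewrite mulr_ge0 ?(ltW pv)// mulr_ge0 ?sqr_ge0// ltW.
have T0 : 0 < 1 + n * rho k ^+ 2 * prior_var k by rewrite ltr_pwDl.
have bge0 : 0 <= b by rewrite divr_ge0// ltW.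
have uk0 : 0 < u k / kappa by rewrite divr_gt0.
have c1V : 0 <= c1^-1 by rewrite invr_ge0 ltW.
have M1 : 0 <= 1 + c1^-1 by rewrite addr_ge0.
suff bu : b <= (1 + c1^-1) * (u k / kappa) `^ beta.
  apply: (@le_trans _ _ (((1 + c1^-1) * (u k / kappa) `^ beta) ^+ 2)).
    by rewrite lerXn2r ?nnegrE// mulr_ge0// powR_ge0.
  rewrite exprMn -mulrA ler_wpM2l ?sqr_ge0//.
  rewrite -powR_mulrn ?powR_ge0// -powRrM powRM ?invr_ge0 ?(ltW (u_gt0 _)) ?(ltW kappa_gt0)//.
  rewrite mulrC -powR_inv1 ?(ltW kappa_gt0)// -powRrM mulN1r (mulrC beta).
  rewrite ler_wpM2l ?powR_ge0// wE; apply: ler_powR.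
    by rewrite (le_trans _ (weight_sqrt_ge k))// ler1n.
  by rewrite ler_pM2l.
have [ku|uk'] := leP kappa (u k).
  rewrite (@le_trans _ _ 1)//; first by rewrite /b ler_pdivrMr// mul1r lerDl.
  rewrite -[leLHS]mulr1 ler_pM//; first by rewrite lerDl.
  rewrite -[leLHS](@powRr0 _ (u k / kappa)); apply: ler_powR => //.
  by rewrite ler_pdivlMr// mul1r.
apply: (@le_trans _ _ (c1^-1 * (u k / kappa) `^ beta)); last first.
  by rewrite ler_wpM2r ?powR_ge0// lerDr.
rewrite /b ler_pdivrMr//.
apply: (@le_trans _ _ (c1^-1 * (u k / kappa) `^ beta * (c1 * (kappa / u k) `^ (2 * alpha + 2 * delta + 1)))); last first.
  rewrite ler_wpM2l ?mulr_ge0 ?powR_ge0//.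
  by rewrite (le_trans sn)// lerDr.
rewrite mulrACA mulVf ?gt_eqF// mul1r.
have -> : u k / kappa = (kappa / u k) `^ (-1).
  by rewrite powR_inv1 ?invf_div// divr_ge0// ltW.
rewrite -powRrM -powRD; last by rewrite (gt_eqF (_ : 0 < kappa / u k)) ?implybT// divr_gt0.
rewrite -[leLHS](@powRr0 _ (kappa / u k)); apply: ler_powR.
  by rewrite ler_pdivlMr// mul1r ltW.
by have := alpha_ge0; have := delta_gt0; lra.
Qed.

End rates.

(** * Posterior mass away from the truth *)

Section posterior_bound.
Context {R : realType} {H1 H2 : hilbertType R}.
Variables (A : {linear H1 -> H2}) (A_cont : continuous A).
Variables (e : nat -> H1) (rho : nat -> R) (g : nat -> H2).
Hypothesis rho_neq0 : forall k, rho k != 0.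
Hypothesis e_norm : forall f : H1,
  \sum_(k < K) inner f (e k) ^+ 2 @[K --> \oo] --> `|f| ^+ 2.
Hypothesis A_norm : forall f : H1,
  \sum_(k < K) (rho k * inner f (e k)) ^+ 2 @[K --> \oo] --> `|A f| ^+ 2.
Variables (Pi : probability (borel H1) R) (tau : nat -> R).
Hypothesis tau_gt0 : forall k, 0 < tau k.
Hypothesis Pi_seq : gauss_seq Pi (fun k (f : borel H1) => inner (f : H1) (e k)) tau.
Variables (n : nat) (n_gt0 : (0 < n)%N) (f0 : H1).

Local Notation lik y f := (expR (log_likelihood A e rho n y f)).

Lemma measurable_inner k :
  measurable_fun [set: borel H1] (fun f : borel H1 => inner (f : H1) (e k)).
Proof. by apply: continuous_borel_measurable; exact: continuous_innerl. Qed.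

Lemma measurable_lik y : measurable_fun [set: borel H1] (fun f : borel H1 => lik y (f : H1)).
Proof.
apply: measurableT_comp => //; apply: measurable_funB.
  apply: measurable_funM => //.
  apply: (@measurable_fun_limn _ _ _
    (fun K (f : borel H1) => series (fun k => rho k * inner (f : H1) (e k) * y k) K)) => K.
  rewrite (_ : (fun f => _) = (fun f : borel H1 => \sum_(k < K) rho k * inner (f : H1) (e k) * y k)); last first.
    by apply/funext => f; rewrite seriesEord.
  apply: measurable_sum => k; apply: measurable_funM => //.
  by apply: measurable_funM => //; exact: measurable_inner.
apply: measurable_funM => //; apply: measurable_funX.
apply: (@continuous_borel_measurable _ H1 (fun f => `|A f|)) => f.
by apply: cvg_norm; exact: A_cont.
Qed.

Lemma measurable_dist : measurable_fun [set: borel H1] (fun f : borel H1 => `|(f : H1) - f0|).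
Proof.
apply: (@continuous_borel_measurable _ H1 (fun f => `|f - f0|)) => f.
by apply: cvg_norm; apply: cvgB; [exact: cvg_id|exact: cvg_cst].
Qed.

Variables (y : nat -> R) (eta M : R).
Hypotheses (eta_gt0 : 0 < eta) (M_gt0 : 0 < M).
Hypothesis yM : forall K, \sum_(k < K) k.+1%:R `^ eta * ((rho k * y k) ^+ 2 * tau k) <= M.

Local Notation N := (n%:R : R).
Let N_gt0 : 0 < N. Proof. by rewrite ltr0n. Qed.
Let x0 k := inner f0 (e k).
Let b_gt0 (c : R) k : 0 <= c -> 0 < N * rho k ^+ 2 + 2 * c.
Proof.
move=> c0; rewrite ltr_wpDr ?mulr_ge0// mulr_gt0//.
by rewrite exprn_even_gt0//= rho_neq0.
Qed.

(** The K-th product is the expectation of the exponential of the K-th partial sum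
    of the exponent.  The partial sums converge for almost every f because of the power
    eta to spare in [yM], and their exponentials are bounded in L^2. *)
Lemma lik_laplace (c : R) : 0 <= c ->
  (\int[Pi]_f (lik y (f : H1) * expR (- (c * `|(f : H1) - f0| ^+ 2)))%:E)%E \is a fin_num /\
  \prod_(k < K) (quad_mean (N * rho k * y k + 2 * c * x0 k) (N * rho k ^+ 2 + 2 * c) (tau k)
      * expR (- (c * x0 k ^+ 2))) @[K --> \oo] -->
  fine (\int[Pi]_f (lik y (f : H1) * expR (- (c * `|(f : H1) - f0| ^+ 2)))%:E)%E.
Proof.
move=> c0.
pose E K (f : H1) := \sum_(k < K) ((N * rho k * y k + 2 * c * x0 k) * inner f (e k)
   - (N * rho k ^+ 2 + 2 * c) * inner f (e k) ^+ 2 / 2 - c * x0 k ^+ 2).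
pose u_ K (f : borel H1) := expR (E K f).
have tau_ge0 k : 0 <= tau k by rewrite ltW.
have EE K f : E K f = N * series (fun k => rho k * inner f (e k) * y k) K
   - N / 2 * (\sum_(k < K) (rho k * inner f (e k)) ^+ 2)
   - c * \sum_(k < K) inner (f - f0) (e k) ^+ 2.
  rewrite seriesEord/= !mulr_sumr -!sumrB; apply: eq_bigr => k _.
  by rewrite innerBl -/(x0 k); field.
have intu K : (\int[Pi]_f (u_ K f)%:E = (\prod_(k < K)
    (quad_mean (N * rho k * y k + 2 * c * x0 k) (N * rho k ^+ 2 + 2 * c) (tau k)
      * expR (- (c * x0 k ^+ 2))))%:E)%E.
  have := gauss_seq_exp tau_ge0 Pi_seq (fun k => N * rho k * y k + 2 * c * x0 k)
    K (fun k => b_gt0 k c0) => G.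
  rewrite big_split/= -expR_sum EFinM -G muleC -ge0_integralZl_EFin ?expR_ge0//; last first.
    apply/measurable_EFinP; apply: measurableT_comp => //; apply: measurable_sum => k.
    have mi := measurable_inner k.
    apply: measurable_funB; first exact: measurable_funM.
    by apply: measurable_funM => //; apply: measurable_funM => //; exact: measurable_funX.
  apply: eq_integral => f _; rewrite -EFinM; congr EFin.
  by rewrite -expRD /u_ /E sumrB sumrN addrC.
have mu_ K : measurable_fun [set: borel H1] (u_ K).
  apply: measurableT_comp => //; apply: measurable_sum => k.
  have mi := measurable_inner k.
  apply: measurable_funB => //; apply: measurable_funB; first exact: measurable_funM.
  by apply: measurable_funM => //; apply: measurable_funM => //; exact: measurable_funX.
pose u (f : borel H1) := lik y (f : H1) * expR (- (c * `|(f : H1) - f0| ^+ 2)).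
have mu : measurable_fun [set: borel H1] u.
  apply: measurable_funM; first exact: measurable_lik.
  apply: measurableT_comp => //; apply: measurableT_comp => //; apply: measurable_funM => //.
  by apply: measurable_funX; exact: measurable_dist.
have u2 K : (\int[Pi]_f (u_ K f ^+ 2)%:E <= (expR (2 * N ^+ 2 * M))%:E)%E.
  (* The square doubles the exponent of the likelihood, and the factor in c is at
   most 1. *)
  pose a k := 2 * (N * rho k * y k); pose b k := 2 * (N * rho k ^+ 2).
  have b0 k : 0 < b k.
    by rewrite mulr_gt0//; have := @b_gt0 0 k (lexx _); rewrite mulr0 addr0.
  have G := gauss_seq_exp tau_ge0 Pi_seq a K b0.
  apply: (@le_trans _ _ (\prod_(k < K) quad_mean (a k) (b k) (tau k))%:E).
    rewrite -G; apply: ge0_le_integral => //=.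
    - by move=> f _; rewrite lee_fin sqr_ge0.
    - by apply/measurable_EFinP; exact: measurable_funX.
    - apply/measurable_EFinP; apply: measurableT_comp => //; apply: measurable_sum => k.
      have mi := measurable_inner k.
      apply: measurable_funB; first exact: measurable_funM.
      by apply: measurable_funM => //; apply: measurable_funM => //; exact: measurable_funX.
    move=> f _; rewrite lee_fin /u_ -expRM_natl ler_expR /E mulr_sumr.
    apply: ler_sum => k _; rewrite /a /b -subr_ge0.
    rewrite (_ : _ - _ = 2 * (c * (inner (f : H1) (e k) - x0 k) ^+ 2)); last by field.
    by rewrite mulr_ge0// mulr_ge0// sqr_ge0.
  rewrite lee_fin.
  apply: (@le_trans _ _ (\prod_(k < K) expR (2 * N ^+ 2 * ((rho k * y k) ^+ 2 * tau k)))).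
    apply: ler_prod => k _; rewrite ltW ?quad_mean_gt0//=.
    rewrite /quad_mean -[leRHS]mul1r; apply: ler_pM; rewrite ?expR_ge0 ?invr_ge0 ?sqrtr_ge0//.
      have h1 : 1 <= 1 + b k * tau k by rewrite lerDl mulr_ge0// ltW.
      have h2 : 1 <= Num.sqrt (1 + b k * tau k) by rewrite -[leLHS]sqrtr1 ler_wsqrtr.
      by rewrite invf_le1// (lt_le_trans ltr01 h2).
    rewrite ler_expR ler_pdivrMr; last first.
      by rewrite mulr_gt0// ltr_pwDl// mulr_ge0// ltW.
    rewrite /a (_ : (2 * (N * rho k * y k)) ^+ 2 * tau k = 2 * N ^+ 2 * ((rho k * y k) ^+ 2 * tau k) * 2); last by ring.
    rewrite ler_wpM2l//.
      by rewrite mulr_ge0// mulr_ge0// ?sqr_ge0// mulr_ge0// sqr_ge0.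
    by rewrite mulrDr mulr1 lerDl mulr_ge0// mulr_ge0// ltW.
  rewrite -expR_sum ler_expR -mulr_sumr ler_wpM2l ?mulr_ge0 ?sqr_ge0//.
  apply: le_trans (yM K); apply: ler_sum => k _.
  have k1 : 1 <= k.+1%:R `^ eta :> R.
    have := @ler_powR R k.+1%:R _ 0 eta (ltW eta_gt0).
    by rewrite powRr0 ler1n => /(_ isT).
  by rewrite ler_peMl// mulr_ge0// sqr_ge0.
have cu : {ae Pi, forall f, u_ K f @[K --> \oo] --> u f}.
  have := @gauss_seq_series_cvg _ _ _ Pi _ tau tau_ge0 Pi_seq (fun k => rho k * y k) eta M
    eta_gt0 M_gt0 yM.
  apply: filterS => f cf.
  rewrite /u_ /u -expRD /log_likelihood.
  apply: (@cvg_comp _ _ _ (E ^~ f) expR); last exact: continuous_expR.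
  rewrite (_ : E ^~ f = (fun K => N * series (fun k => rho k * inner (f : H1) (e k) * y k) K
   - N / 2 * (\sum_(k < K) (rho k * inner (f : H1) (e k)) ^+ 2)
   - c * \sum_(k < K) inner ((f : H1) - f0) (e k) ^+ 2)); last by apply/funext => K; rewrite EE.
  apply: cvgB; last by apply: cvgM; [exact: cvg_cst|exact: e_norm].
  apply: cvgB; last by apply: cvgM; [exact: cvg_cst|exact: A_norm].
  apply: cvgM; first exact: cvg_cst.
  rewrite (_ : (fun k => rho k * inner (f : H1) (e k) * y k) = (fun k => rho k * y k * inner (f : H1) (e k))) //.
  by apply/funext => k; rewrite mulrAC.
have [fu cvgu] := cvg_integral_sqr_bounded mu_ mu (fun K f => expR_ge0 _)
  (fun f => mulr_ge0 (expR_ge0 _) (expR_ge0 _)) u2 cu.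
split => //; move: cvgu; rewrite (_ : (fun K => fine _) = (fun K => \prod_(k < K)
    (quad_mean (N * rho k * y k + 2 * c * x0 k) (N * rho k ^+ 2 + 2 * c) (tau k)
      * expR (- (c * x0 k ^+ 2)))))//.
by apply/funext => K; rewrite intu.
Qed.

Let B k : R := N * rho k ^+ 2.
Let s k := tau k / (1 + B k * tau k).
Let mu k := N * rho k * y k * s k - x0 k.

(** The posterior mean and second moment of exp (- lambda |f - f0|^2) are
    limits of explicit products, whose ratios are controlled by the posterior
    variances s and by the errors mu of the posterior means. *)
Lemma posterior_mass_le (Y : H2 -> R) (G lambda S T Q r : R) :
  separable H1 -> y = (fun k => Y (g k)) ->
  (forall K, \sum_(k < K) rho k ^+ 2 * tau k <= G) ->
  0 < lambda ->
  (forall K, \sum_(k < K) s k <= S) ->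
  (forall K, \sum_(k < K) mu k ^+ 2 <= T) ->
  (forall K, \sum_(k < K) (2 * (lambda * s k) ^+ 2 +
     4 * (lambda * s k) * (lambda * mu k ^+ 2)) <= Q) ->
  0 <= r -> expR (- (lambda * r ^+ 2)) <= expR (- (lambda * S + lambda * T)) / 2 ->
  0 <= posterior A e g rho Pi n Y [set f : H1 | `|f - f0| > r] <=
    4 * (expR Q - 1).
Proof.
move=> sH1 yE rG l0 sS muT sQ r0 hr.
have tau_ge0 k : 0 <= tau k by rewrite ltW.
have B0 k : 0 < B k by have := @b_gt0 0 k (lexx _); rewrite mulr0 addr0.
have T0 k : 0 < 1 + B k * tau k by rewrite ltr_pwDl// mulr_ge0// ltW.
have s0 k : 0 <= s k by rewrite divr_ge0// ltW.
pose q K := \prod_(k < K) quad_mean (N * rho k * y k) (B k) (tau k).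
pose rr c K := \prod_(k < K) sqr_laplace c (s k) (mu k).
have prodE (c : R) K : 0 <= c ->
    \prod_(k < K) (quad_mean (N * rho k * y k + 2 * c * x0 k) (N * rho k ^+ 2 + 2 * c) (tau k)
      * expR (- (c * x0 k ^+ 2))) = q K * rr c K.
  move=> c0; rewrite /q /rr -big_split/=; apply: eq_bigr => k _.
  exact: (quad_mean_tilt _ _ (B0 k) c0 (tau_ge0 k)).
pose J (c : R) := (\int[Pi]_f (lik y (f : H1) * expR (- (c * `|(f : H1) - f0| ^+ 2)))%:E)%E.
have Jfin c : 0 <= c -> J c \is a fin_num by move=> c0; have [] := lik_laplace c0.
have Jcvg c : 0 <= c -> q K * rr c K @[K --> \oo] --> fine (J c).
  move=> c0; have [_] := lik_laplace c0.
  by under eq_fun do rewrite prodE//.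
have q0 K : 0 < q K by apply: prodr_gt0 => k _; exact: quad_mean_gt0.
have rr0 c K : 0 <= c -> 0 < rr c K.
  by move=> c0; apply: prodr_gt0 => k _; exact: sqr_laplace_gt0.
pose D := fine (J 0); pose N1 := fine (J lambda); pose N2 := fine (J (2 * lambda)).
have rr00 K : rr 0 K = 1.
  rewrite /rr big1// => k _; rewrite /sqr_laplace mulr0 !mul0r addr0 sqrtr1 invr1.
  by rewrite oppr0 expR0 mulr1.
have qD : q K @[K --> \oo] --> D.
  by have := Jcvg 0 (lexx _); under eq_fun do rewrite rr00 mulr1.
have l00 := ltW l0.
have l20 : 0 <= 2 * lambda by rewrite mulr_ge0.
have D0 : 0 < D.
  apply: (@lt_le_trans _ _ (expR (- (N * G / 2)))); first exact: expR_gt0.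
  apply: (ler_cvg_to (cvg_cst _) qD); apply: nearW => K.
  apply: (@le_trans _ _ (\prod_(k < K) expR (- (B k * tau k / 2)))).
    rewrite -expR_sum ler_expR sumrN lerN2 -mulr_suml ler_wpM2r//.
    have -> : \sum_(k < K) B k * tau k = N * \sum_(k < K) rho k ^+ 2 * tau k.
      by rewrite mulr_sumr; apply: eq_bigr => k _; rewrite /B mulrA.
    by rewrite ler_wpM2l.
  apply: ler_prod => k _; rewrite expR_ge0/= /quad_mean.
  rewrite -[leLHS]mulr1; apply: ler_pM; rewrite ?expR_ge0//.
    have Bt : 0 <= B k * tau k / 2 by rewrite divr_ge0// mulr_ge0// ltW.
    have := sqrt_inv_expR Bt.
    by rewrite (_ : 2 * (B k * tau k / 2) = B k * tau k) //; field.
  rewrite -[leLHS]expR0 ler_expR divr_ge0// mulr_ge0 ?sqr_ge0//.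
  by rewrite ltW.
have N1D : D * expR (- (lambda * S + lambda * T)) <= N1.
  apply: (ler_cvg_to (cvgM qD (cvg_cst _)) (Jcvg lambda l00)); apply: nearW => K.
  rewrite ler_wpM2l ?(ltW (q0 K))//.
  apply: (@le_trans _ _ (\prod_(k < K) expR (- (lambda * s k + lambda * mu k ^+ 2)))).
    rewrite -expR_sum ler_expR sumrN lerN2 big_split/= -!mulr_sumr.
    by apply: lerD; apply: ler_wpM2l => //; [exact: sS|exact: muT].
  by apply: ler_prod => k _; rewrite expR_ge0/= sqr_laplace_ge.
have N10 : 0 < N1 by apply: lt_le_trans N1D; rewrite mulr_gt0// expR_gt0.
have N2N1 : N2 * D <= N1 ^+ 2 * expR Q.
  have cN1 := Jcvg lambda l00.
  apply: (ler_cvg_to (cvgM (Jcvg (2 * lambda) l20) qD) (cvgM (cvgM cN1 cN1) (cvg_cst (expR Q)))).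
  apply: nearW => K /=.
  rewrite (_ : q K * rr (2 * lambda) K * q K = q K ^+ 2 * rr (2 * lambda) K); last by ring.
  rewrite (_ : q K * rr lambda K * (q K * rr lambda K) * expR Q =
    q K ^+ 2 * (rr lambda K ^+ 2 * expR Q)); last by ring.
  rewrite ler_wpM2l ?sqr_ge0//.
  apply: (@le_trans _ _ (rr lambda K ^+ 2 * expR (\sum_(k < K) (2 * (lambda * s k) ^+ 2 +
     4 * (lambda * s k) * (lambda * mu k ^+ 2))))); last first.
    by rewrite ler_wpM2l ?sqr_ge0// ler_expR.
  rewrite expR_sum -prodrXl -big_split/=.
  apply: ler_prod => k _; rewrite (ltW (sqr_laplace_gt0 _ _ _))//=.
  exact: sqr_laplace_double.
pose Bs : set (borel H1) := [set f : H1 | `|f - f0| > r].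
have mBs : measurable Bs.
  rewrite (_ : Bs = (fun f : borel H1 => `|(f : H1) - f0|) @^-1` `]r, +oo[%classic).
    by rewrite -[X in measurable X]setTI; exact: measurable_dist.
  by apply/seteqP; split => f; rewrite /= in_itv/= andbT.
pose V (f : borel H1) := expR (- (lambda * `|(f : H1) - f0| ^+ 2)).
have mL := measurable_lik y.
have mV : measurable_fun [set: borel H1] V.
  apply: measurableT_comp => //; apply: measurableT_comp => //; apply: measurable_funM => //.
  by apply: measurable_funX; exact: measurable_dist.
have LD : (\int[Pi]_f (lik y (f : H1))%:E = D%:E)%E.
  rewrite /D fineK ?Jfin//; apply: eq_integral => f _.
  by rewrite mul0r oppr0 expR0 mulr1.
have mass : (\int[Pi]_(f in Bs) (lik y (f : H1))%:E <= (4 * (N2 * D / N1 ^+ 2 - 1) * D)%:E)%E.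
  apply: (@laplace_chebyshev _ _ _ Pi (fun f : borel H1 => lik y (f : H1)) V D N1 N2 _
    mL mV mBs _ _ LD).
  - by move=> f; exact: expR_ge0.
  - move=> f; rewrite expR_ge0/= -[leRHS]expR0 ler_expR oppr_le0.
    by rewrite mulr_ge0// sqr_ge0.
  - by rewrite /N1 fineK ?Jfin.
  - rewrite /N2 fineK ?Jfin//; apply: eq_integral => f _.
    by rewrite /V -expRM_natl; congr (_ * expR _)%:E; ring.
  - exact: D0.
  - exact: N10.
  move=> f rf; apply: (@le_trans _ _ (expR (- (lambda * r ^+ 2)))).
    by rewrite ler_expR lerN2 ler_wpM2l// lerXn2r ?nnegrE// ltW.
  apply: (le_trans hr); rewrite ler_wpM2r//.
  by rewrite (ler_pdivlMr _ _ D0) mulrC.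
have mass0 : (0 <= \int[Pi]_(f in Bs) (lik y (f : H1))%:E)%E.
  by apply: integral_ge0 => f _; rewrite lee_fin expR_ge0.
have fm : (\int[Pi]_(f in Bs) (lik y (f : H1))%:E)%E \is a fin_num.
  by rewrite ge0_fin_numE// (le_lt_trans mass)// ltry.
have -> : posterior A e g rho Pi n Y [set f : H1 | `|f - f0| > r] =
    fine (\int[Pi]_(f in Bs) (lik y (f : H1))%:E)%E / D.
  rewrite /posterior -yE; congr (_ / _).
  rewrite /Rintegral (@ge0_integral_support _ H1 Pi (fun f => lik y (f : H1)))//.
  by rewrite LD.
apply/andP; split; first exact: divr_ge0 (fine_ge0 mass0) (ltW D0).
rewrite (ler_pdivrMr _ _ D0).
apply: (@le_trans _ _ (4 * (N2 * D / N1 ^+ 2 - 1) * D)).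
  by rewrite -lee_fin fineK.
rewrite ler_wpM2r ?(ltW D0)// ler_wpM2l// lerD2r ler_pdivrMr ?exprn_gt0//.
by rewrite [leRHS]mulrC.
Qed.

End posterior_bound.

Section posterior_measurability.
Context {R : realType} {H1 H2 : hilbertType R}.
Variables (A : {linear H1 -> H2}) (A_cont : continuous A).
Variables (e : nat -> H1) (rho : nat -> R) (g : nat -> H2).
Variables (Pi : probability (borel H1) R) (n : nat).
Context d (Om : measurableType d) (Y : Om -> H2 -> R).
Hypothesis mY : forall k, measurable_fun [set: Om] (fun w => Y w (g k)).

(** Tonelli's theorem for the joint likelihood; the quotient is written with the
    power - 1, which is measurable and equals the inverse on nonnegative reals. *)
Lemma measurable_posterior (B : set (borel H1)) : measurable B ->
  measurable_fun [set: Om] (fun w => posterior A e g rho Pi n (Y w) B).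
Proof.
move=> mB.
pose lik (z : Om * borel H1) :=
  expR (log_likelihood A e rho n (fun k => Y z.1 (g k)) (z.2 : H1)).
have mH (f : H1 -> R) : continuous f ->
    measurable_fun [set: Om * borel H1] (fun z => f (z.2 : H1)).
  move=> cf; apply: (@measurableT_comp _ _ _ _ _ _ (f : borel H1 -> R)) => //.
  exact: continuous_borel_measurable.
have mlik : measurable_fun [set: Om * borel H1] lik.
  apply: measurableT_comp => //; apply: measurable_funB.
    apply: measurable_funM => //.
    apply: (@measurable_fun_limn _ _ _ (fun K (z : Om * borel H1) =>
      series (fun k => rho k * inner (z.2 : H1) (e k) * Y z.1 (g k)) K)) => K.
    rewrite (_ : (fun z => _) = (fun z : Om * borel H1 =>
      \sum_(k < K) rho k * inner (z.2 : H1) (e k) * Y z.1 (g k))); last first.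
      by apply/funext => f; rewrite seriesEord.
    apply: measurable_sum => k; apply: measurable_funM.
      apply: measurable_funM => //; apply: (mH (fun f => inner f (e k))).
      exact: continuous_innerl.
    by apply: (measurableT_comp (mY k)).
  apply: measurable_funM => //; apply: measurable_funX.
  apply: (mH (fun f => `|A f|)) => f.
  by apply: cvg_norm; exact: A_cont.
have mint (D : set (borel H1)) : measurable D ->
    measurable_fun [set: Om] (fun w => \int[Pi]_(f in D) lik (w, f)).
  move=> mD; apply: measurableT_comp; first exact: fine_measurable.
  rewrite (_ : (fun w => _) = (fun w => \int[Pi]_f (lik (w, f) * \1_D f)%:E)%E); last first.
    apply/funext => w; rewrite integral_mkcond; apply: eq_integral => f _.
    by rewrite patchE indicE; case: ifPn => _ /=; rewrite ?mulr1 ?mulr0.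
  apply: (@measurable_fun_fubini_tonelli_F _ _ _ _ _ Pi
    (fun z => (lik z * \1_D z.2)%:E)) => [|z].
    apply/measurable_EFinP; apply: measurable_funM => //.
    have m1 : measurable_fun [set: borel H1] (\1_D : borel H1 -> R) by exact: measurable_indic.
    by apply: (measurableT_comp m1).
  by rewrite lee_fin mulr_ge0 ?expR_ge0.
rewrite (_ : (fun w => _) = (fun w => (\int[Pi]_(f in B) lik (w, f)) *
    (\int[Pi]_(f in measure_support Pi) lik (w, f)) `^ (-1))).
  apply: measurable_funM; first exact: mint.
  apply: (measurableT_comp (measurable_powR _)).
  by apply: mint; exact: measurable_support.
apply/funext => w; rewrite /posterior powR_inv1//.
by apply: Rintegral_ge0 => f _; exact: expR_ge0.
Qed.

End posterior_measurability.

(** * Uniform bounds on the spectrum and on the noise *)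

Section sequences_of_reals.
Context {R : realType}.

Lemma near_pos_lower_bound (x : nat -> R) (c : R) : (forall k, 0 < x k) -> 0 < c ->
  (\forall k \near \oo, c <= x k) -> exists2 c1, 0 < c1 & forall k, c1 <= x k.
Proof.
move=> x0 c0 [N _ hN].
have [b b0 hb] : exists2 b, 0 < b & forall k, (k < N)%N -> b <= x k.
  elim: N {hN} => [|N [b b0 hb]]; first by exists 1.
  exists (Num.min b (x N)); first by rewrite lt_min b0 x0.
  move=> k; rewrite ltnS leq_eqVlt => /orP[/eqP ->|kN]; first by rewrite ge_min lexx orbT.
  by rewrite ge_min hb.
exists (Num.min b c); first by rewrite lt_min b0 c0.
move=> k; have [kN|Nk] := ltnP k N; first by rewrite ge_min hb.
by rewrite ge_min (hN k Nk) orbT.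
Qed.

Lemma near_upper_bound (x : nat -> R) (c : R) :
  (\forall k \near \oo, x k <= c) -> exists2 c1, 0 < c1 & forall k, x k <= c1.
Proof.
move=> [N _ hN].
have [b hb] : exists b, forall k, (k < N)%N -> x k <= b.
  elim: N {hN} => [|N [b hb]]; first by exists 1.
  exists (Num.max b (x N)) => k.
  rewrite ltnS leq_eqVlt => /orP[/eqP ->|kN]; first by rewrite le_max lexx orbT.
  by rewrite le_max hb.
exists (Num.max 1 (Num.max b c)); first by rewrite lt_max ltr01.
move=> k; have [kN|Nk] := ltnP k N; first by rewrite !le_max hb ?orbT.
by rewrite !le_max (hN k Nk) !orbT.
Qed.

Lemma sum_natpow_le (p : R) K : 0 < p ->
  \sum_(k < K) k.+1%:R `^ (- (p + 1)) <= 2 `^ (p + 1) / p :> R.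
Proof.
move=> p0; have q0 : 0 <= p + 1 by rewrite addr_ge0// ltW.
apply: (@le_trans _ _ (\sum_(k < K) 2 `^ (p + 1) * (1 + k.+1%:R) `^ (- (p + 1)))).
  apply: ler_sum => k _.
  have k1 : 0 < k.+1%:R :> R by rewrite ltr0n.
  rewrite !powRN ler_pdivlMr ?powR_gt0 ?ltr_wpDl// mulrC ler_pdivrMr ?powR_gt0//.
  have k2 : 1 + k.+1%:R <= 2 * k.+1%:R :> R by rewrite mulr2n mulrDl mul1r lerD2r ler1n.
  rewrite -powRM ?addr_ge0//. apply: ge0_ler_powR; rewrite ?nnegrE ?mulr_ge0 ?addr_ge0//; exact: ltW.
rewrite -mulr_sumr ler_wpM2l ?powR_ge0//.
by apply: (le_trans (sum_powR_le K p0 ltr01)); rewrite powR1 mul1r.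
Qed.

End sequences_of_reals.

Section gauss_seq_sup.
Context {R : realType} d (Om : measurableType d) (P : probability Om R).
Variables (X : nat -> Om -> R) (v : nat -> R).
Hypotheses (v_ge0 : forall i, 0 <= v i) (gX : gauss_seq P X v).

Lemma measurable_sqr_sum_tail (u : nat -> R) (t : R) K :
  measurable [set w | (t < \sum_(k < K) u k * X k w ^+ 2)%R].
Proof.
rewrite (_ : [set w | _] = (fun w => \sum_(k < K) u k * X k w ^+ 2) @^-1` `]t, +oo[%classic).
  rewrite -[X in measurable X]setTI; have : measurable_fun [set: Om] (fun w => \sum_(k < K) u k * X k w ^+ 2).
    apply: measurable_sum => k; apply: measurable_funM => //.
    by apply: measurable_funX; exact: gauss_seq_measurable gX k.
  by apply.
by apply/seteqP; split => w; rewrite /= in_itv/= andbT.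
Qed.

(** The events increase with K, so the bound for each K passes to the union. *)
Lemma gauss_seq_sqr_tail_sup (u : nat -> R) (lambda t Sx Q : R) :
  (forall k, 0 < u k) -> (forall k, v k = 1) -> 0 < lambda ->
  (forall K, \sum_(k < K) u k <= Sx) ->
  (forall K, \sum_(k < K) (lambda * u k) ^+ 2 <= Q) ->
  expR (- (lambda * t)) <= expR (- (lambda * Sx)) / 2 ->
  (P (\bigcup_K [set w | (t < \sum_(k < K) u k * X k w ^+ 2)%R]) <=
    (4 * (expR (2 * Q) - 1))%:E)%E.
Proof.
move=> u0 v1 l0 uS uQ ht.
pose F K := [set w | (t < \sum_(k < K) u k * X k w ^+ 2)%R].
have mF K : measurable (F K) by exact: measurable_sqr_sum_tail.
have cF := @nondecreasing_cvg_mu _ _ _ P F mF (bigcupT_measurable _ mF) _.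
have /cF : nondecreasing_seq F.
  apply/nondecreasing_seqP => K; apply/subsetPset => w /= tw.
  by rewrite /F/= big_ord_recr/= (lt_le_trans tw)// lerDl mulr_ge0 ?sqr_ge0// ltW.
move=> {}cF; rewrite -(cvg_lim _ cF)//; apply: lime_le; first by apply/cvg_ex; eexists; exact: cF.
by apply: nearW => K; exact: (gauss_seq_sqr_tail v_ge0 gX u0 v1 l0 (uS K) (uQ K) ht).
Qed.

End gauss_seq_sup.

(** * Contraction at a fixed sample size *)

Section posterior_rates.
Context {R : realType}.
Variables (alpha delta gamma c1 Mr F : R) (rho x0 : nat -> R).
Hypotheses (alpha_ge0 : 0 <= alpha) (delta_gt0 : 0 < delta) (gamma_gt0 : 0 < gamma).
Hypotheses (c1_gt0 : 0 < c1) (rho_ge : forall k, c1 * weight k `^ (- alpha) <= rho k ^+ 2).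
Hypotheses (Mr_gt0 : 0 < Mr) (rho_le : forall k, rho k ^+ 2 <= Mr).
Hypotheses (F_gt0 : 0 < F) (x0_le : forall K, \sum_(k < K) x0 k ^+ 2 * weight k `^ gamma <= F).

Lemma sobolev_coord_le k : x0 k ^+ 2 <= F.
Proof.
apply: le_trans (x0_le k.+1); rewrite big_ord_recr/= ler_wpDl//.
  by apply: sumr_ge0 => i _; rewrite mulr_ge0 ?sqr_ge0 ?powR_ge0.
rewrite ler_peMr ?sqr_ge0// -[leLHS](powRr0 (weight k)).
by apply: ler_powR; [exact: weight_ge1|exact: ltW].
Qed.

Lemma sum_signal_le K :
  \sum_(k < K) rho k ^+ 2 * prior_var delta k <= Mr * (2 `^ (2 * delta + 1) / (2 * delta)).
Proof.
have d2 : 0 < 2 * delta by rewrite mulr_gt0.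
apply: (@le_trans _ _ (\sum_(k < K) Mr * k.+1%:R `^ (- (2 * delta + 1)))).
  apply: ler_sum => k _; apply: ler_pM; rewrite ?sqr_ge0 ?rho_le//.
    by rewrite ltW// prior_var_gt0.
  exact: prior_var_le.
by rewrite -mulr_sumr; apply: ler_wpM2l; [exact: ltW|exact: sum_natpow_le].
Qed.

Section fixed_noise.
Variables (kappa : R) (z : nat -> R).
Hypothesis kappa_ge1 : 1 <= kappa.
Let N := kappa `^ (2 * alpha + 2 * delta + 1).
Let beta := Num.min delta gamma.
Let s := post_var delta rho N.
Let y k := rho k * x0 k + N `^ (- 2^-1) * z k.
Let mu k := N * rho k * y k * s k - x0 k.

Let N_ge1 : 1 <= N.
Proof.
rewrite /N -[leLHS](powRr0 kappa); apply: ler_powR => //.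
by rewrite !addr_ge0 ?mulr_ge0// ltW.
Qed.

Let kappa_gt0 : 0 < kappa. Proof. exact: lt_le_trans kappa_ge1. Qed.

Let s_gt0 k : 0 < s k. Proof. exact: post_var_gt0. Qed.

Let root_N2 : N * (N `^ (- 2^-1)) ^+ 2 = 1.
Proof.
have N0 : 0 < N := lt_le_trans ltr01 N_ge1.
have h0 : 1 + - 2^-1 * 2 = 0 :> R by field.
rewrite -powR_mulrn ?powR_ge0// -powRrM -[X in X * _](powRr1 (ltW N0)) -powRD.
  by rewrite h0 powRr0.
by rewrite (gt_eqF N0) implybT.
Qed.

Let beta_ge0 : 0 <= beta. Proof. by rewrite le_min !ltW. Qed.

(** The error mu of the posterior mean splits into the bias, the coordinate of f0
    times the shrinkage factor, and a noise term N^(1/2) rho s z, whose square is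
    s z^2 times N rho^2 tau / (1 + N rho^2 tau) <= 1. *)
Lemma sqr_centre_le k : mu k ^+ 2 <=
  2 * (1 + c1^-1) ^+ 2 * kappa `^ (- (2 * beta)) * (x0 k ^+ 2 * weight k `^ gamma)
  + 2 * (s k * z k ^+ 2).
Proof.
have t0 : 0 < prior_var delta k := prior_var_gt0 delta k.
set B := N * rho k ^+ 2.
have B0 : 0 <= B by rewrite mulr_ge0 ?sqr_ge0// (le_trans ler01).
have D0 : 0 < 1 + B * prior_var delta k by rewrite ltr_wpDr// mulr_ge0// ltW.
have sE : s k = prior_var delta k / (1 + B * prior_var delta k) by [].
set b := 1 / (1 + B * prior_var delta k).
have -> : mu k = - (b * x0 k) + N * rho k * N `^ (- 2^-1) * s k * z k.
  rewrite /mu /y sE /b /B; field; exact: lt0r_neq0.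
set q := N * rho k * _ * s k.
have q2 : q ^+ 2 <= s k.
  have -> : q ^+ 2 = B * s k * s k.
    rewrite /q /B; transitivity (N * (N * (N `^ (- 2^-1)) ^+ 2) * rho k ^+ 2 * s k * s k).
      by ring.
    by rewrite root_N2 mulr1.
  rewrite ler_piMl ?(ltW (s_gt0 k))// sE mulrA ler_pdivrMr// mul1r.
  by rewrite lerDr.
have bk : b ^+ 2 <= (1 + c1^-1) ^+ 2 * kappa `^ (- (2 * beta)) * weight k `^ gamma.
  apply: (shrinkage_le alpha_ge0 delta_gt0 c1_gt0 rho_ge kappa_ge1) => //.
    by rewrite ge_min lexx.
  by rewrite ge_min lexx orbT.
apply: (@le_trans _ _ (2 * (b ^+ 2 * x0 k ^+ 2) + 2 * (q ^+ 2 * z k ^+ 2))).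
  rewrite -subr_ge0 (_ : _ - _ = (b * x0 k + q * z k) ^+ 2) ?sqr_ge0//; ring.
apply: lerD; rewrite ?ler_pM2l//; last by apply: ler_wpM2r; rewrite ?sqr_ge0.
have := ler_wpM2r (sqr_ge0 (x0 k)) bk.
move=> h; rewrite -(ler_pM2l (ltr0n R 2)) in h; apply: (le_trans h).
by rewrite le_eqVlt; apply/orP; left; apply/eqP; ring.
Qed.

Lemma sum_sqr_centre_le t K :
  (forall K, \sum_(k < K) s k * z k ^+ 2 <= t * kappa `^ (- (2 * beta))) ->
  \sum_(k < K) mu k ^+ 2 <= (2 * (1 + c1^-1) ^+ 2 * F + 2 * t) * kappa `^ (- (2 * beta)).
Proof.
move=> ht; apply: le_trans; first by apply: ler_sum => k _; exact: sqr_centre_le.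
rewrite big_split/= -!mulr_sumr [leRHS]mulrDl; apply: lerD; last first.
  by rewrite -[leRHS]mulrA ler_pM2l//; exact: ht.
rewrite [leRHS]mulrAC; apply: ler_wpM2l; last exact: x0_le.
by rewrite !mulr_ge0 ?powR_ge0 ?sqr_ge0// addr_ge0 ?invr_ge0 // ltW.
Qed.

Lemma sum_spread_le K :
  \sum_(k < K) s k <= rate_const delta c1 / (2 * delta) * kappa `^ (- (2 * beta)).
Proof.
apply: (le_trans (sum_post_var_le alpha_ge0 delta_gt0 c1_gt0 rho_ge kappa_ge1 K)).
apply: ler_wpM2l; first by rewrite ltW// divr_gt0 ?rate_const_gt0// mulr_gt0.
by apply: ler_powR => //; rewrite lerN2 ler_pM2l// ge_min lexx.
Qed.

(** This bound tends to 0 with 1 / kappa, and it is the only source of smallness in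
    the Chebyshev bounds. *)
Lemma scaled_spread_le k : kappa `^ (2 * beta) * s k <= rate_const delta c1 / kappa.
Proof.
have h := post_var_le_max alpha_ge0 delta_gt0 c1_gt0 rho_ge kappa_ge1 k.
apply: (le_trans (ler_wpM2l (powR_ge0 _ _) h)).
rewrite mulrCA; apply: ler_wpM2l; first by rewrite ltW// rate_const_gt0.
rewrite -powRD ?(gt_eqF kappa_gt0) ?implybT// -(powR_inv1 (ltW kappa_gt0)).
apply: ler_powR => //.
by have : beta <= delta; [rewrite ge_min lexx|lra].
Qed.

Lemma sum_laplace_exponent_le S T lambda K : lambda = kappa `^ (2 * beta) ->
  (forall K, \sum_(k < K) s k <= S / lambda) ->
  (forall K, \sum_(k < K) mu k ^+ 2 <= T / lambda) ->
  \sum_(k < K) (2 * (lambda * s k) ^+ 2 + 4 * (lambda * s k) * (lambda * mu k ^+ 2)) <=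
  rate_const delta c1 / kappa * (2 * S + 4 * T).
Proof.
move=> lE hS hT; set m := _ / kappa.
have l0 : 0 < lambda by rewrite lE powR_gt0.
have m0 : 0 <= m by rewrite ltW// divr_gt0 ?rate_const_gt0.
apply: (@le_trans _ _ (\sum_(k < K) (m * (2 * lambda * s k) + m * (4 * lambda * mu k ^+ 2)))).
  apply: ler_sum => k _; have hk := scaled_spread_le k; rewrite -lE -/m in hk.
  rewrite expr2; set a := lambda * s k; have a0 : 0 <= a by rewrite mulr_ge0// ltW.
  have h1 : a * a <= m * a by apply: ler_wpM2r.
  have h2 : a * (lambda * mu k ^+ 2) <= m * (lambda * mu k ^+ 2).
    by apply: ler_wpM2r => //; rewrite mulr_ge0 ?sqr_ge0// ltW.
  move: h1 h2; rewrite (_ : m * (2 * lambda * s k) = 2 * (m * a)); last by rewrite /a; ring.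
  rewrite (_ : m * (4 * lambda * _) = 4 * (m * (lambda * mu k ^+ 2))); last by ring.
  by rewrite -[4 * a * _]mulrA; move: (a * a) (a * (lambda * _)) (m * a) (m * (lambda * _)) => ? ? ? ?; lra.
rewrite big_split/= -!mulr_sumr mulrDr; apply: lerD; apply: ler_wpM2l => //.
  rewrite -mulrA ler_pM2l// -ler_pdivlMl// mulrC; exact: hS.
rewrite -mulrA ler_pM2l// -ler_pdivlMl// mulrC; exact: hT.
Qed.

(** The prior variance is of order k^(-2 delta - 1), so the weight k^delta leaves
    the summable weight k^(-delta - 1) on the squared data. *)
Lemma sum_data_le (M : R) K :
  (forall K, \sum_(k < K) k.+1%:R `^ (- (delta + 1)) * z k ^+ 2 <= M) ->
  \sum_(k < K) k.+1%:R `^ delta * ((rho k * y k) ^+ 2 * prior_var delta k) <=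
  Mr * (2 * Mr * F) * (2 `^ (delta + 1) / delta) + Mr * 2 * M.
Proof.
move=> hM.
apply: (@le_trans _ _ (\sum_(k < K) (Mr * (2 * Mr * F) * k.+1%:R `^ (- (delta + 1)) +
  Mr * 2 * (k.+1%:R `^ (- (delta + 1)) * z k ^+ 2)))).
  apply: ler_sum => k _.
  have y2 : y k ^+ 2 <= 2 * Mr * F + 2 * z k ^+ 2.
    apply: (@le_trans _ _ (2 * (rho k ^+ 2 * x0 k ^+ 2) + 2 * ((N `^ (- 2^-1)) ^+ 2 * z k ^+ 2))).
      rewrite -subr_ge0 (_ : _ - _ = (rho k * x0 k - N `^ (- 2^-1) * z k) ^+ 2) ?sqr_ge0//.
      by rewrite /y; ring.
    apply: lerD; last first.
      rewrite ler_pM2l//; apply: ler_piMl; first exact: sqr_ge0.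
      by rewrite -[leRHS]root_N2; apply: ler_peMl => //; exact: sqr_ge0.
    rewrite -mulrA ler_pM2l//; apply: ler_pM; rewrite ?sqr_ge0 ?rho_le//.
    exact: sobolev_coord_le.
  have hp : k.+1%:R `^ delta * prior_var delta k <= k.+1%:R `^ (- (delta + 1)).
    apply: (le_trans (ler_wpM2l (powR_ge0 _ _) (prior_var_le delta_gt0 k))).
    rewrite -powRD ?pnatr_eq0 ?implybT// le_eqVlt; apply/orP; left; apply/eqP.
    by congr (_ `^ _); ring.
  have yy : (rho k * y k) ^+ 2 <= Mr * (2 * Mr * F + 2 * z k ^+ 2).
    by rewrite exprMn; apply: ler_pM; rewrite ?sqr_ge0.
  rewrite mulrCA; apply: (@le_trans _ _ ((Mr * (2 * Mr * F + 2 * z k ^+ 2)) *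
      k.+1%:R `^ (- (delta + 1)))).
    apply: ler_pM => //; rewrite ?sqr_ge0// mulr_ge0 ?powR_ge0//.
  by rewrite le_eqVlt; apply/orP; left; apply/eqP; ring.
rewrite big_split/= -!mulr_sumr; apply: lerD; apply: ler_wpM2l => //.
- by rewrite !mulr_ge0// ltW.
- exact: sum_natpow_le.
- by rewrite mulr_ge0// ltW.
- exact: hM.
Qed.

End fixed_noise.
End posterior_rates.

Section contraction.
Context {R : realType} {H1 H2 : hilbertType R}.
Variables (A : {linear H1 -> H2}) (A_cont : continuous A).
Variables (e : nat -> H1) (rho : nat -> R) (g : nat -> H2).
Hypothesis rho_neq0 : forall k, rho k != 0.
Hypothesis e_norm : forall f, \sum_(k < K) inner f (e k) ^+ 2 @[K --> \oo] --> `|f| ^+ 2.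
Hypothesis A_norm : forall f,
  \sum_(k < K) (rho k * inner f (e k)) ^+ 2 @[K --> \oo] --> `|A f| ^+ 2.
Variables (alpha delta gamma c1 Mr F : R) (f0 : H1).
Hypotheses (alpha_ge0 : 0 <= alpha) (delta_gt0 : 0 < delta) (gamma_gt0 : 0 < gamma).
Hypotheses (c1_gt0 : 0 < c1) (rho_ge : forall k, c1 * weight k `^ (- alpha) <= rho k ^+ 2).
Hypotheses (Mr_gt0 : 0 < Mr) (rho_le : forall k, rho k ^+ 2 <= Mr).
Hypotheses (F_gt0 : 0 < F)
  (f0_le : forall K, \sum_(k < K) inner f0 (e k) ^+ 2 * weight k `^ gamma <= F).
Variable Pi : probability (borel H1) R.
Hypothesis Pi_seq :
  gauss_seq Pi (fun k (f : borel H1) => inner (f : H1) (e k)) (prior_var delta).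

(** [spread_const] and [centre_const] bound, in units of kappa^(-2 beta), the total
    posterior variance and, when the noise is not exceptionally large, the squared
    distance from the posterior mean to f0. *)
Definition spread_const : R := rate_const delta c1 / (2 * delta).
Definition centre_const : R := 2 * (1 + c1^-1) ^+ 2 * F + 2 * (spread_const + 1).

Lemma spread_const_gt0 : 0 < spread_const.
Proof. by rewrite divr_gt0 ?rate_const_gt0// mulr_gt0. Qed.

Lemma centre_const_ge0 : 0 <= centre_const.
Proof.
have s0 := ltW spread_const_gt0; have f1 := ltW F_gt0.
have q0 := sqr_ge0 (1 + c1^-1).
have h1 : 0 <= (1 + c1^-1) ^+ 2 * F by rewrite mulr_ge0.
by rewrite /centre_const -mulrA; lra.
Qed.

Variables (n : nat) (kappa : R).
Hypotheses (n_gt0 : (0 < n)%N) (kappa_ge1 : 1 <= kappa).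
Hypothesis nE : n%:R = kappa `^ (2 * alpha + 2 * delta + 1).
Let beta := Num.min delta gamma.
Let s := post_var delta rho n%:R.
Let lambda := kappa `^ (2 * beta).
Let kappa_gt0 : 0 < kappa. Proof. exact: lt_le_trans kappa_ge1. Qed.
Let lambda_gt0 : 0 < lambda. Proof. by rewrite powR_gt0. Qed.
Let lambdaV : kappa `^ (- (2 * beta)) = lambda^-1. Proof. by rewrite powRN. Qed.

Let half_expR1 : expR (- 1) <= 2^-1 :> R.
Proof.
by rewrite expRN lef_pV2 ?posrE ?expR_gt0//; have := expR_ge1Dx (1 : R); lra.
Qed.

Lemma posterior_tail_le (C M : R) (z : nat -> R) (Y : H2 -> R) : separable H1 ->
  spread_const + centre_const + 1 <= C ->
  (forall k, Y (g k) = rho k * inner f0 (e k) + n%:R `^ (- 2^-1) * z k) ->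
  (forall K, \sum_(k < K) s k * z k ^+ 2 <= (spread_const + 1) / lambda) ->
  (forall K, \sum_(k < K) k.+1%:R `^ (- (delta + 1)) * z k ^+ 2 <= M) ->
  0 <= posterior A e g rho Pi n Y [set f | C * kappa `^ (- beta) < `|f - f0|] <=
  4 * (expR (rate_const delta c1 / kappa * (2 * spread_const + 4 * centre_const)) - 1).
Proof.
move=> sepH hC YE hz hM.
have s0 := spread_const_gt0; have t0 := centre_const_ge0.
have C1 : 1 <= C by apply: le_trans hC; lra.
have sum_s K : \sum_(k < K) s k <= spread_const / lambda.
  by rewrite /s nE -lambdaV; apply: sum_spread_le.
pose y k := rho k * inner f0 (e k) + (kappa `^ (2 * alpha + 2 * delta + 1)) `^ (- 2^-1) * z k.
have yE : y = (fun k => Y (g k)) by apply/funext => k; rewrite YE nE.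
have sum_mu K : \sum_(k < K) (n%:R * rho k * y k * s k - inner f0 (e k)) ^+ 2 <=
    centre_const / lambda.
  rewrite -lambdaV /s nE.
  rewrite -lambdaV /s nE in hz.
  exact: (sum_sqr_centre_le (x0 := fun k => inner f0 (e k)) alpha_ge0 delta_gt0 gamma_gt0
    c1_gt0 rho_ge f0_le kappa_ge1 K hz).
have yM K : \sum_(k < K) k.+1%:R `^ delta * ((rho k * y k) ^+ 2 * prior_var delta k) <=
    Num.max 1 (Mr * (2 * Mr * F) * (2 `^ (delta + 1) / delta) + Mr * 2 * M).
  rewrite le_max; apply/orP; right.
  exact: (sum_data_le (x0 := fun k => inner f0 (e k)) alpha_ge0 delta_gt0 gamma_gt0
    Mr_gt0 rho_le F_gt0 f0_le kappa_ge1 K hM).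
apply: (posterior_mass_le A_cont rho_neq0 e_norm A_norm (prior_var_gt0 delta) Pi_seq n_gt0
  delta_gt0 _ yM sepH yE (G := Mr * (2 `^ (2 * delta + 1) / (2 * delta)))
  _ lambda_gt0 sum_s sum_mu).
- by rewrite lt_max ltr01.
- by move=> K; exact: sum_signal_le.
- move=> K; move: sum_s sum_mu; rewrite /s nE => sum_s sum_mu.
  exact: (sum_laplace_exponent_le (x0 := fun k => inner f0 (e k)) alpha_ge0 delta_gt0
    c1_gt0 rho_ge kappa_ge1 K erefl sum_s sum_mu).
- by rewrite mulr_ge0 ?powR_ge0// (le_trans ler01).
(* It remains that C^2 exceeds the constants by 1, as exp (- 1) <= 1 / 2. *)
have -> : lambda * (C * kappa `^ (- beta)) ^+ 2 = C ^+ 2.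
  rewrite exprMn -[X in _ * (_ * X)]powR_mulrn ?powR_ge0// -powRrM.
  rewrite (_ : - beta * 2%:R = - (2 * beta)); last by ring.
  by rewrite lambdaV mulrCA divff ?mulr1// gt_eqF.
rewrite !(mulrC lambda) !divfK ?gt_eqF//.
apply: (@le_trans _ _ (expR (- (spread_const + centre_const)) * expR (- 1))).
  rewrite -expRD ler_expR -opprD lerN2 (le_trans hC)// expr2.
  by rewrite ler_peMl// (le_trans ler01).
by rewrite ler_pM2l ?expR_gt0.
Qed.

(** The expectation of the sum is at most [spread_const] / lambda; one more unit of
    1 / lambda is enough of a margin for [gauss_seq_sqr_tail_sup], as 2 <= e. *)
Lemma noise_tail_le d (Om : measurableType d) (P : probability Om R) (Z : nat -> Om -> R) :
  gauss_seq P Z (fun=> 1) ->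
  (P (\bigcup_K [set w | ((spread_const + 1) / lambda < \sum_(k < K) s k * Z k w ^+ 2)%R]) <=
  (4 * (expR (2 * (rate_const delta c1 / kappa * spread_const)) - 1))%:E)%E.
Proof.
move=> gZ.
have s_gt0 k : 0 < s k by rewrite /s nE; exact: post_var_gt0.
have sum_s K : \sum_(k < K) s k <= spread_const / lambda.
  by rewrite /s nE -lambdaV; apply: sum_spread_le.
apply: (gauss_seq_sqr_tail_sup _ gZ s_gt0 _ lambda_gt0 sum_s) => // [K|].
  apply: (@le_trans _ _ (\sum_(k < K) rate_const delta c1 / kappa * lambda * s k)).
    apply: ler_sum => k _; rewrite expr2 -[leRHS]mulrA; apply: ler_wpM2r.
      by rewrite ltW// mulr_gt0.
    by rewrite /s nE; exact: scaled_spread_le.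
  rewrite -mulr_sumr -[leLHS]mulrA; apply: ler_wpM2l.
    by rewrite ltW// divr_gt0 ?rate_const_gt0.
  by rewrite -ler_pdivlMl// mulrC.
rewrite !(mulrC lambda) !divfK ?gt_eqF// opprD expRD.
by rewrite ler_pM2l ?expR_gt0.
Qed.

End contraction.

(** * Contraction in probability *)

Lemma natpow_cvgy {R : realType} (q : R) : 0 < q -> n%:R `^ q @[n --> \oo] --> +oo.
Proof.
move=> q0; apply/cvgryPge => a.
near=> n.
have n1 : (Num.max a 0) `^ q^-1 <= n%:R by near: n; exact: nbhs_infty_ger.
apply: (@le_trans _ _ (Num.max a 0)); first by rewrite le_max lexx.
have a0 : 0 <= Num.max a 0 by rewrite le_max lexx orbT.
have -> : Num.max a 0 = ((Num.max a 0) `^ q^-1) `^ q.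
  by rewrite -powRrM mulVf ?gt_eqF// powRr1.
by apply: ge0_ler_powR; rewrite ?nnegrE ?powR_ge0 ?ler0n// ltW.
Unshelve. all: by end_near.
Qed.

Lemma expR_div_natpow_cvg0 {R : realType} (q a : R) : 0 < q ->
  4 * (expR (a / (n%:R `^ q)) - 1) @[n --> \oo] --> (0 : R).
Proof.
move=> q0.
have inv0 : (n%:R `^ q)^-1 @[n --> \oo] --> (0 : R).
  apply/gtr0_cvgV0; last exact: natpow_cvgy.
  by exists 1%N => // n /= n1; rewrite powR_gt0// ltr0n.
have arg0 : a / n%:R `^ q @[n --> \oo] --> a * 0 by apply: cvgM inv0; exact: cvg_cst.
rewrite mulr0 in arg0.
have exp1 : expR (a / n%:R `^ q) @[n --> \oo] --> expR 0.
  exact: cvg_comp arg0 (@continuous_expR R 0).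
rewrite expR0 in exp1.
have lim : 4 * (expR (a / n%:R `^ q) - 1) @[n --> \oo] --> (4 * (1 - 1) : R).
  by apply: cvgM; [exact: cvg_cst|apply: cvgB exp1 _; exact: cvg_cst].
by rewrite subrr mulr0 in lim.
Qed.

Theorem proposition3p5 (R : realType) (H1 H2 : hilbertType R)
  (sepH1 : separable H1) (sepH2 : separable H2)
  (A : {linear H1 -> H2}) (A_cont : continuous A) (A_inj : injective A)
  (Aadj : {linear H2 -> H1}) (AadjP : is_adjoint A Aadj)
  (e : nat -> H1) (e_basis : orthonormal_basis e)
  (rho : nat -> R) (e_eigen : forall k, Aadj (A (e k)) = rho k ^+ 2 *: e k)
  (g : nat -> H2) (g_conj : forall k, A (e k) = rho k *: g k)
  (alpha : R) (alpha_ge0 : 0 <= alpha) (rho_ill : mildly_ill_posed rho alpha)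
  (gamma : R) (gamma_gt0 : 0 < gamma)
  (f0 : H1) (f0_sob : sobolev e gamma f0)
  (delta : R) (delta_gt0 : 0 < delta)
  (Lambda : {linear H1 -> H1})
  (Lambda_eigen : forall k, Lambda (e k) = weight k `^ (- delta - 2^-1) *: e k)
  (Pi : probability (borel H1) R) (Pi_gauss : gaussian_measure Pi Lambda) :
  exists2 C0 : R, 0 < C0 & forall C : R, C0 <= C ->
    forall (d : nat -> measure_display)
      (Om : forall n, measurableType (d n)) (P : forall n, probability (Om n) R)
      (Z : forall n, H2 -> Om n -> R),
      (forall n, white_noise (P n) (Z n)) ->
      cvg_in_probability P
        (fun n w =>
           posterior A e g rho Pi n (fun h => observation A f0 n (Z n) h w)
             [set f : H1 | `|f - f0| >
                C * n%:R `^ (- (Num.min delta gamma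
                                 / (2 * alpha + 2 * delta + 1)))])
        0.
Proof.
have [C1 [C2 [C1_gt0 C2_gt0 rho_near]]] := rho_ill.
have rho_neq0 := eigenvalue_neq0 A_inj e_basis g_conj.
have [c1 c1_gt0 rho_ge] : exists2 c1, 0 < c1 &
    forall k, c1 * weight k `^ (- alpha) <= rho k ^+ 2.
  have [|||c1 c1_gt0 hc1] := @near_pos_lower_bound R
      (fun k => rho k ^+ 2 * weight k `^ alpha) (C1 ^+ 2).
  - by move=> k; rewrite mulr_gt0 ?powR_gt0 ?weight_gt0 ?exprn_even_gt0 ?rho_neq0.
  - exact: exprn_gt0.
  - apply: filterS rho_near => k /andP[hk _].
    rewrite -ler_pdivrMr ?powR_gt0 ?weight_gt0// -powRN.
    rewrite -(real_normK (num_real (rho k))) (_ : - alpha = - (alpha / 2) * 2%:R); last by field.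
    rewrite powRrM powR_mulrn ?powR_ge0// -exprMn lerXn2r ?nnegrE//.
    by rewrite mulr_ge0 ?powR_ge0// ltW.
  exists c1 => // k.
  by rewrite powRN ler_pdivrMr ?powR_gt0 ?weight_gt0.
have [Mr Mr_gt0 rho_le] : exists2 Mr, 0 < Mr & forall k, rho k ^+ 2 <= Mr.
  apply: (@near_upper_bound _ _ (C2 ^+ 2)); apply: filterS rho_near => k /andP[_ hk].
  rewrite -(real_normK (num_real (rho k))) lerXn2r ?nnegrE ?(ltW C2_gt0)// (le_trans hk)//.
  rewrite ler_piMr ?(ltW C2_gt0)// -[leRHS](powRr0 (weight k)); apply: ler_powR.
    exact: weight_ge1.
  by rewrite oppr_le0 divr_ge0.
have [F F_gt0 f0_le] : exists2 F, 0 < F &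
    forall K, \sum_(k < K) inner f0 (e k) ^+ 2 * weight k `^ gamma <= F.
  by apply: nneseries_lt_bound f0_sob => k; rewrite mulr_ge0 ?sqr_ge0 ?powR_ge0.
have Pi_seq := gaussian_measure_gauss_seq Pi_gauss e_basis Lambda_eigen.
have e_norm := basis_norm e_basis.
have A_norm := operator_norm A_cont A_inj AadjP e_basis e_eigen g_conj.
have g_ortho := conjugate_orthonormal A_inj AadjP e_basis e_eigen g_conj.
pose S0 := spread_const delta c1.
pose T0 := centre_const delta c1 F.
have S0_gt0 : 0 < S0 by exact: spread_const_gt0.
have T0_ge0 : 0 <= T0 by exact: centre_const_ge0.
exists (S0 + T0 + 1); first by lra.
move=> C hC d Om P Z wZ eps eps_gt0.
pose p := 2 * alpha + 2 * delta + 1.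
have p_gt0 : 0 < p by rewrite ltr_wpDl// addr_ge0// mulr_ge0// ltW.
pose kappa n : R := n%:R `^ p^-1.
have noise_seq n : gauss_seq (P n) (fun k => Z n (g k)) (fun=> 1).
  by apply: (centered_gaussian_gauss_seq (wZ n)) => i j; rewrite g_ortho mulr1.
have obsE n w k : observation A f0 n (Z n) (g k) w =
    rho k * inner f0 (e k) + n%:R `^ (- 2^-1) * Z n (g k) w.
  by rewrite /observation (inner_conjugate A_inj AadjP e_basis e_eigen g_conj).
(* bad bounds the probability that the noise is exceptionally large, and mass the
   posterior mass otherwise. *)
pose bad n := 4 * (expR (2 * (rate_const delta c1 * S0) / kappa n) - 1).
pose mass n := 4 * (expR (rate_const delta c1 * (2 * S0 + 4 * T0) / kappa n) - 1).
have bad0 : bad n @[n --> \oo] --> 0 by apply: expR_div_natpow_cvg0; rewrite invr_gt0.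
have mass0 : mass n @[n --> \oo] --> 0 by apply: expR_div_natpow_cvg0; rewrite invr_gt0.
apply: (@squeeze_cvge _ _ _ _ (cst 0%E) _ (fun n => (bad n)%:E)).
- near=> n; apply/andP; split; first exact: measure_ge0.
  have n_gt0 : (0 < n)%N by near: n; exists 1%N.
  have mass_le : mass n <= eps. by near: n; exact: (cvgr_le _ mass0 _ eps_gt0).
  have nE : n%:R = kappa n `^ p.
    by rewrite -powRrM mulVf ?gt_eqF// powRr1.
  have kappa_ge1 : 1 <= kappa n.
    rewrite -[leLHS](powRr0 n%:R); apply: ler_powR; first by rewrite ler1n.
    by rewrite invr_ge0 ltW.
  rewrite (_ : n%:R `^ (- _) = kappa n `^ (- Num.min delta gamma)); last first.
    by rewrite -powRrM; congr (_ `^ _); rewrite mulrN mulrC.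
  set B := [set f : H1 | _].
  set lambda := kappa n `^ (2 * Num.min delta gamma).
  set s := post_var delta rho n%:R.
  set Bad := \bigcup_K [set w | ((S0 + 1) / lambda < \sum_(k < K) s k * Z n (g k) w ^+ 2)%R].
  have mBad : measurable Bad.
    by apply: bigcupT_measurable => K; exact: (measurable_sqr_sum_tail (noise_seq n)).
  have mB : measurable (B : set (borel H1)).
    rewrite (_ : B = (fun f : borel H1 => `|(f : H1) - f0|) @^-1`
        `]C * kappa n `^ (- Num.min delta gamma), +oo[%classic).
      by rewrite -[X in measurable X]setTI; apply: measurable_dist.
    by apply/seteqP; split => f; rewrite /= in_itv/= andbT.
  have [Nul [mNul PNul NulP]] : {ae P n, forall w,
      (\sum_(0 <= k <oo) (k.+1%:R `^ (- (delta + 1)) * Z n (g k) w ^+ 2)%:E < +oo)%E}.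
    apply: (gauss_seq_sqr_sum_ae _ (noise_seq n) _ (M := 2 `^ (delta + 1) / delta)) => // K.
    by under eq_bigr do rewrite mulr1; exact: sum_natpow_le.
  have sub : [set w | eps < `|posterior A e g rho Pi n
      (fun h => observation A f0 n (Z n) h w) B - 0| ] `<=` Bad `|` Nul.
    move=> w /= epsw; have [|nBad] := pselect (Bad w); first by left.
    right; apply: NulP => /= hw.
    have [M _ hM] := nneseries_lt_bound (fun k => mulr_ge0 (powR_ge0 _ _) (sqr_ge0 _)) hw.
    have hz K : \sum_(k < K) s k * Z n (g k) w ^+ 2 <= (S0 + 1) / lambda.
      by rewrite leNgt; apply/negP => h; apply: nBad; exists K.
    have /andP[post0 postle] := posterior_tail_le (g := g)
      (z := fun k => Z n (g k) w) (Y := fun h => observation A f0 n (Z n) h w)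
      A_cont rho_neq0 e_norm A_norm alpha_ge0
      delta_gt0 gamma_gt0 c1_gt0 rho_ge Mr_gt0 rho_le F_gt0 f0_le Pi_seq n_gt0 kappa_ge1
      nE sepH1 hC (obsE n w) hz hM.
    move: epsw; rewrite subr0 ger0_norm//; apply/negP; rewrite -leNgt.
    by rewrite (le_trans postle)// (le_trans _ mass_le)// /mass mulrAC.
  apply: (@le_trans _ _ (P n (Bad `|` Nul))).
    apply: le_measure => //; rewrite inE; last exact: measurableU.
    have mpost : measurable_fun [set: Om n] (fun w => `|posterior A e g rho Pi n
        (fun h => observation A f0 n (Z n) h w) B - 0|).
      apply: measurableT_comp => //; apply: measurable_funB => //.
      apply: measurable_posterior => // k; apply: measurable_funD => //.
      by apply: measurable_funM => //; exact: (gauss_seq_measurable (noise_seq n) k).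
    set E := [set w | _]; rewrite (_ : E = (fun w => `|posterior A e g rho Pi n
        (fun h => observation A f0 n (Z n) h w) B - 0|) @^-1` `]eps, +oo[%classic).
      by rewrite -[X in measurable X]setTI; exact: mpost.
    by apply/seteqP; split => w; rewrite /E/= in_itv/= andbT.
  have PU : (P n (Bad `|` Nul) <= P n Bad)%E.
    by rewrite -[leRHS]adde0 -PNul; exact: measureU2.
  apply: (le_trans PU).
  apply: (le_trans (noise_tail_le gamma alpha_ge0 delta_gt0 c1_gt0 rho_ge kappa_ge1 nE
    (noise_seq n))).
  rewrite lee_fin /bad /S0 [in leLHS]mulrAC [in leLHS]mulrA.
  exact: lexx.
- exact: cvg_cst.
- apply: cvg_EFin; first exact: nearW.
  exact: bad0.
Unshelve. all: by end_near.
Qed.
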